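(* Let $q\in(0,1]$. Then there exists a constant $c_0=c_0(q)$ such that for all $c\ge c_0$ there are constants $y=y(c,q)>0$ and $C=C(c,q)>0$ such that, with probability tending to $1$ as $d\to\infty$, the following both hold: (a) there is a unique component of $Q^d_{c/d}(q)$ of order at least $y2^d$ (the giant component), and all other components have order at most $Cd$; (b) the diameter of the giant component is at most $2^d/d^8$.
   Context: $Q^d$ is the $d$-dimensional binary hypercube. $Q^d_p$ is obtained from $Q^d$ by retaining each edge independently with probability $p$. For $p,q\in[0,1]$, the mixed-percolated hypercube $Q^d_p(q)$ is the induced subgraph $Q^d_p[V_q]$, where $V_q\subseteq V(Q^d)$ is a random set containing each vertex independently with probability $q$ (independently of the edge percolation). The order of a graph is its number of vertices. *)

(* Defs.v *)
From mathcomp Require Import all_boot all_order all_algebra.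
From mathcomp Require Import all_classical all_reals all_analysis.
Set Implicit Arguments.
Unset Strict Implicit.
Unset Printing Implicit Defensive.
Import Order.TTheory GRing.Theory Num.Theory.
Import numFieldNormedType.Exports.
Local Open Scope ring_scope.

Section Graphs.
Variable T : finType.
Implicit Types (e : rel T) (W K : {set T}).

Definition induced e W : rel T :=
  [rel x y | [&& x \in W, y \in W & e x y]].

(* Vertex sets of the components of the graph with vertex set W and
   adjacency relation e, where e only relates elements of W. *)
Definition components e W : {set {set T}} :=
  equivalence_partition (connect e) W.

Definition has_walk e (x y : T) (n : nat) : bool :=
  [exists w : n.-tuple T, path e x w && (last x w == y)].

(* The least length of a walk from x to y; a shortest walk repeats no vertex,
   so its length is less than #|T|. The value is #|T| if y is unreachable. *)
Definition dist e (x y : T) : nat := find (has_walk e x y) (iota 0 #|T|).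

(* Diameter of the subgraph induced on K (meant for K connected). *)
Definition diameter e K : nat :=
  \max_(x in K) \max_(y in K) dist (induced e K) x y.

End Graphs.

Section Hypercube.
Variable d : nat.

Definition vertex := {ffun 'I_d -> bool}.

Definition cube_adj : rel vertex :=
  [rel x y : vertex | #|[set i | x i != y i]| == 1%N].

Definition cube_edges : {set {set vertex}} :=
  [set [set xy.1; xy.2] | xy : vertex * vertex & cube_adj xy.1 xy.2].

(* Adjacency in the subgraph induced on W of the graph with edge set F. *)
Definition mixed_adj (W : {set vertex}) (F : {set {set vertex}}) : rel vertex :=
  induced [rel x y | [set x; y] \in F] W.

End Hypercube.

Section Percolation.
Variable R : realType.

(* Probability that the random subset of A keeping each element independently
   with probability p equals B, for B \subset A. *)
Definition subset_pmf (T : finType) (A : {set T}) (p : R) (B : {set T}) : R :=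
  \prod_(x in A) bernoulli_pmf p (x \in B).

(* Probability that the outcome (W, F) lies in the event A, where W = V_q is
   the set of retained vertices and F the set of retained edges of the
   hypercube. It is meaningful only for p and q in [0, 1]. *)
Definition mixed_prob (d : nat) (p q : R)
    (A : {set vertex d} -> {set {set vertex d}} -> bool) : R :=
  \sum_(W : {set vertex d})
    \sum_(F : {set {set vertex d}} | (F \subset cube_edges d) && A W F)
      subset_pmf [set: vertex d] q W * subset_pmf (cube_edges d) p F.

Definition giant_event (d : nat) (y C : R)
    (W : {set vertex d}) (F : {set {set vertex d}}) : bool :=
  let e := mixed_adj W F in
  [exists K : {set vertex d},
    [&& [set L in components e W | y * 2 ^+ d <= #|L|%:R] == [set K],
        [forall L in components e W, (L != K) ==> (#|L|%:R <= C * d%:R)]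
      & (diameter e K)%:R <= 2 ^+ d / d%:R ^+ 8 :> R]].

End Percolation.

(* Main.v *)
(* Reveal the percolation in two independent rounds, the second one ("sprinkling") with
   retention probabilities of order 1/d.

   For large c a Peierls argument, i.e. a union bound over depth-first codes of spanning
   trees combined with edge isoperimetry, shows that first-round clusters have either fewer
   than d vertices or at least M = 2^(d / constant), that every final connected set of d
   vertices meets a large first-round cluster, and that a vertex lies in a large cluster
   with probability bounded below.  Applied in about d^2 / 16 disjoint subcubes around each
   vertex, the last fact makes the set L of vertices in large clusters linear in size and
   2-dense in the cube.

   Delete a set X of vertices and split the rest of L into parts A and B that no
   first-round edge joins.  The hybrids of a in A and b in B run from a to b and meet a
   vertex near both parts or near X, so there are about |A| / poly(d) disjoint short paths
   from A to B around such vertices, each open in the second round with probability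
   1 / poly(d).  There are few choices of (X, A), since A is a union of clusters of size M
   apart from those cut by X.  Hence some path avoiding X opens for all of them at once.
   With X empty this merges all large clusters into one component; with X a thin
   breadth-first layer in the middle of a long geodesic it contradicts the definition of
   the layer, which bounds the diameter. *)
From mathcomp Require Import all_boot all_order all_algebra.
From mathcomp Require Import all_classical all_reals all_analysis.
From mathcomp Require Import zify ring lra.
From mathcomp Require Import ssrbool ssrfun eqtype ssrnat seq path fintype tuple.
From mathcomp Require Import finfun bigop finset fingraph.
Require Import Defs.
Set Implicit Arguments.
Unset Strict Implicit.
Unset Printing Implicit Defensive.
Import Order.TTheory GRing.Theory Num.Theory.
Import numFieldNormedType.Exports.
Local Open Scope ring_scope.

(** * Product Bernoulli measures on finite sets *)

(** The estimates pull [M] in two directions. The union bound over cuts is run with [M] above a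
    polynomial of degree 22 in [d], whereas the isoperimetric input of the Peierls bound is only
    useful for sets of at most [2 ^ (d / constant)] vertices. Taking [M = 2 ^ r] with [r] a small
    fraction of [d] leaves room for both, and is still small against [2 ^ d / d ^ 8]. The threshold
    [d] for small clusters comes from the union over [2 ^ d] roots, which a cluster probability
    [(q / 16) ^ u] beats once [u >= d]. Density uses two flips rather than one: about [d]
    independent trials fail with a probability exponential in [d], at a rate that for small [q] does
    not beat [2 ^ d] vertices, while [d ^ 2 / 16] trials do for large [d]. Since [L] is 2-dense,
    hybrids come within distance 3 of both sides of a cut, so a link uses at most 14 random items
    and, with sprinkling at [1 / d], opens with probability at least [d ^ -14]. Each vertex in the
    code of a cut is charged [4 ^ -d], so the sum over all codes inside a set of [2 ^ d] vertices
    stays bounded. *)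

Section BernoulliSets.
Variables (R : realType) (J : finType).
Implicit Types (pr : J -> R) (w A B : {set J}) (f g : {set J} -> R).

Definition bernoulli_weight pr w : R := \prod_j bernoulli_pmf (pr j) (j \in w).

Definition expect pr f : R := \sum_w bernoulli_weight pr w * f w.

Definition prob pr (E : pred {set J}) : R := expect pr (fun w => (E w)%:R).

Definition splice A w w' : {set J} := [set j | if j \in A then j \in w else j \in w'].

Definition depends_on (T : Type) (f : {set J} -> T) A :=
  forall w w', {in A, forall j, (j \in w) = (j \in w')} -> f w = f w'.

Definition proba_family pr := forall j, 0 <= pr j <= 1.

Lemma bernoulli_weight_ge0 pr w : proba_family pr -> 0 <= bernoulli_weight pr w.
Proof. by move=> h; apply: prodr_ge0 => j _; apply: bernoulli_pmf_ge0. Qed.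

Lemma sum_bernoulli_weight pr : \sum_w bernoulli_weight pr w = 1.
Proof.
have := @bigA_distr R 0 1 *%R +%R J pr (fun j => 1 - pr j).
rewrite big1 => [->|j _]; first exact: eq_bigr.
by rewrite /= addrC subrK.
Qed.

Lemma eq_expect pr f g : f =1 g -> expect pr f = expect pr g.
Proof. by move=> fg; apply: eq_bigr => w _; rewrite fg. Qed.

Lemma expect_cst pr a : expect pr (fun=> a) = a.
Proof. by rewrite /expect -mulr_suml sum_bernoulli_weight mul1r. Qed.

Lemma expectD pr f g : expect pr (fun w => f w + g w) = expect pr f + expect pr g.
Proof. by rewrite /expect -big_split; apply: eq_bigr => w _; rewrite mulrDr. Qed.

Lemma expectZ pr a f : expect pr (fun w => a * f w) = a * expect pr f.
Proof. by rewrite /expect mulr_sumr; apply: eq_bigr => w _; rewrite mulrCA. Qed.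

Lemma expect_sum pr (K : finType) (P : pred K) (F : K -> {set J} -> R) :
  expect pr (fun w => \sum_(k | P k) F k w) = \sum_(k | P k) expect pr (F k).
Proof.
rewrite /expect exchange_big; apply: eq_bigr => w _ /=.
by rewrite mulr_sumr.
Qed.

Lemma ler_expect pr f g :
  proba_family pr -> (forall w, f w <= g w) -> expect pr f <= expect pr g.
Proof.
move=> h fg; apply: ler_sum => w _.
by apply: ler_wpM2l (fg w); apply: bernoulli_weight_ge0.
Qed.

Lemma expect_ge0 pr f : proba_family pr -> (forall w, 0 <= f w) -> 0 <= expect pr f.
Proof. by move=> h f0; rewrite -(expect_cst pr 0) ler_expect. Qed.

Lemma bernoulli_weight_splice pr A w w' :
  bernoulli_weight pr (splice A w w') * bernoulli_weight pr (splice A w' w) =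
  bernoulli_weight pr w * bernoulli_weight pr w'.
Proof.
rewrite /bernoulli_weight -!big_split; apply: eq_bigr => j _ /=.
by rewrite !inE; case: ifP => _ //; rewrite mulrC.
Qed.

Lemma spliceK A w w' : splice A (splice A w w') (splice A w' w) = w.
Proof. by apply/setP => j; rewrite !inE; case: (j \in A). Qed.

(* Exchanging the coordinates outside [A] between two independent samples is a
   weight-preserving involution. *)
Lemma expect_swap pr A (F : {set J} -> {set J} -> R) :
  expect pr (fun w => expect pr (F w)) =
  expect pr (fun w => expect pr (fun w' => F (splice A w w') (splice A w' w))).
Proof.
pose ew := @bernoulli_weight pr.
have dbl (G : {set J} -> {set J} -> R) : expect pr (fun w => expect pr (G w)) =
    \sum_(ww : {set J} * {set J}) ew ww.1 * ew ww.2 * G ww.1 ww.2.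
  rewrite -(pair_bigA _ (fun w w' => ew w * ew w' * G w w')) /=.
  apply: eq_bigr => w _; rewrite mulr_sumr.
  by apply: eq_bigr => w' _; rewrite mulrA.
rewrite !dbl; pose h (ww : {set J} * {set J}) := (splice A ww.1 ww.2, splice A ww.2 ww.1).
rewrite (reindex_inj (h := h)) /=.
  by apply: eq_bigr => -[w w'] _ /=; rewrite /ew bernoulli_weight_splice.
apply: (can_inj (g := h)) => -[w w']; rewrite /h /=.
by rewrite !spliceK.
Qed.

(** This replaces conditioning on the coordinates in [A]: [w] fixes them, and [w'] is a fresh sample
    of all the others. *)
Lemma expect_splice pr A f :
  expect pr f = expect pr (fun w => expect pr (fun w' => f (splice A w w'))).
Proof.
rewrite -(expect_swap pr A (fun w _ => f w)).
by apply: eq_expect => w; rewrite expect_cst.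
Qed.

Lemma expectM_indep pr A B f g :
  [disjoint A & B] -> depends_on f A -> depends_on g B ->
  expect pr (fun w => f w * g w) = expect pr f * expect pr g.
Proof.
move=> dAB fA gB; rewrite (expect_splice pr A) mulrC -expectZ.
apply: eq_expect => w; rewrite mulrC -expectZ; apply: eq_expect => w'.
congr (_ * _); first by apply: fA => j jA; rewrite inE jA.
by apply: gB => j jB; rewrite inE (disjointFl dAB jB).
Qed.

Lemma depends_on2 (T T' T'' : Type) (h : T -> T' -> T'') (f : {set J} -> T)
    (g : {set J} -> T') A B :
  depends_on f A -> depends_on g B -> depends_on (fun w => h (f w) (g w)) (A :|: B).
Proof.
move=> fA gB w w' e; rewrite (fA w w') ?(gB w w') // => j jAB; apply: e.
  by rewrite inE jAB orbT.
by rewrite inE jAB.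
Qed.

Lemma depends_on_comp (T T' : Type) (h : T -> T') (f : {set J} -> T) A :
  depends_on f A -> depends_on (fun w => h (f w)) A.
Proof. by move=> fA w w' e; rewrite (fA w w' e). Qed.

Lemma depends_on_subset A : depends_on (fun w => A \subset w) A.
Proof. by move=> w w' e; apply/subsetP/subsetP => h j jA; have := h j jA; rewrite e. Qed.

Lemma depends_on_disjoint A : depends_on (fun w => [disjoint A & w]) A.
Proof.
move=> w w' e; rewrite !disjoint_subset.
by apply/subsetP/subsetP => h j jA; have := h j jA; rewrite !inE e.
Qed.

Lemma expect_prod_indep pr (K : finType) (P : pred K) (S : K -> {set J})
    (f : K -> {set J} -> R) :
  (forall k l, P k -> P l -> k != l -> [disjoint S k & S l]) ->
  (forall k, P k -> depends_on (f k) (S k)) ->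
  expect pr (fun w => \prod_(k | P k) f k w) = \prod_(k | P k) expect pr (f k).
Proof.
move=> dS fS.
have: {subset enum P <= P} by move=> k; rewrite mem_enum.
have eP (G : K -> R) : \prod_(k | P k) G k = \prod_(k <- enum P) G k.
  by rewrite big_enum.
rewrite (eq_expect pr (fun w => eP (fun k => f k w))) eP.
elim: (enum P) (enum_uniq P) => [|k s IHs] /=.
  by rewrite big_nil; under eq_expect do rewrite big_nil; rewrite expect_cst.
case/andP=> ks us sub; under eq_expect do rewrite big_cons.
have Pk : P k by apply: sub; rewrite mem_head.
have subs : {subset s <= P} by move=> l ls; apply: sub; rewrite inE ls orbT.
rewrite big_cons -IHs //.
apply: (@expectM_indep pr (S k) (\bigcup_(l in s) S l)); last 2 first.
- exact: fS.
- move=> w w' e; apply: eq_big_seq => l ls; apply: fS; first exact: subs.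
  by move=> j jS; apply: e; apply/bigcupP; exists l.
rewrite disjoint_subset; apply/subsetP => j jk; rewrite inE.
apply/bigcupP => -[l ls jl]; have kl : k != l by apply: contraNneq ks => ->.
by rewrite (disjointFr (dS k l Pk (subs l ls) kl) jk) in jl.
Qed.

Lemma prob_ge0 pr E : proba_family pr -> 0 <= prob pr E.
Proof. by move=> h; apply: expect_ge0. Qed.

Lemma prob_le pr (E E' : pred {set J}) :
  proba_family pr -> (forall w, E w -> E' w) -> prob pr E <= prob pr E'.
Proof.
move=> h EE'; apply: ler_expect => // w; rewrite ler_nat.
by case: (E w) (EE' w) => // ->.
Qed.

Lemma prob_le1 pr E : proba_family pr -> prob pr E <= 1.
Proof.
move=> h; rewrite -(expect_cst pr 1); apply: ler_expect => // w.
by rewrite lern1 leq_b1.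
Qed.

Lemma eq_prob pr (E E' : pred {set J}) : E =1 E' -> prob pr E = prob pr E'.
Proof. by move=> h; apply: eq_expect => w; rewrite h. Qed.

Lemma prob_not pr E : prob pr (fun w => ~~ E w) = 1 - prob pr E.
Proof.
apply/eqP; rewrite eq_sym subr_eq eq_sym -expectD -[eqbRHS](expect_cst pr 1).
by apply/eqP/eq_expect => w; case: (E w); rewrite ?addr0 ?add0r.
Qed.

Lemma prob_union pr (K : finType) (P : pred K) (E : K -> pred {set J}) :
  proba_family pr ->
  prob pr (fun w => [exists k, P k && E k w]) <= \sum_(k | P k) prob pr (E k).
Proof.
move=> h; rewrite -expect_sum; apply: ler_expect => // w.
case: existsP => [[k /andP[Pk Ek]]|_]; last by apply: sumr_ge0.
by rewrite (bigD1 k) //= Ek lerDl; apply: sumr_ge0.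
Qed.

Lemma prob_or pr E E' : proba_family pr ->
  prob pr (fun w => E w || E' w) <= prob pr E + prob pr E'.
Proof.
move=> h; rewrite -expectD; apply: ler_expect => // w.
by rewrite -natrD ler_nat; case: (E w); case: (E' w).
Qed.

Lemma prob_mem pr j : prob pr (fun w => j \in w) = pr j.
Proof.
rewrite /prob /expect.
(* Replacing the absent-factor of [j] by 0 in the expansion of the product keeps exactly the sets
   that contain [j]. *)
have := @bigA_distr R 0 1 *%R +%R J pr (fun i => if i == j then 0 else 1 - pr i).
rewrite (bigD1 j) //= eqxx addr0 big1 ?mulr1 => [->|i ij]; last first.
  by rewrite /= (negPf ij) addrC subrK.
apply: eq_bigr => w _; rewrite /bernoulli_weight.
have [jw|jw] := boolP (j \in w); last first.
  by rewrite mulr0 (bigD1 j) //= (negPf jw) eqxx mul0r.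
rewrite mulr1; apply: eq_bigr => i _; case: ifP => // iw.
by case: eqP => // ij; rewrite -ij iw in jw.
Qed.

Lemma bernoulli_prod (K : finType) (P : pred K) (E : K -> bool) :
  \prod_(k | P k) (E k)%:R = [forall k, P k ==> E k]%:R :> R.
Proof.
have [/forallP h|] := boolP [forall k, P k ==> E k].
  by rewrite big1 // => k Pk; move: (h k); rewrite Pk /= => ->.
rewrite negb_forall => /existsP[k]; rewrite negb_imply => /andP[Pk /negPf nE].
by rewrite (bigD1 k) //= nE mul0r.
Qed.

Lemma prob_and_indep pr A B (E E' : pred {set J}) :
  [disjoint A & B] -> depends_on E A -> depends_on E' B ->
  prob pr (fun w => E w && E' w) = prob pr E * prob pr E'.
Proof.
move=> dAB EA EB; rewrite -(@expectM_indep _ A B) //.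
- by apply: eq_expect => w; rewrite -natrM mulnb.
- by move=> w w' e; rewrite (EA w w' e).
- by move=> w w' e; rewrite (EB w w' e).
Qed.

Lemma prob_forall_indep pr (K : finType) (P : pred K) (S : K -> {set J})
    (E : K -> pred {set J}) :
  (forall k l, P k -> P l -> k != l -> [disjoint S k & S l]) ->
  (forall k, P k -> depends_on (E k) (S k)) ->
  prob pr (fun w => [forall k, P k ==> E k w]) = \prod_(k | P k) prob pr (E k).
Proof.
move=> dS ES; rewrite -(@expect_prod_indep pr K P S) //; last first.
  by move=> k Pk w w' e; rewrite (ES k Pk w w' e).
by apply: eq_expect => w; rewrite bernoulli_prod.
Qed.

Lemma prob_subset pr A : prob pr (fun w => A \subset w) = \prod_(j in A) pr j.
Proof.
transitivity (prob pr (fun w => [forall j, (j \in A) ==> (j \in w)])).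
  by apply: eq_prob => w; apply/subsetP/forall_inP.
rewrite (@prob_forall_indep _ _ _ (fun j => [set j])).
- by apply: eq_bigr => j _; rewrite prob_mem.
- by move=> k l _ _ kl; rewrite disjoints1 inE.
- by move=> k _ w w' e; apply: e; rewrite inE.
Qed.

Lemma prob_disjoint pr A :
  prob pr (fun w => [disjoint A & w]) = \prod_(j in A) (1 - pr j).
Proof.
transitivity (prob pr (fun w => [forall j, (j \in A) ==> (j \notin w)])).
  apply: eq_prob => w; rewrite disjoint_subset.
  by apply/subsetP/forall_inP => h j /h; rewrite inE.
rewrite (@prob_forall_indep _ _ _ (fun j => [set j])).
- by apply: eq_bigr => j _; rewrite prob_not prob_mem.
- by move=> k l _ _ kl; rewrite disjoints1 inE.
- by move=> k _ w w' e; rewrite e ?inE.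
Qed.

(* Markov's inequality applied to [2 ^ - X], where [X] counts the events that occur. *)
Lemma prob_few pr (K : finType) (S : K -> {set J}) (E : K -> pred {set J})
    (g : R) t :
  proba_family pr ->
  (forall k l, k != l -> [disjoint S k & S l]) ->
  (forall k, depends_on (E k) (S k)) -> (forall k, g <= prob pr (E k)) ->
  prob pr (fun w => #|[set k | E k w]| <= t)%N <= 2 ^+ t * (1 - g / 2) ^+ #|K|.
Proof.
move=> h dS ES gE.
pose f k w : R := 1 - (E k w)%:R / 2.
have Ef : expect pr (fun w => \prod_k f k w) <= (1 - g / 2) ^+ #|K|.
  rewrite (@expect_prod_indep _ _ _ S) //; last first.
  - by move=> k _ w w' e; rewrite /f (ES k w w' e).
  - by move=> k l _ _; apply: dS.
  rewrite -prodr_const; apply: ler_prod => k _.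
  have -> : expect pr (f k) = 1 - prob pr (E k) / 2.
    transitivity (expect pr (fun w => 1 + - 2^-1 * (E k w)%:R)).
      by apply: eq_expect => w; rewrite /f; lra.
    by rewrite (expectD pr (fun=> 1)) expectZ expect_cst /prob; lra.
  have := prob_le1 (E k) h; have := gE k; lra.
have t0 : 0 <= 2 ^+ t :> R by rewrite exprn_ge0.
apply: le_trans (ler_wpM2l t0 Ef); rewrite -expectZ; apply: ler_expect => // w.
have -> : \prod_k f k w = 2 ^- #|[set k | E k w]|.
  rewrite (bigID (E^~ w)) /= mulrC big1 ?mul1r => [|k /negPf]; last first.
    by rewrite /f => ->; rewrite mul0r subr0.
  rewrite -exprVn cardsE -prodr_const; apply: eq_bigr => k /= Ek.
  by rewrite /f Ek mulr1n; lra.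
case: leqP => [le_t|_] /=; last by rewrite mulr_ge0 // invr_ge0 exprn_ge0.
rewrite ler_pdivlMr ?exprn_gt0 // mul1r.
by apply: ler_weXn2l => //; rewrite ler1n.
Qed.

End BernoulliSets.

(** * Two-round exposure and the mixed-percolation model *)

Section Sprinkling.
Variables (R : realType) (I : finType).

(* [true] is the main round and [false] the sprinkled one. *)
Definition round (r : bool) (w : {set bool * I}) : {set I} := [set i | (r, i) \in w].

Definition rounds (w : {set bool * I}) : {set I} := round true w :|: round false w.

Lemma prob_rounds (pr : bool * I -> R) i :
  prob pr (fun w => i \in rounds w) = 1 - (1 - pr (true, i)) * (1 - pr (false, i)).
Proof.
transitivity (1 - prob pr (fun w => [disjoint [set (true, i); (false, i)] & w])).
  rewrite -prob_not; apply: eq_prob => w; rewrite !inE disjoints_subset subUset !sub1set !inE.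
  by case: ((true, i) \in w); case: ((false, i) \in w).
by rewrite prob_disjoint big_setU1 ?big_set1 // inE xpair_eqE.
Qed.

(** Membership of [i] in the union is decided by the two coordinates over [i], and these pairs are
    disjoint for different [i]. So the union is again a product Bernoulli set, and comparing point
    masses is enough. *)
Lemma expect_rounds (pr : bool * I -> R) (prI : I -> R) (f : {set I} -> R) :
  (forall i, 1 - prI i = (1 - pr (true, i)) * (1 - pr (false, i))) ->
  expect pr (fun w => f (rounds w)) = expect prI f.
Proof.
move=> hpr.
have weightE A : prob pr (fun w => rounds w == A) = bernoulli_weight prI A.
  transitivity (prob pr (fun w => [forall i, true ==> ((i \in rounds w) == (i \in A))])).
    apply: eq_prob => w; apply/eqP/forallP => [-> i|h]; first by rewrite eqxx.
    by apply/setP => i; apply/eqP/h.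
  rewrite (@prob_forall_indep _ _ _ _ _ (fun i => [set j | j.2 == i])) => [|k l _ _ kl|k _ w w' e].
  - apply: eq_bigr => i _; rewrite /bernoulli_pmf hpr.
    case: (i \in A).
      under eq_prob do rewrite eqb_id.
      by rewrite prob_rounds -hpr; lra.
    under eq_prob do rewrite eqbF_neg.
    by rewrite prob_not prob_rounds; lra.
  - rewrite disjoint_subset; apply/subsetP => j; rewrite !inE => /eqP->; exact: kl.
  - by rewrite !inE !e // inE.
rewrite /expect; under [RHS]eq_bigr do rewrite -weightE /prob /expect mulr_suml.
rewrite exchange_big /=; apply: eq_bigr => w _.
rewrite (bigD1 (rounds w)) //= eqxx mulr1 big1 ?addr0 // => A /negPf.
by rewrite eq_sym => ->; rewrite mulr0 mul0r.
Qed.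

End Sprinkling.

Section MixedPercolation.
Variables (R : realType) (d : nat).
Local Notation V := (vertex d).
Local Notation item := (V + {set V})%type.

Definition vertices_of (w : {set item}) : {set V} := [set v | inl v \in w].
Definition edges_of (w : {set item}) : {set {set V}} := [set e | inr e \in w].

(** Candidate edges range over all sets of vertices. Those outside the cube get probability 0, so
    that a single product measure on a fixed finite type carries both vertices and edges. *)
Definition mixed_proba (p q : R) (i : item) : R :=
  match i with inl _ => q | inr e => if e \in cube_edges d then p else 0 end.

Lemma mixed_probE (p q : R) (E : {set V} -> {set {set V}} -> bool) :
  mixed_prob p q E =
  prob (mixed_proba p q)
    (fun w => (edges_of w \subset cube_edges d) && E (vertices_of w) (edges_of w)).
Proof.
pose h (WF : {set V} * {set {set V}}) : {set item} :=
  [set i | match i with inl v => v \in WF.1 | inr e => e \in WF.2 end].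
have h1 WF : vertices_of (h WF) = WF.1 by apply/setP => v; rewrite !inE.
have h2 WF : edges_of (h WF) = WF.2 by apply/setP => v; rewrite !inE.
rewrite /prob /expect (reindex h) /=; last first.
  apply: onW_bij; exists (fun w => (vertices_of w, edges_of w)) => [[W F]|w].
    by rewrite h1 h2.
  by apply/setP => -[v|e]; rewrite !inE.
rewrite -(pair_bigA _ (fun W F => bernoulli_weight (mixed_proba p q) (h (W, F)) *
   ((edges_of (h (W, F)) \subset cube_edges d)
     && E (vertices_of (h (W, F))) (edges_of (h (W, F))))%:R)) /=.
apply: eq_bigr => W _; rewrite big_mkcond; apply: eq_bigr => F _ /=.
rewrite h1 h2 /=; case: ifP => [/andP[FE _]|_]; last by rewrite mulr0.
rewrite mulr1 /bernoulli_weight big_sumType /=; congr (_ * _).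
  rewrite /subset_pmf; apply: eq_big => [v|v _]; first by rewrite inE.
  by rewrite inE.
rewrite /subset_pmf [RHS](bigID (mem (cube_edges d))) /=.
rewrite [X in _ = _ * X]big1 ?mulr1 => [|e /negPf eE].
  by apply: eq_bigr => e; rewrite !inE => ->.
by rewrite inE eE /bernoulli_pmf ifF ?subr0 //; apply: contraFF eE => /(subsetP FE).
Qed.

Lemma mixed_prob_le1 (p q : R) (E : {set V} -> {set {set V}} -> bool) :
  0 <= p <= 1 -> 0 <= q <= 1 -> mixed_prob p q E <= 1.
Proof.
move=> hp hq; rewrite mixed_probE; apply: prob_le1 => -[v|e] //=.
by case: ifP => // _; rewrite lexx ler01.
Qed.

(* Since [mixed_prob] never charges edge sets that leave the hypercube, its events only
   matter on the subsets of [cube_edges d]. *)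
Lemma mixed_prob_rounds (p q : R) (pr : bool * item -> R)
    (E : {set V} -> {set {set V}} -> bool) :
  (forall v, 1 - q = (1 - pr (true, inl v)) * (1 - pr (false, inl v))) ->
  (forall e, e \in cube_edges d ->
     1 - p = (1 - pr (true, inr e)) * (1 - pr (false, inr e))) ->
  (forall r e, e \notin cube_edges d -> pr (r, inr e) = 0) ->
  mixed_prob p q E =
  prob pr (fun w => (edges_of (rounds w) \subset cube_edges d)
                    && E (vertices_of (rounds w)) (edges_of (rounds w))).
Proof.
move=> hv he h0; rewrite mixed_probE /prob -(@expect_rounds _ _ pr) // => -[v|e] /=.
  exact: hv.
by case: ifP => [/he //|/negbT eE]; rewrite !h0 // !subr0 mulr1.
Qed.

End MixedPercolation.

(** * Edges of the hypercube *)

Section CubeGeometry.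
Local Open Scope nat_scope.
Variable d : nat.
Local Notation V := (vertex d).
Implicit Types (x y z v : V) (i j : 'I_d) (U S T X : {set V}).

Definition flip x i : V := [ffun j => x j (+) (j == i)].

Lemma flipK i : involutive (flip^~ i).
Proof. by move=> x; apply/ffunP => j; rewrite !ffunE -addbA addbb addbF. Qed.

Lemma flip_injl i : injective (flip^~ i).
Proof. exact: inv_inj (@flipK i). Qed.

Lemma flip_inj x : injective (flip x).
Proof.
move=> i j /ffunP/(_ i); rewrite !ffunE eqxx => /addbI.
by case: eqP.
Qed.

Lemma flip_at x i : flip x i i = ~~ x i.
Proof. by rewrite ffunE eqxx addbT. Qed.

Lemma flip_off x i j : j != i -> flip x i j = x j.
Proof. by move=> /negPf ji; rewrite ffunE ji addbF. Qed.

Lemma cube_adjP x y : reflect (exists i, y = flip x i) (cube_adj x y).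
Proof.
apply: (iffP cards1P) => [[i Ei]|[i ->]]; exists i.
  apply/ffunP => j; rewrite ffunE; have /setP/(_ j) := Ei.
  by rewrite !inE => <-; case: (x j); case: (y j).
apply/setP => j; rewrite !inE ffunE.
by case: (j == i); rewrite ?addbT ?addbF ?eqxx //; case: (x j).
Qed.

Lemma cube_adj_flip x i : cube_adj x (flip x i).
Proof. by apply/cube_adjP; exists i. Qed.

Lemma cube_adj_sym x y : cube_adj x y = cube_adj y x.
Proof. by congr (_ == _); apply: eq_card => i; rewrite !inE eq_sym. Qed.

Lemma cube_adjxx x : cube_adj x x = false.
Proof.
apply/negbTE/negP => /cube_adjP[i /ffunP/(_ i)].
by rewrite flip_at; case: (x i).
Qed.

Lemma cube_edgesP x y : ([set x; y] \in cube_edges d) = cube_adj x y.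
Proof.
apply/imsetP/idP => [[[a b]]|xy]; last by exists (x, y); rewrite ?inE.
rewrite inE /= => ab E.
have : x \in [set a; b] by rewrite -E set21.
have : y \in [set a; b] by rewrite -E set22.
rewrite !inE => /orP[]/eqP yE /orP[]/eqP xE; rewrite xE yE // ?cube_adjxx in E *.
- have : b \in [set a; a] by rewrite E set22.
  by rewrite !inE orbb => /eqP ba; rewrite ba cube_adjxx in ab.
- by rewrite cube_adj_sym.
- have : a \in [set b; b] by rewrite E set21.
  by rewrite !inE orbb => /eqP ba; rewrite ba cube_adjxx in ab.
Qed.

Definition degree_in U x := #|[set i | flip x i \in U]|.

Lemma degree_in_le U x : (degree_in U x <= d)%N.
Proof. by rewrite -[X in (_ <= X)%N]card_ord max_card. Qed.

Lemma degree_inS U T x : U \subset T -> (degree_in U x <= degree_in T x)%N.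
Proof. by move=> /subsetP h; apply/subset_leq_card/subsetP => i; rewrite !inE => /h. Qed.

Lemma degree_inE U x : degree_in U x = \sum_i (flip x i \in U).
Proof.
rewrite /degree_in -sum1_card big_mkcond; apply: eq_bigr => i _.
by rewrite inE; case: ifP.
Qed.

Lemma sum_degree_inC S T :
  (\sum_(x in S) degree_in T x = \sum_(y in T) degree_in S y)%N.
Proof.
under eq_bigr do rewrite degree_inE; under [RHS]eq_bigr do rewrite degree_inE.
rewrite exchange_big [RHS]exchange_big /=; apply: eq_bigr => i _.
rewrite big_mkcond [RHS]big_mkcond (reindex_inj (@flip_injl i)) /=.
by apply: eq_bigr => x _; rewrite flipK; case: (x \in T); case: (flip x i \in S).
Qed.

(* Cutting [U] along a coordinate on which it is not constant creates at most as many
   crossing edges as the smaller half has vertices. *)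
Lemma inner_degree_le k U : (#|U| <= 2 ^ k)%N ->
  (\sum_(x in U) degree_in U x <= 2 * k * #|U|)%N.
Proof.
have [n] := ubnP #|U|; elim: n k U => // n IHn k U; rewrite ltnS => Un Uk.
have [U1|U1] := leqP #|U| 1.
  rewrite big1 // => x xU; apply/eqP; rewrite cards_eq0; apply/eqP/setP => i.
  rewrite !inE; apply/negbTE/negP => fU.
  have := cube_adj_flip x i.
  by rewrite -(card_le1_eqP U1 (flip x i) x fU xU) cube_adjxx.
have /card_gt1P[x [y [xU yU xy]]] := U1.
have [i xyi] : exists i, x i != y i.
  apply/existsP; apply: contraNT xy => /existsPn h.
  by apply/eqP/ffunP => i; have := h i; rewrite negbK => /eqP.
pose B b := [set z in U | z i == b].
have BU b : B b \subset U by apply/subsetP => z; rewrite inE => /andP[].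
have cardB : #|U| = (#|B true| + #|B false|)%N.
  rewrite -(cardsID (B true) U) (setIidPr (BU true)); congr (_ + _)%N.
  by apply: eq_card => z; rewrite !inE; case: (z \in U); case: (z i).
have B0 b : (0 < #|B b|)%N.
  apply/card_gt0P; have [xb|xb] := eqVneq (x i) b; [exists x|exists y]; rewrite inE ?xU ?yU ?xb //=.
  by move: xb xyi; case: (x i); case: (y i); case: b.
have cross b : (\sum_(z in B b) (flip z i \in B (~~ b)) <= minn #|B b| #|B (~~ b)|)%N.
  rewrite leq_min; apply/andP; split.
    by rewrite -sum1_card; apply: leq_sum => z _; apply: leq_b1.
  rewrite -[leqRHS]sum1_card [leqRHS]big_mkcond [leqRHS](reindex_inj (@flip_injl i)) /=.
  rewrite big_mkcond /=; apply: leq_sum => z _; case: ifP => // _; exact: leqnn.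
have half b : (\sum_(z in B b) degree_in U z <=
    \sum_(z in B b) degree_in (B b) z + minn #|B b| #|B (~~ b)|)%N.
  apply: leq_trans (leq_add (leqnn _) (cross b)); rewrite -big_split /=.
  apply: leq_sum => z; rewrite inE => /andP[zU /eqP zb].
  rewrite !degree_inE (bigD1 i) //= [X in (_ <= X + _)%N](bigD1 i) //=.
  rewrite !inE flip_at zb eqxx andbT addnC leq_add // -[leqLHS]addn0 addnC leq_add //.
  by apply: leq_sum => j ji; rewrite !inE flip_off 1?eq_sym // zb eqxx andbT.
have splitU : (\sum_(z in U) degree_in U z =
    \sum_(z in B true) degree_in U z + \sum_(z in B false) degree_in U z)%N.
  rewrite (big_setID (B true)) /= (setIidPr (BU true)); congr (_ + _)%N.
  by apply: eq_bigl => z; rewrite !inE; case: (z \in U); case: (z i).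
have [b Bb] : exists b, (#|B b| <= #|B (~~ b)|)%N.
  by have [?|/ltnW ?] := leqP #|B true| #|B false|; [exists true|exists false].
have cU : (\sum_(z in U) degree_in U z <= 
  \sum_(z in B b) degree_in (B b) z + \sum_(z in B (~~ b)) degree_in (B (~~ b)) z + 2 * #|B b|)%N.
  rewrite splitU; have := half true; have := half false.
  by case: b Bb => /= Bb; lia.
have cB : #|U| = (#|B b| + #|B (~~ b)|)%N by rewrite cardB; case: (b); rewrite 1?addnC.
case: k Uk => [|k] Uk; first by rewrite expn0 in Uk; lia.
(* The smaller half has at most [2 ^ k] vertices, so its bound saves 2 per vertex, which pays
   exactly for the [2 * #|B b|] crossing incidences. *)
have h1 := IHn k (B b); have h2 := IHn k.+1 (B (~~ b)).
have := B0 b; have := B0 (~~ b); rewrite expnS in Uk h2 => p1 p2.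
have {}h1 : \sum_(x in B b) degree_in (B b) x <= 2 * k * #|B b| by apply: h1; lia.
have {}h2 : \sum_(x in B (~~ b)) degree_in (B (~~ b)) x <= 2 * k.+1 * #|B (~~ b)|.
  by apply: h2; lia.
nia.
Qed.

End CubeGeometry.

Section LightBoundary.
Local Open Scope nat_scope.
Variable d : nat.
Local Notation V := (vertex d).

(* Boundary vertices [w] with more than [d / kappa] neighbours in [U'] are few, and
   [inner_degree_le] shows that they receive few of the edges leaving [U']. *)
Lemma light_boundary (Z U U' : {set V}) kappa k :
  0 < d -> U \subset Z -> U' \subset U -> 7 * #|U| <= 8 * #|U'| ->
  {in Z, forall x, d <= 2 * degree_in Z x} ->
  #|U| * kappa.+1 <= 2 ^ k -> 16 * (k * kappa.+2) <= d ->
  #|U| * d <=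
  4 * \sum_(w in Z :\: U | degree_in U' w * kappa <= d) degree_in U' w.
Proof.
move=> d0 UZ U'U hU' degZ Uk hd.
set light := \sum_(w in _ | _) _.
pose T := [set w in Z :\: U | d < degree_in U' w * kappa].
have S1 : \sum_(s in U') degree_in (Z :\: U) s = light + \sum_(w in T) degree_in U' w.
  rewrite sum_degree_inC (bigID (fun w => degree_in U' w * kappa <= d)) /=.
  congr (_ + _); apply: eq_bigl => w; by rewrite [in RHS]inE -ltnNge.
have S2 : #|U'| * d <= 2 * \sum_(s in U') degree_in Z s.
  rewrite -sum_nat_const big_distrr /=; apply: leq_sum => s sU'.
  exact: degZ (subsetP UZ _ (subsetP U'U _ sU')).
have S3 : \sum_(s in U') degree_in Z s <=
    \sum_(s in U') degree_in (Z :\: U) s + \sum_(s in U) degree_in U s.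
  apply: (@leq_trans (\sum_(s in U') (degree_in (Z :\: U) s + degree_in U s))).
    apply: leq_sum => s _; rewrite !degree_inE -big_split; apply: leq_sum => i _ /=.
    by rewrite inE; case: (flip s i \in U); case: (flip s i \in Z).
  rewrite big_split leq_add2l /= (big_setID U' (A := U)) /= (setIidPr U'U).
  exact: leq_addr.
have uk : #|U| <= 2 ^ k by apply: leq_trans Uk; rewrite leq_pmulr.
have S4 := inner_degree_le uk.
(* Markov's inequality for degrees: each vertex of [T] receives more than [d / kappa] of the at most
   [#|U'| * d] edges leaving the vertices of [U']. *)
have cT : #|T| <= kappa * #|U|.
  rewrite -(leq_pmul2r d0) -sum_nat_const.
  apply: (@leq_trans (kappa * \sum_(w in [set: V]) degree_in U' w)).
    rewrite [leqRHS]mulnC big_distrl /= [leqRHS](big_setID T) /= setTI.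
    apply: leq_trans (leq_addr _ _); apply: leq_sum => w.
    by rewrite inE => /andP[_ /ltnW].
  rewrite sum_degree_inC -mulnA leq_mul2l; apply/orP; right.
  apply: (@leq_trans (#|U'| * d)); last by rewrite leq_mul2r subset_leq_card ?orbT.
  by rewrite -sum_nat_const; apply: leq_sum => s _; apply: degree_in_le.
have cUT : #|U :|: T| <= #|U| * kappa.+1.
  by apply: leq_trans (leq_card_setU _ _) _; rewrite mulnS leq_add2l mulnC.
have S5 := inner_degree_le (leq_trans cUT Uk).
have S6 : \sum_(w in T) degree_in U' w <= \sum_(w in U :|: T) degree_in (U :|: T) w.
  rewrite [leqRHS](big_setID T) /= (setIidPr (subsetUr _ _)).
  apply: leq_trans (leq_addr _ _); apply: leq_sum => w _; apply: degree_inS.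
  exact: subset_trans U'U (subsetUl _ _).
have S7 : 2 * k * #|U :|: T| <= 2 * k * (#|U| * kappa.+1) by rewrite leq_mul2l cUT orbT.
have S8 : #|U| * (16 * (k * kappa.+2)) <= #|U| * d by rewrite leq_mul2l hd orbT.
have S9 : 7 * #|U| * d <= 8 * #|U'| * d by rewrite leq_mul2r hU' orbT.
clear -S1 S2 S3 S4 S5 S6 S7 S8 S9.
move: S1 S2 S3 S4 S5 S6 S7 S8 S9.
move: (\sum_(s in U') degree_in (Z :\: U) s) (\sum_(s in U') degree_in Z s).
move: (\sum_(s in U) degree_in U s) (\sum_(w in U :|: T) degree_in (U :|: T) w).
move: (\sum_(w in T) _) => t a b c e.
move: #|U| #|U'| #|U :|: T| => u u' ut.
rewrite -!mulnA => S1 S2 S3 S4 S5 S6 S7 S8 S9.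
(* In units of [#|U| * d], the degrees from [U'] into [Z] sum to at least 7/16. Edges inside [U] and
   edges to [T] together take at most [2 * k * kappa.+2 / d <= 2/16], so at least 5/16, hence 1/4,
   is left for the light vertices. *)
have E1 : u * (16 * (k * kappa.+2)) = 16 * (k * (u * kappa.+1)) + 16 * (k * u) by ring.
rewrite E1 in S8; lia.
Qed.

End LightBoundary.

(** * Connected sets and their depth-first codes *)

Section ConnectedSets.
Local Open Scope nat_scope.
Variables (T : finType) (e : rel T).
Hypothesis e_sym : symmetric e.
Implicit Types (U W : {set T}).

Definition connected_from U v := [forall x in U, connect (induced e U) v x].

Lemma induced_sym U : symmetric (induced e U).
Proof. by move=> x y; rewrite /induced /= e_sym andbCA. Qed.

Lemma connected_exit U W v z : connected_from U v -> z \in U -> v \in W -> z \notin W ->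
  exists x y, [/\ x \in W, x \in U, y \in U, y \notin W & e x y].
Proof.
move=> /forall_inP cU zU vW zW.
have [/existsP[x /existsP[y /and5P[*]]]|/existsPn no] := boolP [exists x, [exists y,
    [&& x \in W, x \in U, y \in U, y \notin W & e x y]]]; first by exists x, y; split.
have half x y : induced e U x y -> x \in W -> y \in W.
  move=> /and3P[xU yU exy] xW; have /existsPn/(_ y) := no x.
  by rewrite xW xU yU exy andbT negbK.
have cl : closed (induced e U) (mem W).
  move=> x y exy; apply/idP/idP; apply: half => //.
  by rewrite induced_sym.
by have := closed_connect cl (cU z zU); rewrite /= vW (negPf zW).
Qed.

(** Induction principle behind both [connected_subset] and [tree_code]: a connected set can be built
    from its root by adding one adjacent vertex at a time, with any data [P] carried along. *)
Lemma connected_grow (P : {set T} -> Prop) U v n :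
  connected_from U v -> v \in U -> P [set v] ->
  (forall U' x y, U' \subset U -> v \in U' -> x \in U' -> y \in U -> y \notin U' ->
     e x y -> P U' -> P (y |: U')) ->
  0 < n <= #|U| -> exists2 U', P U' & [/\ U' \subset U, v \in U' & #|U'| = n].
Proof.
move=> cU vU P1 PS; elim: n => // n IHn /= nU.
case: n IHn nU => [_ _|n IHn nU].
  by exists [set v]; rewrite ?sub1set ?set11 ?cards1.
have [|U' PU' [U'U vU' cU']] := IHn; first exact: ltnW nU.
have /subsetPn[z zU zU'] : ~~ (U \subset U').
  by apply: contraL nU => /subset_leq_card; rewrite cU' -ltnNge ltnS.
have [x [y [xU' xU yU yU' exy]]] := connected_exit cU zU vU' zU'.
exists (y |: U'); first exact: (PS U' x y).
by rewrite subUset sub1set yU U'U cardsU1 yU' cU' inE vU' orbT.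
Qed.

Lemma connected_fromW U W v : U \subset W -> connected_from U v ->
  {in U, forall x, connect (induced e W) v x}.
Proof.
move=> /subsetP UW /forall_inP cU x xU; apply: connect_sub (cU x xU) => a b.
by rewrite /induced => /and3P[aU bU eab]; apply: connect1; rewrite /= !UW.
Qed.

Lemma connected_add U v x y : connected_from U v -> v \in U -> x \in U -> e x y ->
  connected_from (y |: U) v.
Proof.
move=> cU vU xU exy; have cW := connected_fromW (subsetUr [set y] U) cU.
apply/forall_inP => z; rewrite !inE => /orP[/eqP->|]; last exact: cW.
by apply: connect_trans (cW x xU) (connect1 _); rewrite /induced /= !inE eqxx xU orbT.
Qed.

Lemma connected_from1 v : connected_from [set v] v.
Proof. by apply/forall_inP => x; rewrite inE => /eqP->; apply: connect0. Qed.

Lemma connected_subset U v n : connected_from U v -> v \in U -> 0 < n <= #|U| ->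
  exists2 U', connected_from U' v & [/\ U' \subset U, v \in U' & #|U'| = n].
Proof.
move=> cU vU; apply: connected_grow => //; first exact: connected_from1.
by move=> U' x y _ vU' xU' _ _ exy cU'; apply: connected_add exy.
Qed.

End ConnectedSets.

Section TreeCodes.
Local Open Scope nat_scope.
Variable d : nat.
Local Notation V := (vertex d).

(* Depth-first codes of rooted trees in the cube: [Some i] moves along direction [i] to
   a new child, [None] backtracks; [st] is the branch from the current vertex to the
   root. *)
Fixpoint tree_arcs (st : seq V) (s : seq (option 'I_d)) : seq (V * V) :=
  match s, st with
  | Some i :: s', x :: _ => (x, flip x i) :: tree_arcs (flip x i :: st) s'
  | None :: s', _ :: st' => tree_arcs st' s'
  | _, _ => [::]
  end.

Fixpoint tree_branch (st : seq V) (s : seq (option 'I_d)) : seq V :=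
  match s, st with
  | Some i :: s', x :: _ => tree_branch (flip x i :: st) s'
  | None :: s', _ :: st' => tree_branch st' s'
  | _, _ => st
  end.

Definition arc_edge (a : V * V) : {set V} := [set a.1; a.2].
Definition tree_edges v s := map arc_edge (tree_arcs [:: v] s).
Definition tree_vertices v s := v :: map snd (tree_arcs [:: v] s).

Lemma tree_arcs_nil s : tree_arcs [::] s = [::].
Proof. by case: s => [|[]]. Qed.

Lemma tree_arcs_cat st s1 s2 :
  tree_arcs st (s1 ++ s2) = tree_arcs st s1 ++ tree_arcs (tree_branch st s1) s2.
Proof.
elim: s1 st => [|[i|] s1 IH] [|x st] //=; rewrite ?IH ?tree_arcs_nil //.
Qed.

(** Finds a moment at which the traversal stands at [y], which is where a new leaf below [y] can be
    inserted into the code. *)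
Lemma tree_branch_visit st s y : y \in map snd (tree_arcs st s) ->
  exists s1 s2 st', s = s1 ++ s2 /\ tree_branch st s1 = y :: st'.
Proof.
elim: s st => [|[i|] s IH] [|x st] //=.
  rewrite inE => /orP[/eqP->|/IH[s1 [s2 [st' [-> e]]]]].
    by exists [:: Some i], s, (x :: st); case: s {IH}.
  by exists (Some i :: s1), s2, st'.
by move=> /IH[s1 [s2 [st' [-> e]]]]; exists (None :: s1), s2, st'.
Qed.

(** A new vertex is attached by inserting the detour [Some i; None] at a moment when the traversal
    is at its neighbour. The branch is the same before and after the detour, so the rest of the code
    keeps its meaning. Each vertex other than the root thus costs two letters, one of them a
    direction. *)
Lemma tree_code (e : rel V) (U : {set V}) v :
  symmetric e -> subrel e (@cube_adj d) -> connected_from e U v -> v \in U ->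
  exists2 s, size s = 2 * #|U|.-1 /\ count isSome s = #|U|.-1 &
    [/\ uniq (tree_edges v s), size (tree_edges v s) = #|U|.-1,
        [set x in tree_vertices v s] = U &
        all (fun a => e a.1 a.2) (tree_arcs [:: v] s)].
Proof.
move=> e_sym e_cube cU vU.
pose P (U' : {set V}) := exists2 s, size s = 2 * #|U'|.-1 /\ count isSome s = #|U'|.-1 &
  [/\ uniq (tree_edges v s), size (tree_edges v s) = #|U'|.-1,
        [set x in tree_vertices v s] = U',
        all (fun a => e a.1 a.2) (tree_arcs [:: v] s) &
        all (fun a => a.1 \in U') (tree_arcs [:: v] s)].
have P1 : P [set v].
  exists [::]; rewrite ?cards1 //; split=> //=.
  by apply/setP => x; rewrite !inE.
have U0 : 0 < #|U| by apply/card_gt0P; exists v.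
suff step : forall (U' : {set V}) x y, U' \subset U -> v \in U' -> x \in U' -> y \in U ->
    y \notin U' -> e x y -> P U' -> P (y |: U').
  have [|U' [s sz [us se sU es _]] [U'U _ cU']] :=
    @connected_grow _ e e_sym P U v #|U| cU vU P1 step; first by rewrite U0 leqnn.
  have /eqP UU : U' == U by rewrite eqEcard U'U cU' leqnn.
  by rewrite UU in sz se sU; exists s.
move=> U' x y U'U vU' xU' yU yU' exy [s [szs cs] [us se sU es sub]].
have /cube_adjP[i yE] := e_cube _ _ exy.
have [s1 [s2 [st' [sE stE]]]] : exists s1 s2 st', s = s1 ++ s2 /\ tree_branch [:: v] s1 = x :: st'.
  move: xU'; rewrite -{1}sU !inE => /orP[/eqP->|]; last exact: tree_branch_visit.
  by exists [::], s, [::].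
pose s' := s1 ++ [:: Some i; None] ++ s2.
have arcsE : tree_arcs [:: v] s' =
    tree_arcs [:: v] s1 ++ (x, y) :: tree_arcs (x :: st') s2.
  by rewrite /s' tree_arcs_cat stE /= -yE.
have arcsE0 : tree_arcs [:: v] s = tree_arcs [:: v] s1 ++ tree_arcs (x :: st') s2.
  by rewrite sE tree_arcs_cat stE.
have pm : perm_eq (tree_arcs [:: v] s') ((x, y) :: tree_arcs [:: v] s).
  by rewrite arcsE arcsE0 -(cat1s (x, y) (tree_arcs (x :: st') s2)) perm_catCA.
have pe : perm_eq (tree_edges v s') ([set x; y] :: tree_edges v s).
  by rewrite (perm_map arc_edge pm).
have c1 : #|y |: U'|.-1 = #|U'|.-1.+1.
  by rewrite cardsU1 yU' add1n /= prednK //; apply/card_gt0P; exists v.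
exists s'; rewrite c1.
  split; first by rewrite mulnS -szs /s' sE !size_cat addnCA.
  by rewrite -cs /s' sE !count_cat addnCA.
split.
- rewrite (perm_uniq pe) /= us andbT; apply/mapP => -[a aS /setP/(_ y)].
  rewrite !inE eqxx orbT => /esym/orP[]/eqP ya.
    by rewrite ya (allP sub a aS) in yU'.
  by move: yU'; rewrite -sU inE ya /tree_vertices inE (map_f snd aS) orbT.
- by rewrite (perm_size pe) /= se.
- apply/setP => z; rewrite -sU !inE.
  by rewrite (perm_mem (perm_map snd pm)) /= inE orbCA.
- by rewrite (perm_all _ pm) /= exy es.
- rewrite (perm_all _ pm) /= inE xU' orbT /=.
  by apply/allP => a aS; rewrite inE (allP sub a aS) orbT.
Qed.

End TreeCodes.

(** * The Peierls estimate *)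

Section TwoRounds.
Variables (R : realType) (d : nat).
Local Notation V := (vertex d).
Local Notation item := (V + {set V})%type.
Local Notation sample := {set bool * item}.
Implicit Types (Z U D : {set V}) (w : sample).

Definition open_adj (F : {set {set V}}) : rel V :=
  [rel x y | cube_adj x y && ([set x; y] \in F)].

Lemma open_adj_sym F : symmetric (open_adj F).
Proof. by move=> x y; rewrite /open_adj /= cube_adj_sym finset.setUC. Qed.

Definition verts1 w := vertices_of (round true w).
Definition verts2 w := vertices_of (round false w).
Definition verts w := vertices_of (rounds w).
Definition edges1 w := edges_of (round true w).
Definition edges2 w := edges_of (round false w).
Definition edges w := edges_of (rounds w).

Lemma vertsE w : verts w = verts1 w :|: verts2 w.
Proof. by apply/setP => v; rewrite !inE. Qed.

Lemma edgesE w : edges w = edges1 w :|: edges2 w.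
Proof. by apply/setP => v; rewrite !inE. Qed.

(* The vertices of [U] may be connected by both rounds, but no first-round edge leaves
   [U] inside the host [Z].  Mixing the two rounds makes the same bound exclude first-round
   clusters of intermediate size and final clusters without a large first-round one. *)
Definition isolated_cluster Z v u w := [exists U : {set V},
  [&& v \in U, #|U| == u, U \subset Z :&: verts w,
      connected_from (open_adj (edges w)) U v &
      [forall x in U :&: verts1 w, forall y in (Z :\: U) :&: verts1 w,
         ~~ open_adj (edges1 w) x y]]].

Variables q1 q2 p1 p2 : R.
Hypotheses (q1_01 : 0 <= q1 <= 1) (q2_01 : 0 <= q2 <= 1)
  (p1_01 : 0 <= p1 <= 1) (p2_01 : 0 <= p2 <= 1).

Definition round_proba (j : bool * item) : R :=
  match j.2 with
  | inl _ => if j.1 then q1 else q2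
  | inr e => if e \in cube_edges d then if j.1 then p1 else p2 else 0
  end.

Lemma round_proba_family : proba_family round_proba.
Proof.
case=> r [v|e] /=; rewrite /round_proba /=; first by case: r.
by case: ifP => _; [case: r|rewrite lexx ler01].
Qed.

Let pr_ok := round_proba_family.

Definition arrow_items v U : sample :=
  [set (true, inr [set v; flip v i]) | i : 'I_d & flip v i \in U].

Definition arrow_edge (v : V) i : {set V} := [set v; flip v i].

Lemma arrow_edge_inj v : injective (arrow_edge v).
Proof.
move=> i j /setP/(_ (flip v i)); rewrite !inE eqxx orbT => /esym/orP[]/eqP.
  by move=> e; have := cube_adj_flip v i; rewrite e cube_adjxx.
exact: flip_inj.
Qed.

Lemma arrow_edge_cube (v : V) i : arrow_edge v i \in cube_edges d.
Proof. by rewrite cube_edgesP cube_adj_flip. Qed.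

(** The event does not look at the endpoints in [U], which will be chosen inside the first round.
    This keeps the events of different outer vertices [v] independent. *)
Definition unattached U v w := ~~ ((v \in verts1 w) && ~~ [disjoint arrow_items v U & w]).

Definition attach_support U v : sample := (true, inl v) |: arrow_items v U.

Lemma unattached_depends U v : depends_on (unattached U v) (attach_support U v).
Proof.
apply: (@depends_on2 _ bool bool bool (fun a b => ~~ (a && ~~ b)) (fun w => v \in verts1 w)).
  by move=> w w' e; rewrite !inE e ?inE.
exact: depends_on_disjoint.
Qed.

Lemma card_arrow_items v U : #|arrow_items v U| = degree_in U v.
Proof.
rewrite card_imset; last by move=> i j [] /arrow_edge_inj.
by apply: eq_card => i; rewrite !inE.
Qed.

Lemma prob_unattached U v :
  prob round_proba (unattached U v) = 1 - q1 * (1 - (1 - p1) ^+ degree_in U v).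
Proof.
rewrite prob_not (@prob_and_indep _ _ _ [set (true, inl v)] (arrow_items v U)).
- rewrite prob_not prob_disjoint; congr (1 - _ * (1 - _)).
    transitivity (prob round_proba (fun w => (true, inl v) \in w)).
      by apply: eq_prob => w; rewrite !inE.
    by rewrite prob_mem.
  rewrite -card_arrow_items -prodr_const; apply: eq_bigr => j /imsetP[i _ ->].
  by rewrite /round_proba /= arrow_edge_cube.
- by rewrite disjoints1; apply/imsetP => -[i _ [] ].
- by move=> w w' e; rewrite !inE e ?inE.
- exact/depends_on_comp/depends_on_disjoint.
Qed.

(** The probability never drops below [1 - q1], so it cannot decay exponentially in the degree for
    ever. The hypotheses force [p1 * degree <= 1], the range in which the decay is still linear in
    the degree; this is why only light boundary vertices are used. *)
Lemma prob_unattached_le U v (a b : nat) :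
  (degree_in U v * a <= b)%N -> p1 * b%:R <= a%:R -> (0 < a)%N ->
  prob round_proba (unattached U v) <= expR (- (q1 * p1 / 2 * (degree_in U v)%:R)).
Proof.
move=> dab pab a0; rewrite prob_unattached; move: (degree_in U v) dab => m dab.
have pm : p1 * m%:R <= 1.
  have a0' : 0 < a%:R :> R by rewrite ltr0n.
  rewrite -(ler_pM2r a0') mul1r -mulrA -natrM; apply: le_trans pab.
  by apply: ler_wpM2l; [case/andP: p1_01 | rewrite ler_nat].
have pm0 : 0 <= p1 * m%:R by rewrite mulr_ge0 //; case/andP: p1_01.
(* With [z = p1 * m], Bernoulli's inequality and [(1 - p1) ^+ m * (1 + p1) ^+ m <= 1] bound the
   power by [1 / (1 + z)], and this is at most [1 - z / 2] for [z] in [0, 1]. *)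
have key : (1 - p1) ^+ m <= 1 - p1 * m%:R / 2.
  have [p10 p11] := andP p1_01.
  have B : 1 + p1 * m%:R <= (1 + p1) ^+ m.
    rewrite mulr_natr; elim: (m) => [|n IH]; first by rewrite expr0 mulr0n addr0.
    rewrite exprS mulrS.
    apply: le_trans (ler_wpM2l _ IH); last by lra.
    have : 0 <= p1 * (p1 *+ n) by rewrite mulr_ge0 // mulrn_wge0.
    lra.
  have C : (1 - p1) ^+ m * (1 + p1) ^+ m <= 1.
    rewrite -exprMn; apply: exprn_ile1; first by apply: mulr_ge0; lra.
    have : 0 <= p1 * p1 by apply: mulr_ge0.
    lra.
  have D : 0 <= (1 - p1) ^+ m by apply: exprn_ge0; lra.
  move: B C D pm pm0; move: ((1 - p1) ^+ m) ((1 + p1) ^+ m) (p1 * m%:R) => x y z B C D E F.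
  have G : x * (1 + z) <= 1 by apply: le_trans C; apply: ler_wpM2l.
  have : x * ((1 + z) * (1 - z / 2)) <= 1 - z / 2.
    by rewrite mulrA ler_piMl //; lra.
  have : 0 <= x * (z * (1 - z)) by rewrite mulr_ge0 // mulr_ge0 //; lra.
  lra.
have [q10 q11] := andP q1_01.
apply: (@le_trans _ _ (1 - q1 * p1 / 2 * m%:R)); last first.
  have := @expR_ge1Dx R (- (q1 * p1 / 2 * m%:R)); by [].
have : q1 * (p1 * m%:R / 2) <= q1 * (1 - (1 - p1) ^+ m) by apply: ler_wpM2l => //; lra.
lra.
Qed.

End TwoRounds.

Section TreeArcs.
Local Open Scope nat_scope.
Variable d : nat.
Local Notation V := (vertex d).

Definition tree_set (v : V) s := [set x in tree_vertices v s].
Definition tree_edge_set (v : V) s := [set e in tree_edges v s].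

Lemma tree_arcs_mem (st : seq V) s a : a \in tree_arcs st s ->
  [/\ cube_adj a.1 a.2, a.1 \in st ++ map snd (tree_arcs st s) &
      a.2 \in map snd (tree_arcs st s)].
Proof.
move=> aS; suff: cube_adj a.1 a.2 && (a.1 \in st ++ map snd (tree_arcs st s)).
  by case/andP => ? ?; split=> //; apply: map_f.
elim: s st aS => [|[i|] s IH] [|x st] //=.
  rewrite inE => /orP[/eqP->|/IH /andP[-> h]] /=; first by rewrite cube_adj_flip mem_head.
  by move: h; rewrite /= !(inE, mem_cat); do 2 case: (_ == _); do 2 case: (_ \in _).
by move=> /IH /andP[-> h]; rewrite /= inE h orbT.
Qed.

Lemma tree_edge_setP (v : V) s e : e \in tree_edge_set v s ->
  e \in cube_edges d /\ e \subset tree_set v s.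
Proof.
rewrite inE => /mapP[a /tree_arcs_mem[adj a1 a2] ->].
rewrite cube_edgesP; split=> //; rewrite subUset !sub1set !inE.
by move: a1; rewrite /= inE => ->; rewrite a2 orbT.
Qed.

End TreeArcs.

Lemma big_option (R : Type) (idx : R) (op : Monoid.com_law idx) (T : finType)
    (F : option T -> R) :
  \big[op/idx]_o F o = op (F None) (\big[op/idx]_i F (Some i)).
Proof.
rewrite (bigD1 None) //=; congr (op _ _).
rewrite (reindex_omap (fun x => Some x) id) => [|[x|]] //=.
by apply: eq_bigl => x; rewrite eqxx.
Qed.

Section Peierls.
Variables (R : realType) (d : nat).
Local Notation V := (vertex d).
Local Notation item := (V + {set V})%type.
Local Notation sample := {set bool * item}.
Implicit Types (Z U D : {set V}) (w : sample).

Variables q1 q2 p1 p2 : R.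
Hypotheses (q1_01 : 0 <= q1 <= 1) (q2_01 : 0 <= q2 <= 1)
  (p1_01 : 0 <= p1 <= 1) (p2_01 : 0 <= p2 <= 1).
Let pr := @round_proba R d q1 q2 p1 p2.
Let pr_ok : proba_family pr := round_proba_family q1_01 q2_01 p1_01 p2_01.
Let p := 1 - (1 - p1) * (1 - p2).

Let p0 : 0 <= p.
Proof.
have [p10 p11] := andP p1_01; have [p20 p21] := andP p2_01.
have -> : p = p1 + p2 * (1 - p1) by rewrite /p; ring.
by rewrite addr_ge0 // mulr_ge0 // subr_ge0.
Qed.

(** An edge from outside [U] into [D] has only one endpoint outside [U], so it belongs to a single
    outer vertex. *)
Lemma attach_support_disjoint U D x y : D \subset U -> x \notin U -> y \notin U -> x != y ->
  [disjoint @attach_support d D x & attach_support D y].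
Proof.
move=> /subsetP DU xU yU xy; rewrite disjoint_subset; apply/subsetP => j.
rewrite !inE => /orP[/eqP->|/imsetP[i ix ->]].
  rewrite negb_or xpair_eqE /= (inj_eq (@inl_inj _ _)) xy /=.
  by apply/imsetP => -[].
rewrite negb_or /=; apply/imsetP => -[k ky] [E].
have : x \in [set y; flip y k] by rewrite -E set21.
rewrite !inE (negPf xy) => /eqP xk; move: ky; rewrite inE -xk => /DU.
by rewrite (negPf xU).
Qed.

Definition code_event Z v s D w :=
  [&& D \subset verts2 w, tree_edge_set v s \subset edges w &
      [forall y, (y \in Z :\: tree_set v s) ==> unattached (tree_set v s :\: D) y w]].

(** The three clauses read disjoint coordinates: second-round vertices, the edges of the tree in
    both rounds, and first-round vertices outside the tree set with their edges into it. *)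
Lemma prob_code_event Z v s D :
  prob pr (code_event Z v s D) =
  q2 ^+ #|D| * (p ^+ #|tree_edge_set v s| *
  \prod_(y in Z :\: tree_set v s) prob pr (unattached (tree_set v s :\: D) y)).
Proof.
set U := tree_set v s; set t := tree_edge_set v s.
pose AD : sample := [set (false, inl x) | x in D].
pose At : sample := [set j | if j.2 is inr e then e \in t else false].
pose Au : sample := \bigcup_(y in Z :\: U) attach_support (U :\: D) y.
have DE w : (D \subset verts2 w) = (AD \subset w).
  apply/subsetP/subsetP => [h _ /imsetP[x /h xD ->]|h x xD]; first by rewrite !inE in xD.
  by rewrite !inE; apply/h/imset_f.
have depD : depends_on (fun w => D \subset verts2 w) AD.
  by move=> w w' e; rewrite !DE; apply: depends_on_subset e.
have dept : depends_on (fun w => t \subset edges w) At.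
  move=> w w' e; apply/subsetP/subsetP => h x xt; have := h x xt; rewrite !inE !e //;
    by rewrite inE.
have depu : depends_on (fun w => [forall y, (y \in Z :\: U) ==> unattached (U :\: D) y w]) Au.
  move=> w w' e; apply: eq_forallb => y; have [yZ /=|//] := boolP (y \in _).
  by apply: unattached_depends => j jy; apply: e; apply/bigcupP; exists y.
rewrite (@prob_and_indep _ _ _ AD (At :|: Au)) //; last first.
- exact: (depends_on2 andb dept depu).
- rewrite disjoint_subset; apply/subsetP => _ /imsetP[x xD ->].
  rewrite !inE /=; apply/bigcupP => -[y _]; rewrite !inE => /orP[/eqP[]|/imsetP[]] //.
rewrite (@prob_and_indep _ _ _ At Au) //; last first.
  rewrite disjoint_subset; apply/subsetP => -[r [x|e]]; rewrite inE //= => et.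
  rewrite inE; apply/bigcupP => -[y /setDP[_ yU]]; rewrite !inE => /orP[/eqP[]|/imsetP[i _]] //.
  move=> [_ E]; have [_ /subsetP/(_ y)] := tree_edge_setP et.
  by rewrite (negPf yU) E set21 => /(_ isT).
congr (_ * (_ * _)).
- under eq_prob do rewrite DE.
  rewrite prob_subset -prodr_const big_imset /=; last by move=> x y _ _ [].
  by [].
- transitivity (prob pr (fun w => [forall e, (e \in t) ==> (inr e \in rounds w)])).
    apply: eq_prob => w; apply/subsetP/forall_inP => h e /h; by rewrite !inE.
  rewrite (@prob_forall_indep _ _ _ _ _ (fun e => [set j | j.2 == inr e])).
  + rewrite -prodr_const; apply: eq_bigr => e et; rewrite prob_rounds.
    by have [ec _] := tree_edge_setP et; rewrite /pr /round_proba /= ec.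
  + move=> k l _ _ kl; rewrite disjoint_subset; apply/subsetP => j; rewrite !inE => /eqP->.
    by apply: contra kl => /eqP[->].
  + by move=> k _ w w' e; rewrite !inE !e // inE.
- apply: (@prob_forall_indep _ _ _ _ _ (attach_support (U :\: D))).
    move=> x y /setDP[_ xU] /setDP[_ yU]; apply: attach_support_disjoint xU yU.
    exact: subsetDl.
  move=> y _; exact: unattached_depends.
Qed.

Variables (beta : R) (kappa k : nat).
Hypotheses (beta01 : 0 <= beta <= 1) (q2_beta : q2 <= beta ^+ 8)
  (qp_beta : expR (- (q1 * p1 * d%:R / 8)) <= beta)
  (p1_kappa : p1 * d%:R <= kappa%:R) (kappa0 : (0 < kappa)%N) (d0 : (0 < d)%N)
  (k_d : (16 * (k * kappa.+2) <= d)%N).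

(* Either many vertices of [U] come from the second round, which costs [q2] each, or
   [light_boundary] provides many chances for a first-round edge to leave [U]. *)
Lemma prob_code_event_le Z v s D :
  {in Z, forall x, (d <= 2 * degree_in Z x)%N} ->
  tree_set v s \subset Z -> D \subset tree_set v s ->
  (#|tree_set v s| * kappa.+1 <= 2 ^ k)%N ->
  prob pr (code_event Z v s D) <= p ^+ #|tree_edge_set v s| * beta ^+ #|tree_set v s|.
Proof.
move=> degZ UZ DU Uk; rewrite prob_code_event mulrCA; set U := tree_set v s in UZ DU Uk *.
have [b0 b1] := andP beta01; have [q20 q21] := andP q2_01; have [q10 q11] := andP q1_01.
have [p10 p11] := andP p1_01; have [p20 p21] := andP p2_01.
apply: ler_wpM2l; first exact: exprn_ge0.
set P := \prod_(y in _) _.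
have P01 : 0 <= P <= 1.
  apply/andP; split; first by apply: prodr_ge0 => y _; apply: prob_ge0.
  by apply: Num.Theory.prodr_ile1 => y _; rewrite prob_ge0 // prob_le1.
have [P0 P1] := andP P01.
have qD1 : q2 ^+ #|D| <= 1 by apply: exprn_ile1.
have qD0 : 0 <= q2 ^+ #|D| by apply: exprn_ge0.
(* If [D] is at least an eighth of [U], then [q2_beta] supplies 8 factors [beta] per vertex of [D].
   Otherwise [U :\: D] keeps 7/8 of [U], as [light_boundary] requires. *)
have [D8|D8] := leqP #|U| (8 * #|D|).
  apply: (@le_trans _ _ (q2 ^+ #|D|)); first by rewrite ler_piMr.
  apply: (@le_trans _ _ ((beta ^+ 8) ^+ #|D|)); first by apply: lerXn2r; rewrite ?nnegrE ?exprn_ge0.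
  by rewrite -exprM; apply: ler_wiXn2l.
apply: (@le_trans _ _ P); first by rewrite ler_piMl.
have cD : (7 * #|U| <= 8 * #|U :\: D|)%N.
  move: D8 (cardsID D U); rewrite (setIidPr DU).
  by move: #|U| #|D| #|U :\: D| => a b c; clear; lia.
have := light_boundary d0 UZ (subsetDl U D) cD degZ Uk k_d.
set L := (\sum_(y in _ | _) _)%N => hL.
apply: (@le_trans _ _ (expR (- (q1 * p1 / 2 * L%:R)))).
  rewrite /P (bigID (fun y => degree_in (U :\: D) y * kappa <= d)%N) /=.
  apply: (@le_trans _ _ (\prod_(y in Z :\: U | (degree_in (U :\: D) y * kappa <= d)%N)
     prob pr (unattached (U :\: D) y))).
    rewrite ler_piMr //; first by apply: prodr_ge0 => y _; apply: prob_ge0.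
    by apply: Num.Theory.prodr_ile1 => y _; rewrite prob_ge0 // prob_le1.
  rewrite /L natr_sum mulr_sumr -sumrN expR_sum; apply: ler_prod => y /andP[yZ yl].
  by rewrite prob_ge0 //=; apply: (@prob_unattached_le _ _ _ _ _ _ q1_01 p1_01 _ _ kappa d).
(* The 8 is 2 times 4: the factor 1/2 of [prob_unattached_le] and [L >= #|U| * d / 4]. *)
apply: (@le_trans _ _ (expR (- (q1 * p1 * d%:R / 8)) ^+ #|U|)); last first.
  by apply: lerXn2r; rewrite ?nnegrE ?expR_ge0.
rewrite -expRM_natl ler_expR mulrN lerN2.
have : (#|U| * d)%N%:R <= (4 * L)%N%:R :> R by rewrite ler_nat.
rewrite !natrM; move: (#|U|%:R : R) (L%:R : R) (d%:R : R) => a b c h.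
rewrite -subr_ge0.
have -> : q1 * p1 / 2 * b - a * (q1 * p1 * c / 8) = q1 * p1 * (4 * b - a * c) / 8 by field.
by rewrite divr_ge0 // mulr_ge0 ?mulr_ge0 // subr_ge0.
Qed.

Definition good_code Z v u s :=
  [&& uniq (tree_edges v s), #|tree_edge_set v s| == u.-1, count isSome s == u.-1,
      tree_set v s \subset Z & #|tree_set v s| == u].

Lemma isolated_cluster_code Z v u w : isolated_cluster Z v u w ->
  [exists f : {ffun 'I_(2 * u.-1) -> option 'I_d},
    good_code Z v u (codom f) && [exists D : {set V},
      (D \subset tree_set v (codom f)) && code_event Z v (codom f) D w]].
Proof.
move=> /existsP[U /and5P[vU /eqP cU UZ conU clU]].
have sub_cube : subrel (open_adj (edges w)) (@cube_adj d) by move=> x y /andP[].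
have [s [szs cs] [us ss sU es]] :=
  tree_code (@open_adj_sym d (edges w)) sub_cube conU vU.
rewrite cU in szs cs ss.
pose f : {ffun 'I_(2 * u.-1) -> option 'I_d} := [ffun i => nth None s (val i)].
have fs : codom f = s.
  apply: (@eq_from_nth _ None); first by rewrite size_codom card_ord szs.
  move=> i; rewrite size_codom card_ord => ih; rewrite /codom /image_mem.
  rewrite (nth_map (Ordinal ih)) ?size_enum_ord // ffunE.
  by rewrite /= nth_enum_ord.
have tsU : tree_set v s = U by exact: sU.
apply/existsP; exists f; rewrite fs /good_code us cs eqxx tsU cU eqxx andbT.
rewrite (subset_trans UZ (subsetIl _ _)) andbT /=; apply/andP; split.
  by rewrite cardsE (card_uniqP us) ss eqxx.
(* With this [D], the rest of [U] is exactly its first-round part, so an open arrow into it would be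
   a first-round edge leaving the cluster. *)
apply/existsP; exists (U :\: verts1 w); rewrite subsetDl /code_event tsU /=.
apply/and3P; split.
- apply/subsetP => x /setDP[xU x1].
  by have := subsetP UZ x xU; rewrite inE vertsE inE (negPf x1) /= => /andP[].
- apply/subsetP => e; rewrite inE => /mapP[a aS ->].
  by have /andP[] := allP es a aS.
apply/forall_inP => y yZ; rewrite /unattached negb_and negbK.
have [y1 /=|//] := boolP (y \in verts1 w).
rewrite disjoint_subset; apply/subsetP => j /imsetP[i ix ->]; rewrite inE; apply/negP => iw.
move: ix; rewrite inE setDDr setDv finset.set0U inE => /andP[iU i1].
have /forall_inP/(_ (flip y i)) := clU; rewrite inE iU i1 => /(_ isT) /forall_inP/(_ y).
rewrite inE yZ y1 => /(_ isT); rewrite /open_adj /= cube_adj_sym cube_adj_flip /=.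
by rewrite !inE finset.setUC iw.
Qed.

(** The factor [p ^+ u.-1] of the tree edges is spread over the code letters, with weight [p] for a
    direction and 1 for a backtrack. Summing over all words, good or not, factorizes into
    [(1 + d p) ^+ (2 * u.-1)]. The factor [2 ^+ u] counts the choices of [D]. *)
Lemma prob_isolated_cluster Z v u :
  {in Z, forall x, (d <= 2 * degree_in Z x)%N} -> (0 < u)%N -> (u * kappa.+1 <= 2 ^ k)%N ->
  prob pr (isolated_cluster Z v u) <= ((1 + d%:R * p) ^+ 2 * (2 * beta)) ^+ u.
Proof.
move=> degZ u0 uk.
have [b0 b1] := andP beta01.
apply: le_trans (prob_le pr_ok (@isolated_cluster_code Z v u)) _.
apply: le_trans (prob_union _ _ pr_ok) _.
pose wt (o : option 'I_d) : R := if o is Some _ then p else 1.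
have wt0 o : 0 <= wt o by case: o.
apply: (@le_trans _ _ (\sum_(f : {ffun 'I_(2 * u.-1) -> option 'I_d})
    (\prod_i wt (f i)) * (2 * beta) ^+ u)).
  rewrite [leRHS](bigID (fun f : {ffun _} => good_code Z v u (codom f))) /=.
  rewrite -[leLHS]addr0; apply: lerD; last first.
    by apply: sumr_ge0 => f _; rewrite mulr_ge0 ?exprn_ge0 ?prodr_ge0 ?mulr_ge0.
  apply: ler_sum => f /and5P[_ /eqP ct /eqP cf UZ /eqP cU].
  have -> : \prod_i wt (f i) = p ^+ u.-1.
    rewrite -[RHS](congr1 (GRing.exp p) cf) -big_enum -(big_map f predT wt) -[map f _]/(codom f).
    elim: (codom f) => [|[i|] s IH]; rewrite ?big_nil ?expr0 // big_cons IH /=.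
      by rewrite add1n exprS.
    by rewrite mul1r.
  apply: le_trans (prob_union _ _ pr_ok) _.
  apply: (@le_trans _ _ (\sum_(D in powerset (tree_set v (codom f))) p ^+ u.-1 * beta ^+ u)).
    rewrite (eq_bigl (fun D => D \in powerset (tree_set v (codom f)))) => [|D]; last first.
      by rewrite powersetE.
    apply: ler_sum => D; rewrite powersetE => DU.
    by have := prob_code_event_le degZ UZ DU; rewrite ct cU; apply.
  by rewrite sumr_const card_powerset cU exprMn -[X in X <= _]mulr_natl natrX mulrCA.
rewrite -mulr_suml -(bigA_distr_bigA (fun _ => wt)) prodr_const card_ord big_option /=.
rewrite sumr_const card_ord [leRHS]exprMn; apply: ler_wpM2r.
  by rewrite exprn_ge0 // mulr_ge0.
rewrite -exprM -[p *+ d]mulr_natl; apply: ler_weXn2l; last by rewrite leq_mul2l leq_pred orbT.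
by rewrite lerDl mulr_ge0.
Qed.

End Peierls.

(** * Density of the large first-round clusters *)

Section Density.
Variables (R : realType) (d : nat).
Local Notation V := (vertex d).
Local Notation item := (V + {set V})%type.
Local Notation sample := {set bool * item}.
Implicit Types (Z U D : {set V}) (w : sample) (v x y : V).

Definition graph1 Z w : rel V := induced (open_adj (edges1 w)) (Z :&: verts1 w).
Definition cluster1 Z w v := [set x | connect (graph1 Z w) v x].
Definition large_in Z M v w := (v \in Z :&: verts1 w) && (M <= #|cluster1 Z w v|)%N.

Lemma graph1_sym Z w : symmetric (graph1 Z w).
Proof. exact/induced_sym/open_adj_sym. Qed.

Lemma connect_graph1_sym Z w : connect_sym (graph1 Z w).
Proof. exact/sym_connect_sym/graph1_sym. Qed.

Lemma mem_cluster1 Z w v : v \in cluster1 Z w v.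
Proof. by rewrite inE connect0. Qed.

Lemma cluster1_sub Z w v : v \in Z :&: verts1 w -> cluster1 Z w v \subset Z :&: verts1 w.
Proof.
move=> vZ; apply/subsetP => x; rewrite inE => /connectP[s].
elim/last_ind: s x => [|s y _] x /=; first by move=> _ ->.
by rewrite rcons_path last_rcons => /andP[_ /and3P[_ yZ _]] ->.
Qed.

Lemma connected_cluster1 Z w v : connected_from (open_adj (edges w)) (cluster1 Z w v) v.
Proof.
apply/forall_inP => x; rewrite inE => /connectP[s ps ->].
elim/last_ind: s ps => [|s y IH] /=; first by rewrite connect0.
rewrite rcons_path last_rcons => /andP[ps gy].
apply: connect_trans (IH ps) (connect1 _).
have cl : connect (graph1 Z w) v (last v s) by apply/connectP; exists s.
have cy : connect (graph1 Z w) v y by apply: connect_trans cl (connect1 gy).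
have /and3P[_ _ /andP[a e]] := gy; rewrite /induced /open_adj /= !inE cl cy a /=.
by rewrite !inE in e; rewrite e.
Qed.

(** A first-round cluster is its own witness: it is connected already in the first round, and no
    open first-round edge between first-round vertices of the host leaves it. *)
Lemma cluster1_isolated Z w v : v \in Z :&: verts1 w ->
  isolated_cluster Z v #|cluster1 Z w v| w.
Proof.
move=> vZ; have sub := cluster1_sub vZ.
apply/existsP; exists (cluster1 Z w v); rewrite mem_cluster1 eqxx connected_cluster1 /=.
apply/andP; split.
  apply: subset_trans sub _; apply: setIS; rewrite vertsE; exact: subsetUl.
apply/forall_inP => x /setIP[xC x1]; apply/forall_inP => y /setIP[/setDP[yZ yC] y1].
have /setIP[xZ _] := subsetP sub x xC.
apply: contra yC => exy; move: xC; rewrite ![_ \in cluster1 _ _ _]inE => cx.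
apply: connect_trans cx (connect1 _).
by apply/and3P; split=> //; apply/setIP.
Qed.

Lemma graph1_mono Z Z' w : Z \subset Z' -> subrel (graph1 Z w) (graph1 Z' w).
Proof.
move=> /subsetP ZZ x y /and3P[/setIP[xZ x1] /setIP[yZ y1] e].
by apply/and3P; split=> //; apply/setIP; rewrite ZZ.
Qed.

Lemma large_in_mono Z Z' M v w : Z \subset Z' -> large_in Z M v w -> large_in Z' M v w.
Proof.
move=> ZZ /andP[/setIP[vZ v1] Mv]; rewrite /large_in inE v1 (subsetP ZZ) //=.
apply: leq_trans Mv _; apply/subset_leq_card/subsetP => x; rewrite !inE.
by apply: connect_sub => a b ab; apply: connect1; apply: graph1_mono ab.
Qed.

Definition host_support (r : bool) Z : sample :=
  [set j | (j.1 == r) && match j.2 with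
    | inl x => x \in Z | inr e => (e \in cube_edges d) && (e \subset Z) end].

Lemma large_in_depends Z M v : depends_on (large_in Z M v) (host_support true Z).
Proof.
move=> w w' e.
have e1 : Z :&: verts1 w = Z :&: verts1 w'.
  by apply/setP => x; rewrite !inE; case xZ: (x \in Z) => //=; rewrite e ?inE.
have eg : graph1 Z w =2 graph1 Z w'.
  move=> x y; rewrite /graph1 /induced /open_adj /= e1.
  case xZ : (x \in _) => //=; case yZ : (y \in _) => //=.
  case a : (cube_adj x y) => //=; rewrite !inE e // inE /= cube_edgesP a /=.
  by rewrite subUset !sub1set; move: xZ yZ; rewrite !inE => /andP[-> _] /andP[-> _].
rewrite /large_in e1; congr (_ && (_ <= _)%N); apply: eq_card => x.
by rewrite !inE; apply: eq_connect.
Qed.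

Lemma host_support_disjoint r Z Z' : [disjoint Z & Z'] ->
  [disjoint host_support r Z & host_support r Z'].
Proof.
move=> ZZ; rewrite disjoint_subset; apply/subsetP => -[r' [x|e]]; rewrite !inE /=.
  by case/andP=> -> xZ; rewrite (disjointFr ZZ xZ).
case/and3P=> -> ec eZ; rewrite ec /=; apply/negP => eZ'.
have /imsetP[[x y] _ E] := ec.
have xe : x \in e by rewrite E set21.
by have := disjointFr ZZ (subsetP eZ x xe); rewrite (subsetP eZ' x xe).
Qed.

Variables q1 q2 p1 p2 : R.
Hypotheses (q1_01 : 0 <= q1 <= 1) (q2_01 : 0 <= q2 <= 1)
  (p1_01 : 0 <= p1 <= 1) (p2_01 : 0 <= p2 <= 1).
Let pr := @round_proba R d q1 q2 p1 p2.
Let pr_ok : proba_family pr := round_proba_family q1_01 q2_01 p1_01 p2_01.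

Variables (beta : R) (M : nat).
Hypothesis beta_half : 0 <= beta <= 1 / 2.

Lemma geometric_sum_le n a : 0 <= beta -> \sum_(i < n) beta ^+ (a + i) <= 2 * beta ^+ a.
Proof.
move=> b0; have [_ bh] := andP beta_half.
have ba : 0 <= beta ^+ a by rewrite exprn_ge0.
have -> : \sum_(i < n) beta ^+ (a + i) = beta ^+ a * \sum_(i < n) beta ^+ i.
  by rewrite mulr_sumr; apply: eq_bigr => i _; rewrite exprD.
rewrite [leRHS]mulrC; apply: ler_wpM2l => //.
elim: n => [|n IH]; first by rewrite big_ord0.
rewrite big_ord_recl expr0; under eq_bigr do rewrite lift0 exprS.
rewrite -mulr_sumr; have : beta * (\sum_(i < n) beta ^+ i) <= 1 / 2 * 2.
  by apply: ler_pM => //; apply: sumr_ge0 => i _; rewrite exprn_ge0.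
lra.
Qed.

(** A first-round vertex outside the large clusters has an isolated cluster of some size between 1
    and [M - 1], and the geometric series of these events sums to at most [2 * beta]. *)
Lemma prob_large_in Z v : v \in Z ->
  (forall u, (0 < u < M)%N -> prob pr (isolated_cluster Z v u) <= beta ^+ u) ->
  q1 - 2 * beta <= prob pr (large_in Z M v).
Proof.
move=> vZ peierls; have [b0 _] := andP beta_half.
have q1E : prob pr (fun w => v \in verts1 w) = q1.
  transitivity (prob pr (fun w => (true, inl v) \in w)).
    by apply: eq_prob => w; rewrite !inE.
  by rewrite prob_mem.
suff : q1 <= prob pr (large_in Z M v) +
    \sum_(u < M.-1) prob pr (isolated_cluster Z v u.+1).
  have : \sum_(u < M.-1) prob pr (isolated_cluster Z v u.+1) <= 2 * beta ^+ 1.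
    apply: le_trans (geometric_sum_le M.-1 1 b0); apply: ler_sum => u _.
    by rewrite add1n; apply: peierls; have := ltn_ord u; lia.
  by rewrite expr1 => h1 h2; lra.
rewrite -q1E.
apply: le_trans (lerD (lexx _) (prob_union predT _ pr_ok)).
apply: le_trans (prob_or _ _ pr_ok); apply: (prob_le pr_ok) => w v1.
have vw : v \in Z :&: verts1 w by rewrite inE vZ.
rewrite /large_in vw /=; case: leqP => //= small.
have c0 : (0 < #|cluster1 Z w v|)%N by apply/card_gt0P; exists v; apply: mem_cluster1.
have iM : (#|cluster1 Z w v|.-1 < M.-1)%N.
  by move: c0 small; move: #|cluster1 Z w v| M => a b; lia.
by apply/existsP; exists (Ordinal iM); rewrite /= prednK // cluster1_isolated.
Qed.

(* The subcubes of the vertices [quarter v ij], obtained by freezing the first two quarters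
   of the coordinates, are disjoint, so their clusters are independent. *)
Let h := (d %/ 4)%N.

Let four_h : (4 * h <= d)%N.
Proof. by rewrite mulnC leq_divM. Qed.

Let two_h : (h + h <= d)%N.
Proof. by apply: leq_trans four_h; rewrite addnn -mul2n leq_mul2r orbT. Qed.

Lemma low_ord_subproof (i : 'I_h) : (i < d)%N.
Proof. exact: leq_trans (ltn_ord i) (leq_trans (leq_addr _ _) two_h). Qed.

Lemma high_ord_subproof (i : 'I_h) : (h + i < d)%N.
Proof. by apply: leq_trans two_h; rewrite ltn_add2l. Qed.

Definition low_ord i := Ordinal (low_ord_subproof i).
Definition high_ord i := Ordinal (high_ord_subproof i).

Definition quarter v (ij : 'I_h * 'I_h) := flip (flip v (low_ord ij.1)) (high_ord ij.2).

Definition subcube v := [set y : V | [forall k : 'I_d, (k < h + h)%N ==> (y k == v k)]].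

Lemma mem_subcube v : v \in subcube v.
Proof. by rewrite inE; apply/forall_inP. Qed.

(** At most [2 * (d %/ 4)] coordinates are frozen, so at least half stay free. The Peierls bound is
    stated for hosts of this minimum degree so that it applies to the subcubes as well as to the
    full cube. *)
Lemma subcube_degree v : {in subcube v, forall x, (d <= 2 * degree_in (subcube v) x)%N}.
Proof.
move=> x; rewrite inE => /forall_inP xv.
have sub : [set k : 'I_d | (h + h <= k)%N] \subset [set k | flip x k \in subcube v].
  apply/subsetP => k; rewrite !inE => hk; apply/forall_inP => l lh.
  by rewrite flip_off ?xv //; apply: contraTneq lh => ->; rewrite -leqNgt.
have := subset_leq_card sub; rewrite -/(degree_in _ x).
have := cardsC [set k : 'I_d | (h + h <= k)%N]; rewrite card_ord.
have : (#|~: [set k : 'I_d | (h + h <= k)%N]| <= h + h)%N.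
  rewrite -[leqRHS]card_ord -cardsT; apply: leq_trans (leq_imset_card (widen_ord two_h) _).
  apply/subset_leq_card/subsetP => k; rewrite !inE -ltnNge => kh.
  by apply/imsetP; exists (Ordinal kh) => //; apply/val_inj.
move: (#|~: _|) (#|[set k : 'I_d | _]|) (degree_in _ x) four_h; move: h => a b c e; lia.
Qed.

Lemma quarter_inj v : injective (quarter v).
Proof.
move=> [i j] [k l] /ffunP e.
have := e (low_ord i); have := e (high_ord j).
rewrite !ffunE -!val_eqE /= !eqxx eqn_add2l.
have n1 : ((h + j)%N == i :> nat) = false by have := ltn_ord i; lia.
have n2 : ((h + j)%N == k :> nat) = false by have := ltn_ord k; lia.
have n3 : (i == (h + j)%N :> nat) = false by have := ltn_ord i; lia.
have n4 : (i == (h + l)%N :> nat) = false by have := ltn_ord i; lia.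
rewrite n1 n2 n3 n4 !addbF => /addbI/esym/eqP jl /addbI/esym/eqP ik.
by congr (_, _); apply/val_inj.
Qed.

Lemma subcube_quarter_disjoint v ij kl : ij != kl ->
  [disjoint subcube (quarter v ij) & subcube (quarter v kl)].
Proof.
move=> ne; rewrite disjoint_subset; apply/subsetP => y; rewrite !inE => /forall_inP h1.
apply: contra ne => /forall_inP h2; apply/eqP/(@quarter_inj v)/ffunP => k.
have [kh|kh] := ltnP k (h + h); first by rewrite -(eqP (h1 k kh)) -(eqP (h2 k kh)).
case: ij kl {h1 h2} => [i j] [k' l]; rewrite !ffunE -!val_eqE /=.
have n1 : (k == (h + j)%N :> nat) = false by have := ltn_ord j; lia.
have n2 : (k == (h + l)%N :> nat) = false by have := ltn_ord l; lia.
have n3 : (k == i :> nat) = false by have := ltn_ord i; lia.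
have n4 : (k == k' :> nat) = false by have := ltn_ord k'; lia.
by rewrite n1 n2 n3 n4.
Qed.

Definition good_quarters v w :=
  [set ij | large_in (subcube (quarter v ij)) M (quarter v ij) w].

Definition dense t w := [forall v, (t < #|good_quarters v w|)%N].

Definition large_vertices w := [set v | large_in [set: V] M v w].

(** The trials around one vertex are independent because the subcubes are disjoint. Their number
    [h * h] is quadratic in [d], which is what later absorbs the factor [2 ^+ d] of the union over
    [v]. *)
Lemma prob_not_dense t :
  (forall Z v u, {in Z, forall x, (d <= 2 * degree_in Z x)%N} -> (0 < u < M)%N ->
     prob pr (isolated_cluster Z v u) <= beta ^+ u) ->
  prob pr (fun w => ~~ dense t w) <=
  2 ^+ d * (2 ^+ t * (1 - (q1 - 2 * beta) / 2) ^+ (h * h)).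
Proof.
move=> peierls.
apply: (@le_trans _ _ (prob pr (fun w => [exists v, true && (#|good_quarters v w| <= t)%N]))).
  apply: (prob_le pr_ok) => w; rewrite negb_forall => /existsP[v]; rewrite -leqNgt => hv.
  by apply/existsP; exists v.
apply: le_trans (prob_union _ _ pr_ok) _.
have -> : 2 ^+ d = #|{: V}|%:R :> R by rewrite card_ffun card_bool card_ord natrX.
apply: (@le_trans _ _ (\sum_(v : V) (2 ^+ t * (1 - (q1 - 2 * beta) / 2) ^+ (h * h)))); last first.
  by rewrite sumr_const -[leLHS]mulr_natl.
apply: ler_sum => v _.
have -> : (h * h)%N = #|{: 'I_h * 'I_h}| by rewrite card_prod !card_ord.
apply: (@prob_few _ _ _ _ (fun ij => host_support true (subcube (quarter v ij)))) => //.
- by move=> ij kl ne; apply/host_support_disjoint/subcube_quarter_disjoint.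
- by move=> ij; apply: large_in_depends.
- move=> ij; apply: prob_large_in => [|u uM]; first exact: mem_subcube.
  by apply: peierls => //; apply: subcube_degree.
Qed.

Lemma good_quarters_large v ij w : ij \in good_quarters v w -> quarter v ij \in large_vertices w.
Proof. by rewrite !inE; apply: large_in_mono; apply: subsetT. Qed.

(** Double counting of pairs [(v, ij)]: for a fixed [ij] the map [quarter^~ ij] is injective, so
    each large vertex is hit at most once. *)
Lemma card_large_vertices t w : dense t w ->
  (2 ^ d * t.+1 <= h * h * #|large_vertices w|)%N.
Proof.
move=> /forallP dw.
have <- : #|{: V}| = (2 ^ d)%N by rewrite card_ffun card_bool card_ord.
rewrite -sum_nat_const.
apply: (@leq_trans (\sum_(v : V) \sum_(ij : 'I_h * 'I_h) (quarter v ij \in large_vertices w))%N).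
  apply: leq_sum => v _; apply: leq_trans (dw v) _; rewrite -sum1_card big_mkcond.
  apply: leq_sum => ij _; case: ifP => // /good_quarters_large -> //.
rewrite exchange_big -[(h * h)%N]/(h * h)%N.
have -> : (h * h)%N = #|{: 'I_h * 'I_h}| by rewrite card_prod !card_ord.
rewrite -sum_nat_const; apply: leq_sum => ij _.
rewrite -[leqRHS]sum1_card [leqRHS]big_mkcond.
have inj : injective (quarter^~ ij) by move=> x y /flip_injl/flip_injl.
by rewrite [leqRHS](reindex_inj inj) /=; apply: leq_sum => x _; case: ifP.
Qed.

End Density.

(** * Many short paths across a cut *)

Section HammingGeometry.
Local Open Scope nat_scope.
Variable d : nat.
Local Notation V := (vertex d).
Implicit Types (x y z v a b : V) (A B L X I : {set V}).

Definition hamming x y := #|[set i | x i != y i]|.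

Lemma hammingxx x : hamming x x = 0.
Proof. by apply/eqP; rewrite cards_eq0; apply/eqP/setP => i; rewrite !inE eqxx. Qed.

Lemma hammingC x y : hamming x y = hamming y x.
Proof. by apply: eq_card => i; rewrite !inE eq_sym. Qed.

Lemma hamming_triangle y x z : hamming x z <= hamming x y + hamming y z.
Proof.
apply: leq_trans (leq_card_setU _ _); apply/subset_leq_card/subsetP => i.
by rewrite !inE; case: (x i); case: (y i); case: (z i).
Qed.

Lemma hamming_flip x y i : x i != y i -> hamming x y = (hamming (flip x i) y).+1.
Proof.
move=> xyi; rewrite /hamming (cardsD1 i) inE xyi add1n; congr _.+1.
apply: eq_card => j; rewrite !inE ffunE; have [->|ji] := eqVneq j i; last by rewrite addbF.
by rewrite addbT; move: xyi; case: (x i); case: (y i).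
Qed.

Lemma hamming1 x i : hamming x (flip x i) = 1.
Proof.
by rewrite (@hamming_flip _ _ i) ?hammingxx // flip_at; case: (x i).
Qed.

Lemma hamming_neq n x y : hamming x y = n.+1 -> exists i, x i != y i.
Proof.
move=> h; have /card_gt0P[i] : 0 < #|[set i | x i != y i]| by rewrite -/(hamming x y) h.
by rewrite inE; exists i.
Qed.

Lemma cube_path x y : exists s, [/\ path (@cube_adj d) x s, last x s = y,
  size s = hamming x y & all (fun z => hamming x z <= hamming x y) s].
Proof.
have [n] := ubnP (hamming x y); elim: n x => // n IHn x; rewrite ltnS => hn.
case hxy : (hamming x y) => [|m].
  exists [::]; split=> //=; apply/ffunP => i; apply/eqP; apply: contraTT isT => xyi.
  by rewrite (hamming_flip xyi) in hxy.
have [i xyi] := hamming_neq hxy.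
have hE := hamming_flip xyi; rewrite hxy in hE.
have [|s [ps ls ss hs]] := IHn (flip x i); first by case: hE => <-; rewrite -ltnS -hxy.
exists (flip x i :: s); split; rewrite //= ?cube_adj_flip //; first by rewrite ss -hE.
rewrite hamming1 /=; apply/allP => z /(allP hs) hz.
by apply: leq_trans (hamming_triangle (flip x i) _ _) _; rewrite hamming1 hE add1n ltnS.
Qed.

Definition hamming_ball r x := [set y | hamming x y <= r].

Lemma card_hamming_ball r x : #|hamming_ball r x| <= d.+1 ^ r.
Proof.
elim: r => [|r IH].
  suff -> : hamming_ball 0 x = [set x] by rewrite cards1.
  apply/setP => y; rewrite !inE leqn0; apply/eqP/eqP => [|->]; last exact: hammingxx.
  move=> h; apply/ffunP => i; apply/eqP; apply: contraT => yxi.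
  by rewrite hammingC (hamming_flip yxi) in h.
pose step (yo : V * option 'I_d) := if yo.2 is Some i then flip yo.1 i else yo.1.
have sub : hamming_ball r.+1 x \subset step @: setX (hamming_ball r x) [set: option 'I_d].
  apply/subsetP => y; rewrite inE leq_eqVlt ltnS => /orP[/eqP h|h]; last first.
    by apply/imsetP; exists (y, None); rewrite ?inE //= h.
  rewrite hammingC in h; have [i yxi] := hamming_neq h.
  apply/imsetP; exists (flip y i, Some i); last by rewrite /step /= flipK.
  by rewrite !inE andbT hammingC -ltnS -(hamming_flip yxi) h.
apply: leq_trans (subset_leq_card sub) _; apply: leq_trans (leq_imset_card _ _) _.
by rewrite cardsX cardsT card_option card_ord expnSr leq_mul.
Qed.

Lemma card_near r X : #|[set v | [exists x in X, hamming v x <= r]]| <= #|X| * d.+1 ^ r.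
Proof.
rewrite -sum_nat_const.
apply: (@leq_trans #|\bigcup_(x in X) hamming_ball r x|).
  apply/subset_leq_card/subsetP => v; rewrite inE => /exists_inP[x xX vx].
  by apply/bigcupP; exists x; rewrite // inE hammingC.
apply: (big_ind2 (fun (S : {set V}) n => #|S| <= n)); rewrite ?cards0 //.
  by move=> S m S' m' Sm Sm'; apply: leq_trans (leq_card_setU _ _) (leq_add Sm Sm').
by move=> x _; apply: card_hamming_ball.
Qed.

Definition hybrid (k : nat) a b : V := [ffun i : 'I_d => if i < k then b i else a i].

Lemma hybrid0 a b : hybrid 0 a b = a.
Proof. by apply/ffunP => i; rewrite ffunE. Qed.

Lemma hybrid_full a b : hybrid d a b = b.
Proof. by apply/ffunP => i; rewrite ffunE ltn_ord. Qed.

Lemma hybridK k a b : hybrid k (hybrid k b a) (hybrid k a b) = b.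
Proof. by apply/ffunP => i; rewrite !ffunE; case: (i < k). Qed.

Lemma hybrid_step k a b : hamming (hybrid k a b) (hybrid k.+1 a b) <= 1.
Proof.
apply/card_le1_eqP => i j; rewrite !inE !ffunE !ltnS => hi hj; apply/val_inj => /=.
have eqk (l : 'I_d) : (if l < k then b l else a l) != (if l <= k then b l else a l) ->
    l = k :> nat by case: ltngtP => //; rewrite eqxx.
by rewrite (eqk i hi) (eqk j hj).
Qed.

(* The hybrids of [a \in A] and [b \in B] walk from [a] to [b], so they pass near both
   sets, unless they first come near [X]. *)
Definition frontier A B X := [set v | [exists a in A, hamming v a <= 3] &&
    [exists b in B, hamming v b <= 3] || [exists x in X, hamming v x <= 3]].

(** Take a step [k] after which the hybrids stop being within 2 of [A]. The next hybrid has a point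
    of [L] within 2, which must lie in [B] or [X], and is within 3 of the current hybrid. If no such
    step exists, [b] itself is near [A]. *)
Lemma hybrid_frontier L A B X a b :
  (forall v, [exists x in L, hamming v x <= 2]) -> L \subset A :|: B :|: X ->
  a \in A -> b \in B -> exists k : 'I_d.+1, hybrid k a b \in frontier A B X.
Proof.
move=> dense LABX aA bB.
pose P k := [exists a' in A, hamming (hybrid k a b) a' <= 2].
have [Pd|nPd] := boolP (P d).
  exists ord_max; rewrite inE /=; apply/orP; left; apply/andP; split.
    by case/exists_inP: Pd => a' a'A h; apply/exists_inP; exists a' => //; apply: leqW.
  by apply/exists_inP; exists b; rewrite // hybrid_full hammingxx.
have P0 : P 0 by apply/exists_inP; exists a; rewrite // hybrid0 hammingxx.
have [k kd /andP[Pk nPk]] : exists2 k, k < d & P k && ~~ P k.+1.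
  elim: (d) nPd => [|n IH nPn]; first by rewrite P0.
  have [Pn|/IH[k kn Pk]] := boolP (P n); first by exists n; rewrite ?Pn.
  by exists k; rewrite // ltnW.
have kd' : k < d.+1 by apply: ltnW.
exists (Ordinal kd'); rewrite inE /=.
have [l lL hl] := exists_inP (dense (hybrid k.+1 a b)).
have hl3 : hamming (hybrid k a b) l <= 3.
  apply: leq_trans (hamming_triangle (hybrid k.+1 a b) _ _) _.
  by rewrite (leq_add (hybrid_step k a b) hl).
have := subsetP LABX l lL; rewrite !inE => /orP[/orP[lA|lB]|lX].
- by case/negP: nPk; apply/exists_inP; exists l.
- apply/orP; left; apply/andP; split; last by apply/exists_inP; exists l.
  by case/exists_inP: Pk => a' a'A h; apply/exists_inP; exists a' => //; apply: leqW.
- by apply/orP; right; apply/exists_inP; exists l.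
Qed.

Lemma card_frontier L A B X :
  (forall v, [exists x in L, hamming v x <= 2]) -> L \subset A :|: B :|: X ->
  #|A| * #|B| <= #|frontier A B X| * (d.+1 * 2 ^ d).
Proof.
move=> dense LABX.
pose k (a b : V) : 'I_d.+1 := odflt ord0 [pick k : 'I_d.+1 | hybrid k a b \in frontier A B X].
pose f (ab : V * V) := (hybrid (k ab.1 ab.2) ab.1 ab.2,
  (k ab.1 ab.2, hybrid (k ab.1 ab.2) ab.2 ab.1)).
pose g (ckw : V * ('I_d.+1 * V)) :=
  (hybrid ckw.2.1 ckw.1 ckw.2.2, hybrid ckw.2.1 ckw.2.2 ckw.1).
have fK : cancel f g.
  by case=> a b; rewrite /f /g /= !hybridK.
have <- : #|{: 'I_d.+1 * V}| = d.+1 * 2 ^ d.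
  by rewrite card_prod card_ord card_ffun card_bool card_ord.
rewrite -cardsX -(card_imset _ (can_inj fK)) -cardsT -cardsX.
apply/subset_leq_card/subsetP => _ /imsetP[[a b] /setXP[aA bB] ->].
apply/setXP; split; last by rewrite inE.
have [k0 hk0] := hybrid_frontier dense LABX aA bB.
by rewrite /= /k; case: pickP => [//|/(_ k0)]; rewrite hk0.
Qed.

End HammingGeometry.

Lemma separated_subset (T : finType) (near : rel T) (D : nat) (G : {set T}) :
  symmetric near -> (forall x, #|[set y | near x y]| <= D)%N -> (forall x, near x x) ->
  exists I : {set T}, [/\ I \subset G, {in I &, forall x y, x != y -> ~~ near x y} &
    (#|G| <= #|I| * D)%N].
Proof.
move=> near_sym nearD near_refl.
have [n] := ubnP #|G|; elim: n G => // n IHn G; rewrite ltnS => Gn.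
have [->|[x xG]] := set_0Vmem G.
  by exists set0; rewrite sub0set cards0; split=> // x y; rewrite inE.
have [|I [IG sep GI]] := IHn (G :\: [set y | near x y]).
  apply: leq_trans Gn; apply/proper_card/properP; split; first exact: subsetDl.
  by exists x; rewrite // !inE near_refl.
have far y : y \in I -> ~~ near x y by move=> /(subsetP IG); rewrite !inE => /andP[].
have xI : x \notin I by apply/negP => /far; rewrite near_refl.
exists (x |: I); split.
- by rewrite subUset sub1set xG (subset_trans IG) // subsetDl.
- move=> y z; rewrite !inE => /orP[/eqP->|yI] /orP[/eqP->|zI]; rewrite ?eqxx //.
  + by move=> _; apply: far.
  + by move=> _; rewrite near_sym; apply: far.
  + exact: sep.
rewrite cardsU1 xI add1n mulSn -(cardsID [set y | near x y] G) leq_add //.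
by apply: leq_trans (nearD x); rewrite subset_leq_card // subsetIr.
Qed.

(** * Disjoint second-round links between the two sides of a cut *)

Section SprinkledPaths.
Variables (R : realType) (d : nat).
Local Notation V := (vertex d).
Local Notation item := (V + {set V})%type.
Local Notation sample := {set bool * item}.
Implicit Types (X Z L A B U : {set V}) (w : sample) (v x y z a b : V).

Definition graph2 X w : rel V := induced (open_adj (edges2 w)) (verts2 w :\: X).

Fixpoint path_items v (s : seq V) : seq (bool * item) :=
  (false, inl v) ::
  if s is y :: s' then (false, inr [set v; y]) :: path_items y s' else [::].

Lemma size_path_items v s : size (path_items v s) = (2 * size s).+1.
Proof. by elim: s v => //= y s IH v; rewrite IH mulnS. Qed.

Lemma path_items_host v s Z : path (@cube_adj d) v s -> all (mem Z) (v :: s) ->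
  {subset path_items v s <= host_support false Z}.
Proof.
elim: s v => [|y s IH] v /=.
  by move=> _ /andP[vZ _] j; rewrite !inE => /eqP->.
move=> /andP[vy ps] /and3P[vZ yZ sZ] j; rewrite !inE => /or3P[/eqP->|/eqP->|js] //=.
  by rewrite cube_edgesP vy subUset !sub1set vZ yZ.
by have := IH y ps _ j js; rewrite /= yZ sZ inE; apply.
Qed.

Lemma path_items_connect X w v s : path (@cube_adj d) v s -> all (mem (~: X)) (v :: s) ->
  all (mem w) (path_items v s) -> connect (graph2 X w) v (last v s).
Proof.
elim: s v => [|y s IH] v //=.
move=> /andP[vy ps] /and3P[vX yX sX] /and3P[vw ew iw].
have iy : (false, inl y) \in w by case: (s) iw => [|? ?] /=; case/andP.
apply: connect_trans (connect1 _) (IH y ps _ iw); last by rewrite /= yX sX.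
rewrite /graph2 /induced /open_adj /= !inE in vX yX *.
by rewrite vX yX vw iy vy ew.
Qed.

Lemma graph2_sym X w : symmetric (graph2 X w).
Proof. exact/induced_sym/open_adj_sym. Qed.

Definition linked A B X w := [exists a in A, exists b in B, connect (graph2 X w) a b].

Lemma linked_depends A B X : depends_on (linked A B X) [set j | ~~ j.1].
Proof.
move=> w w' e; apply: eq_existsb => a; congr (_ && _); apply: eq_existsb => b.
congr (_ && _); apply: eq_connect => x y.
by rewrite /graph2 /induced /open_adj /= !inE !e ?inE.
Qed.

(* [S] is made of geodesics from the centre [v] to both sides; its ball avoids [X]. *)
Lemma frontier_link A B X v :
  v \in frontier A B X :\: [set v | [exists x in X, (hamming v x <= 3)%N]] ->
  exists S : sample, [/\ S \subset host_support false (hamming_ball 3 v), (#|S| <= 14)%N &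
    forall w, S \subset w -> linked A B X w].
Proof.
rewrite in_setD inE => /andP[nX]; rewrite inE (negPf nX) orbF.
case/andP=> /exists_inP[a aA va] /exists_inP[b bB vb].
have branch y : (hamming v y <= 3)%N -> exists s, [/\ path (@cube_adj d) v s,
    last v s = y, (size s <= 3)%N & all (mem (hamming_ball 3 v)) (v :: s)].
  move=> vy; have [s [ps ls ss hs]] := cube_path v y.
  exists s; split=> //; first by rewrite ss.
  rewrite /= inE hammingxx /=; apply/allP => z zs; rewrite /= inE.
  exact: leq_trans (allP hs z zs) vy.
have [sa [pa la ssa ha]] := branch a va; have [sb [pb lb ssb hb]] := branch b vb.
have ballX s : all (mem (hamming_ball 3 v)) s -> all (mem (~: X)) s.
  apply: sub_all => z; rewrite /= !inE => vz; apply: contra nX => zX.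
  by apply/exists_inP; exists z.
exists [set j in path_items v sa ++ path_items v sb]; split.
- apply/subsetP => j; rewrite inE mem_cat => /orP[].
    exact: path_items_host pa ha j.
  exact: path_items_host pb hb j.
(* Each branch has at most 3 edges and 4 vertices, hence 7 items. *)
- rewrite cardsE; apply: leq_trans (card_size _) _.
  by rewrite size_cat !size_path_items; move: ssa ssb; clear; lia.
move=> w /subsetP sw; apply/exists_inP; exists a => //; apply/exists_inP; exists b => //.
have all_w s : {subset path_items v s <= path_items v sa ++ path_items v sb} ->
    all (mem w) (path_items v s).
  by move=> h; apply/allP => j js; apply: sw; rewrite inE h.
apply: (@connect_trans _ _ v).
  rewrite (sym_connect_sym (graph2_sym X w)) -la; apply: path_items_connect => //.
    exact: ballX ha.
  by apply: all_w => j js; rewrite mem_cat js.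
rewrite -lb; apply: path_items_connect => //; first exact: ballX hb.
by apply: all_w => j js; rewrite mem_cat js orbT.
Qed.

Variables q1 p1 s : R.
Hypotheses (q1_01 : 0 <= q1 <= 1) (p1_01 : 0 <= p1 <= 1) (s_01 : 0 <= s <= 1).
Let pr := @round_proba R d q1 s p1 s.
Let pr_ok : proba_family pr := round_proba_family q1_01 s_01 p1_01 s_01.

(** Frontier vertices not near [X] are thinned to pairwise distance more than 6. Their balls of
    radius 3 are then disjoint and their links independent. [N] is the number kept; [d.+1 ^ 6] pays
    for the thinning and [#|X| * d.+1 ^ 3] for the vertices near [X]. *)
Lemma prob_not_linked_le L A B X :
  (forall v, [exists x in L, (hamming v x <= 2)%N]) -> L \subset A :|: B :|: X ->
  exists2 N, (#|A| * #|B| <= (N * d.+1 ^ 6 + #|X| * d.+1 ^ 3) * (d.+1 * 2 ^ d))%N &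
    prob pr (fun w => ~~ linked A B X w) <= (1 - s ^+ 14) ^+ N.
Proof.
move=> dense LABX; have [s0 s1] := andP s_01.
pose N3 := [set v | [exists x in X, (hamming v x <= 3)%N]].
pose near x y := (hamming x y <= 6)%N.
have [|||I [IG sep cI]] := @separated_subset _ near (d.+1 ^ 6) (frontier A B X :\: N3).
- by move=> x y; rewrite /near hammingC.
- exact: card_hamming_ball.
- by move=> x; rewrite /near hammingxx.
have [S hS] : exists S : V -> sample, forall v, v \in I ->
    [/\ S v \subset host_support false (hamming_ball 3 v), (#|S v| <= 14)%N &
        forall w, S v \subset w -> linked A B X w].
  apply: (@fin_all_exists _ (fun=> sample) (fun v (Sv : sample) => v \in I ->
     [/\ Sv \subset host_support false (hamming_ball 3 v), (#|Sv| <= 14)%N &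
        forall w, Sv \subset w -> linked A B X w])) => v.
  case vI : (v \in I); last by exists set0.
  by have [Sv hv] := frontier_link (subsetP IG v vI); exists Sv.
exists #|I|.
  apply: leq_trans (card_frontier dense LABX) _; rewrite leq_mul2r; apply/orP; right.
  by rewrite -(cardsID N3) addnC leq_add // (leq_trans _ (card_near 3 X)) //
    subset_leq_card // subsetIr.
apply: (@le_trans _ _ (prob pr (fun w => [forall v, (v \in I) ==> ~~ (S v \subset w)]))).
  apply: (prob_le pr_ok) => w nl; apply/forall_inP => v vI; apply: contra nl.
  by have [_ _] := hS v vI; apply.
rewrite (@prob_forall_indep _ _ _ _ _ S); last first.
- by move=> v _ w w' e; rewrite (depends_on_subset e).
- move=> x y xI yI xy; have [hx _ _] := hS x xI; have [hy _ _] := hS y yI.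
  apply: disjointW hx hy _; apply: host_support_disjoint.
  rewrite disjoint_subset; apply/subsetP => z; rewrite !inE => xz; apply/negP => yz.
  case/negP: (sep x y xI yI xy); apply: leq_trans (hamming_triangle z x y) _.
  by rewrite (hammingC z) (leq_add xz yz).
rewrite -prodr_const; apply: ler_prod => v vI; rewrite prob_ge0 //=.
rewrite prob_not prob_subset lerD2l lerN2; have [hv cv _] := hS v vI.
rewrite (eq_bigr (fun=> s)) => [|j /(subsetP hv)].
  by rewrite prodr_const; apply: ler_wiXn2l.
case: j => r [x|e]; rewrite inE /= /pr /round_proba /=; first by case/andP=> /eqP->.
by case/and3P=> /eqP-> ->.
Qed.

End SprinkledPaths.

(** * Union bound over encoded cuts *)

Section WellLinked.
Variables (R : realType) (d : nat).
Local Notation V := (vertex d).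
Local Notation item := (V + {set V})%type.
Local Notation sample := {set bool * item}.
Implicit Types (X Z L A B U Q : {set V}) (w : sample) (v x y z a b : V) (g : rel V).

(** [Q] is a set of generators for one side of the cut. Quantifying over [Q] instead of over the
    side itself keeps the union bound affordable. *)
Definition cut_closure L g X Q :=
  [set v in L :\: X | [exists r in Q, connect (induced g (~: X)) r v]].

(* The inequality lets the number of disjoint paths beat the number of pairs [(X, Q)]. *)
Definition cut_condition M L g X Q :=
  let A := cut_closure L g X Q in
  (#|A| <= #|L :\: X :\: A|)%N && (M * (#|Q| + d * #|X| + 1) <= 4 * #|A|)%N.

Definition well_linked M L g w := [forall X, forall Q, cut_condition M L g X Q ==>
  linked (cut_closure L g X Q) (L :\: X :\: cut_closure L g X Q) X w].

Lemma sum_set_pow (T : finType) (z : R) : \sum_(A : {set T}) z ^+ #|A| = (z + 1) ^+ #|T|.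
Proof.
have -> : (z + 1) ^+ #|T| = \prod_(t : T) (z + 1) by rewrite prodr_const.
rewrite (@bigA_distr R 0 1 *%R +%R T (fun=> z) (fun=> 1)).
apply: eq_bigr => A _; rewrite -prodr_const big_mkcond; exact: eq_bigr.
Qed.

Variables q1 p1 : R.
Hypotheses (q1_01 : 0 <= q1 <= 1) (p1_01 : 0 <= p1 <= 1) (d0 : (0 < d)%N).
Let s : R := d%:R^-1.
Let pr := @round_proba R d q1 s p1 s.

Let s_01 : 0 <= s <= 1.
Proof.
by rewrite invr_ge0 ler0n /= invf_le1 ?ltr0n // ler1n.
Qed.

Let pr_ok : proba_family pr := round_proba_family q1_01 s_01 p1_01 s_01.

(** A link opens with probability [d ^ -14], so [2 * d ^ 15 * m] of them all fail with probability
    at most [expR (- 2 d m)], and [expR (- 2) <= 1 / 4]. *)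
Lemma few_paths_bound N m : (2 * d ^ 15 * m <= N)%N ->
  (1 - s ^+ 14) ^+ N <= ((1 / 4) ^+ d) ^+ m.
Proof.
move=> hN; have [s0 s1] := andP s_01.
have s14 : 0 <= s ^+ 14 by rewrite exprn_ge0.
have s14' : s ^+ 14 <= 1 by rewrite exprn_ile1.
apply: (@le_trans _ _ (expR (- s ^+ 14) ^+ N)).
  apply: lerXn2r; rewrite ?nnegrE ?expR_ge0 ?subr_ge0 //.
  exact: expR_ge1Dx.
apply: (@le_trans _ _ (expR (- s ^+ 14) ^+ (2 * d ^ 15 * m))).
  by apply: ler_wiXn2l; rewrite ?expR_ge0 // expR_le1 oppr_le0.
rewrite -exprM -expRM_natl.
have -> : (2 * d ^ 15 * m)%N%:R * - s ^+ 14 = (d * m)%N%:R * (- 2) :> R.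
  have dne : d%:R != 0 :> R by rewrite pnatr_eq0 -lt0n.
  rewrite (natrM _ _ m) (natrM _ 2) (natrM _ d m) natrX (exprS _ 14) /s exprVn; field; exact: dne.
rewrite expRM_natl; apply: lerXn2r; rewrite ?nnegrE ?expR_ge0 //.
rewrite expRN -[1 / 4]/(1 * 4^-1) mul1r lef_pV2 ?posrE ?expR_gt0 //.
have e1 : 2 <= expR 1 :> R by have := expR_ge1Dx (1 : R); lra.
have -> : 4 = 2 ^+ 2 :> R by rewrite -natrX.
have -> : expR 2 = expR 1 ^+ 2 :> R by rewrite -expRM_natl mulr1.
by apply: lerXn2r; rewrite ?nnegrE ?expR_ge0.
Qed.

(** Here [a], [b], [x], [r], [l] stand for the sizes of the two sides, [X], [Q] and [L]. As
    [x <= a <= b], the larger side has at least [2 ^ d / (3 * n0)] vertices, so the frontier bound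
    forces [a <= 3 * n0 * d.+1 ^ 7 * (N + x)]. *)
Lemma cut_paths_bound n0 (M a b x r l N : nat) :
  (2 ^ d <= n0 * l)%N -> (l <= a + b + x)%N -> (a <= b)%N ->
  (12 * n0 * d.+1 ^ 7 * (2 * d ^ 15).+1 <= M)%N ->
  (M * (r + d * x + 1) <= 4 * a)%N ->
  (a * b <= (N * d.+1 ^ 6 + x * d.+1 ^ 3) * (d.+1 * 2 ^ d))%N ->
  (2 * d ^ 15 * (x + r + 1) <= N)%N.
Proof.
move=> hl hlab ab hM hcut hN.
set D := (d ^ 15)%N in hM *; set E := (2 ^ d)%N in hl hN.
have E0 : (0 < E)%N by rewrite expn_gt0.
have n00 : (0 < n0)%N by case: n0 hl {hM} => //; rewrite mul0n leqNgt E0.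
have M4 : (4 <= M)%N.
  apply: leq_trans hM; rewrite -!mulnA -[X in (X <= _)%N]/(4 * 1)%N leq_mul //.
  by rewrite !muln_gt0 n00 ?expn_gt0.
have m_le : (x + r + 1 <= r + d * x + 1)%N.
  by rewrite leq_add2r addnC leq_add2l leq_pmull.
have xa : (x <= a)%N.
  have : (4 * (x + r + 1) <= M * (r + d * x + 1))%N by rewrite leq_mul.
  by move: hcut; clear; lia.
have hb : (E <= 3 * n0 * b)%N.
  apply: leq_trans hl _; rewrite [(3 * n0)%N]mulnC -mulnA leq_mul2l; apply/orP; right.
  by move: hlab ab xa; clear; lia.
have step : (a * E <= 3 * n0 * d.+1 ^ 7 * (N + x) * E)%N.
  apply: (@leq_trans (a * (3 * n0 * b))); first by rewrite leq_mul2l hb orbT.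
  apply: (@leq_trans (3 * n0 * ((N * d.+1 ^ 6 + x * d.+1 ^ 3) * (d.+1 * E)))%N).
    by rewrite mulnCA leq_mul2l hN orbT.
  have -> : (3 * n0 * d.+1 ^ 7 * (N + x) * E = 3 * n0 * ((N + x) * d.+1 ^ 6 * (d.+1 * E)))%N.
    by rewrite (expnS _ 6); ring.
  rewrite leq_mul2l; apply/orP; right; rewrite leq_mul2r; apply/orP; right.
  by rewrite mulnDl leq_add2l leq_mul2l leq_pexp2l ?orbT.
rewrite leq_pmul2r // in step.
set K := (12 * n0 * d.+1 ^ 7)%N in hM.
have K0 : (0 < K)%N by rewrite !muln_gt0 n00 ?expn_gt0.
(* The successor in [(2 * D).+1] leaves one spare copy of [x + r + 1], which cancels the [x] lost
   near the deleted set. *)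
have h1 : (K * ((2 * D).+1 * (x + r + 1)) <= K * (N + x))%N.
  apply: (@leq_trans (M * (x + r + 1))); first by rewrite mulnA leq_mul2r hM orbT.
  apply: (@leq_trans (4 * a)); first by apply: leq_trans hcut; rewrite leq_mul2l m_le orbT.
  have -> : (K * (N + x) = 4 * (3 * n0 * d.+1 ^ 7 * (N + x)))%N by rewrite /K; ring.
  by rewrite leq_mul2l step orbT.
rewrite leq_pmul2l // mulSn in h1.
by move: h1; move: (2 * D * (x + r + 1))%N => t; clear; lia.
Qed.

(** With [z = 4 ^ -d], a bad pair has probability at most [z ^+ (#|X| + #|Q| + 1)]. Summed over all
    pairs this is [(1 + z) ^+ (2 * 2 ^ d) * z]. The power stays below 4 since [2 ^ d * z <= 1 / 2],
    and the [+ 1] in [cut_condition] provides the last factor [z]. *)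
Lemma prob_not_well_linked n0 M L g :
  (forall v, [exists x in L, (hamming v x <= 2)%N]) -> (2 ^ d <= n0 * #|L|)%N ->
  (12 * n0 * d.+1 ^ 7 * (2 * d ^ 15).+1 <= M)%N ->
  prob pr (fun w => ~~ well_linked M L g w) <= 4 * (1 / 4) ^+ d.
Proof.
move=> dense bigL hM; pose z : R := (1 / 4) ^+ d.
have z0 : 0 <= z by rewrite exprn_ge0 //; lra.
pose bad (XQ : {set V} * {set V}) w := ~~ linked (cut_closure L g XQ.1 XQ.2)
  (L :\: XQ.1 :\: cut_closure L g XQ.1 XQ.2) XQ.1 w.
apply: (@le_trans _ _ (prob pr (fun w => [exists XQ,
    cut_condition M L g XQ.1 XQ.2 && bad XQ w]))).
  apply: (prob_le pr_ok) => w; rewrite negb_forall => /existsP[X].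
  rewrite negb_forall => /existsP[Q]; rewrite negb_imply => h.
  by apply/existsP; exists (X, Q).
apply: le_trans (prob_union _ _ pr_ok) _.
apply: (@le_trans _ _ (\sum_(XQ : {set V} * {set V}) z ^+ (#|XQ.1| + #|XQ.2| + 1))).
  rewrite [leLHS]big_mkcond; apply: ler_sum => -[X Q] _ /=.
  case: ifP => [|_]; last exact: exprn_ge0.
  rewrite /cut_condition /bad /=; set A := cut_closure L g X Q => /andP[AB cut].
  have LABX : L \subset A :|: (L :\: X :\: A) :|: X.
    by apply/subsetP => v vL; rewrite !in_setU !in_setD vL; case: (v \in A); case: (v \in X).
  have [N hN hp] := prob_not_linked_le q1_01 p1_01 s_01 dense LABX.
  apply: le_trans hp _; apply: few_paths_bound; apply: cut_paths_bound bigL _ AB hM cut hN.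
  apply: leq_trans (subset_leq_card LABX) _; apply: leq_trans (leq_card_setU _ _) _.
  by rewrite leq_add2r leq_card_setU.
have half : (z + 1) ^+ #|{: V}| <= 2.
  rewrite card_ffun card_bool card_ord; apply: (@le_trans _ _ (expR z ^+ (2 ^ d))).
    apply: lerXn2r; rewrite ?nnegrE ?expR_ge0 ?addr_ge0 // addrC; exact: expR_ge1Dx.
  rewrite -expRM_natl; set y := _ * z.
  have yE : y = (1 / 2) ^+ d.
    by rewrite /y /z natrX -exprMn; congr (_ ^+ _); lra.
  have yh : y <= 1 / 2 by rewrite yE -(prednK d0) exprS ler_piMr ?exprn_ile1 //; lra.
  have := expR_ge1Dx (- y); rewrite expRN => h.
  rewrite -[leRHS]invrK -[leLHS]invrK lef_pV2 ?posrE ?invr_gt0 ?expR_gt0 //.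
  by apply: le_trans h; lra.
have -> : \sum_(XQ : {set V} * {set V}) z ^+ (#|XQ.1| + #|XQ.2| + 1) =
    (z + 1) ^+ #|{: V}| * (z + 1) ^+ #|{: V}| * z.
  rewrite -(pair_bigA _ (fun X Q : {set V} => z ^+ (#|X| + #|Q| + 1))) /=.
  rewrite -sum_set_pow !mulr_suml; apply: eq_bigr => X _.
  rewrite mulr_sumr mulr_suml; apply: eq_bigr => Q _.
  by rewrite !exprD expr1.
have p0 : 0 <= (z + 1) ^+ #|{: V}| by rewrite exprn_ge0 // addr_ge0.
apply: ler_wpM2r => //; have -> : 4 = 2 * 2 :> R by rewrite -natrM.
by apply: ler_pM.
Qed.

Lemma well_linked_depends M L g : depends_on (well_linked M L g) [set j | ~~ j.1].
Proof.
move=> w w' e; apply: eq_forallb => X; apply: eq_forallb => Q.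
by congr (_ ==> _); apply: linked_depends.
Qed.

End WellLinked.

(** * The giant component and its diameter *)

Section Distances.
Local Open Scope nat_scope.
Variables (T : finType) (e : rel T).
Implicit Types (x y z : T).

Lemma has_walkP x y n :
  reflect (exists s, [/\ size s = n, path e x s & last x s = y]) (has_walk e x y n).
Proof.
apply: (iffP existsP) => [[w /andP[pw /eqP lw]]|[s [ss ps ls]]].
  by exists w; rewrite size_tuple.
have ss' : size s == n by rewrite ss.
by exists (Tuple ss'); rewrite /= ps ls eqxx.
Qed.

Lemma dist_le x y n : has_walk e x y n -> dist e x y <= n.
Proof.
move=> hw; have [nT|nT] := ltnP n #|T|; last first.
  by apply: leq_trans nT; rewrite -[leqRHS](size_iota 0) find_size.
rewrite leqNgt; apply/negP => /(before_find 0).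
by rewrite nth_iota // add0n hw.
Qed.

Lemma dist_walk x y : connect e x y -> has_walk e x y (dist e x y).
Proof.
move=> /connectP[s ps ->]; case/shortenP: ps => s' ps' us' _.
have hs : size s' < #|T|.
  by have := max_card (mem (x :: s')); rewrite (card_uniqP us').
have hh : has (has_walk e x (last x s')) (iota 0 #|T|).
  apply/hasP; exists (size s'); first by rewrite mem_iota.
  by apply/has_walkP; exists s'.
have := nth_find 0 hh; rewrite nth_iota ?add0n //.
by move: hh; rewrite has_find size_iota.
Qed.

Lemma dist_step x y z : connect e x y -> e y z -> dist e x z <= (dist e x y).+1.
Proof.
move=> /dist_walk/has_walkP[s [ss ps ls]] yz; apply/dist_le/has_walkP.
by exists (rcons s z); rewrite size_rcons ss rcons_path ps ls last_rcons.
Qed.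

(** A shorter walk to an intermediate vertex, followed by the rest of the path, would beat the
    distance of the endpoints. *)
Lemma geodesic x y : connect e x y -> exists s, [/\ path e x s, size s = dist e x y,
  last x s = y & forall i, i <= dist e x y -> dist e x (nth x (x :: s) i) = i].
Proof.
move=> cxy; have /has_walkP[s [ss ps ls]] := dist_walk cxy.
exists s; split=> // i iD.
have is1 : i <= size s by rewrite ss.
have lt : last x (take i s) = nth x (x :: s) i.
  by rewrite (last_nth x) size_takel // -[x :: take i s]/(take i.+1 (x :: s)) nth_take.
have := ps; rewrite -{1}(cat_take_drop i s) cat_path => /andP[p1 p2].
apply/eqP; rewrite eqn_leq; apply/andP; split.
  by apply/dist_le/has_walkP; exists (take i s); rewrite size_takel.
have ci : connect e x (nth x (x :: s) i) by rewrite -lt; apply/connectP; exists (take i s).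
have /has_walkP[s1 [ss1 ps1 ls1]] := dist_walk ci.
have : dist e x y <= dist e x (nth x (x :: s) i) + (size s - i).
  apply/dist_le/has_walkP; exists (s1 ++ drop i s).
  rewrite size_cat ss1 size_drop cat_path ps1 ls1 -lt p2 last_cat ls1 -lt.
  by split=> //; rewrite -[LHS]last_cat cat_take_drop.
by rewrite ss; move: iD; move: (dist e x y) (dist e x _); clear; lia.
Qed.

End Distances.

Section CutRepresentation.
Local Open Scope nat_scope.
Variables (d : nat).
Local Notation V := (vertex d).
Variables (g : rel V) (L : {set V}) (M : nat).
Hypotheses (g_sym : symmetric g) (g_cube : subrel g (@cube_adj d))
  (L_closed : forall x y, g x y -> x \in L -> y \in L)
  (L_large : forall x, x \in L -> M <= #|[set y | connect g x y]|).

(* [A] is recovered from its vertices next to [X] and one vertex in each of its full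
   [g]-components; the latter are few, as these components are large. *)
Lemma cut_closure_repr (X A : {set V}) : A \subset L :\: X ->
  (forall x y, x \in A -> y \in L :\: X -> g x y -> y \in A) ->
  exists2 Q, cut_closure L g X Q = A & M * #|Q| <= #|A| + M * (d * #|X|).
Proof.
move=> ALX A_closed.
have csym : connect_sym g by apply: sym_connect_sym.
have AL a : a \in A -> a \in L by move=> /(subsetP ALX)/setDP[].
have AX a : a \in A -> a \notin X by move=> /(subsetP ALX)/setDP[].
pose Q1 := [set a in A | [exists x in X, cube_adj a x]].
pose full := [set a in A | [set y | connect g a y] \subset A].
pose Q2 := [set fingraph.root g a | a in full].
have cQ1 : #|Q1| <= d * #|X|.
  have sub : Q1 \subset [set flip xi.1 xi.2 | xi in setX X [set: 'I_d]].
    apply/subsetP => a; rewrite inE => /andP[_ /exists_inP[x xX]].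
    rewrite cube_adj_sym => /cube_adjP[i ->]; apply/imsetP; exists (x, i) => //.
    by rewrite !inE xX.
  apply: leq_trans (subset_leq_card sub) _; apply: leq_trans (leq_imset_card _ _) _.
  by rewrite cardsX cardsT card_ord mulnC.
have cQ2 : M * #|Q2| <= #|A|.
  rewrite mulnC -sum_nat_const.
  apply: (@leq_trans (\sum_(r in Q2) \sum_(a in A | fingraph.root g a == r) 1)).
    apply: leq_sum => r /imsetP[a]; rewrite inE => /andP[aA /subsetP aF] ->.
    apply: leq_trans (L_large (AL a aA)) _; rewrite sum1dep_card.
    apply/subset_leq_card/subsetP => y ay; rewrite inE aF //=.
    by rewrite inE in ay; apply/eqP/(rootP csym); rewrite csym.
  rewrite -[leqRHS]sum1_card [leqRHS](bigID (fun a => fingraph.root g a \in Q2)) /=.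
  apply: leq_trans (leq_addr _ _).
  rewrite [leqRHS](partition_big (fingraph.root g) (mem Q2)) => [|a /andP[] //].
  apply: leq_sum => r rQ; rewrite eq_leq //; apply: eq_bigl => a.
  by case: eqP => [->|]; rewrite ?andbF //= ?(andbT, rQ).
exists (Q1 :|: Q2); last first.
  apply: leq_trans (leq_mul (leqnn M) (leq_card_setU _ _)) _.
  by rewrite mulnDr addnC leq_add // leq_mul2l cQ1 orbT.
have QA q : q \in Q1 :|: Q2 -> q \in A.
  case/setUP => [|/imsetP[a]]; rewrite inE => /andP[aA] // /subsetP aF ->.
  by apply: aF; rewrite inE connect_root.
have stay q s : q \in A -> path (induced g (~: X)) q s -> last q s \in A.
  elim: s q => //= y s IH q qA /andP[/and3P[qX yX gqy] ps]; apply: IH ps.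
  apply: (A_closed q y qA _ gqy); rewrite inE; rewrite inE in yX; rewrite yX /=.
  exact: L_closed gqy (AL q qA).
apply/setP => a; rewrite inE; apply/andP/idP => [[_ /exists_inP[q qQ]]|aA].
  by move=> /connectP[s ps ->]; apply: stay ps; apply: QA.
split; first exact: (subsetP ALX).
have ind_sym : symmetric (induced g (~: X)) by apply: induced_sym.
(* If the component of [a] avoids [X], it lies in [A] and its root in [Q2] reaches [a]. Otherwise a
   path from [a] to [X] has a vertex of [Q1] just before it first enters [X]. *)
have [disj|] := boolP [disjoint [set y | connect g a y] & X].
  have inA : [set y | connect g a y] \subset A.
    apply/subsetP => y; rewrite inE => /connectP[s ps ->].
    elim/last_ind: s ps => [|s z IH] //=; rewrite rcons_path last_rcons => /andP[ps gz].
    apply: (A_closed _ _ (IH ps) _ gz); rewrite inE (L_closed gz (AL _ (IH ps))) andbT.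
    rewrite (disjointFr disj) // inE; apply/connectP; exists (rcons s z).
      by rewrite rcons_path ps.
    by rewrite last_rcons.
  apply/exists_inP; exists (fingraph.root g a).
    by apply/setUP; right; apply: imset_f; rewrite inE aA.
  rewrite (sym_connect_sym ind_sym).
  have /connectP[s ps ->] := connect_root g a.
  elim/last_ind: s ps => [|s z IH] //=; rewrite rcons_path last_rcons => /andP[ps gz].
  apply: connect_trans (IH ps) (connect1 _).
  have cl : connect g a (last a s) by apply/connectP; exists s.
  have cz : connect g a z by apply: connect_trans cl (connect1 gz).
  by rewrite /induced /= gz !inE !(disjointFr disj) // inE.
rewrite -setI_eq0 => /set0Pn[x /setIP[]]; rewrite inE => /connectP[s ps ->{x}] xX.
elim: s a aA ps xX => [|y s IH] a aA /=; first by move=> _ /(negP (AX a aA)).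
move=> /andP[gay ps] lX.
have [yX|yX] := boolP (y \in X).
  apply/exists_inP; exists a; rewrite ?connect0 // inE; apply/orP; left.
  by rewrite inE aA; apply/exists_inP; exists y; rewrite // g_cube.
have yA : y \in A by apply: (A_closed a y aA _ gay); rewrite inE yX (L_closed gay) // AL.
have /exists_inP[q qQ cq] := IH y yA ps lX.
apply/exists_inP; exists q => //; apply: connect_trans cq (connect1 _).
by rewrite /induced /= !inE yX AX //= g_sym.
Qed.

End CutRepresentation.

(** Used with [E = 2 ^ d], [D] a too long distance and [x] the size of layer [r]. Then
    [x <= 4 * d ^ 8], while both ends of the geodesic have length at least [D %/ 3], so dividing by
    [d] still leaves far more than [M * (2 * (d * x) + 1)]. *)
Lemma layer_numerics (d M E D r x : nat) : (0 < d)%N -> (0 < M)%N ->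
  (M * (8 * (d * d ^ 8)).+1 * (d * (4 * d ^ 8)) <= E)%N -> (E < D * d ^ 8)%N ->
  (D %/ 3 <= r < D %/ 3 + D %/ 3)%N -> (x * (D %/ 3) <= E)%N ->
  (M * (2 * (d * x) + 1) <= 3 * (r %/ d))%N /\
  (M * (2 * (d * x) + 1) <= 3 * ((D - r) %/ d))%N.
Proof.
move=> d0 M0; have : (0 < d ^ 8)%N by rewrite expn_gt0 d0.
move: (d ^ 8)%N => P P0; set T := (M * _)%N => hE ED rr xE.
have T9 : (9 <= T)%N.
  rewrite /T -[X in (X <= _)%N]mul1n leq_mul // ltnS -[X in (X <= _)%N]muln1.
  by rewrite leq_mul // muln_gt0 d0.
have hD : (T * d * 4 < D)%N.
  rewrite -(ltn_pmul2r P0); apply: leq_ltn_trans ED; apply: leq_trans hE.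
  by rewrite eq_leq //; ring.
have Td : (T <= T * d)%N by rewrite leq_pmulr.
have r0_big : (0 < D %/ 3)%N by lia.
have D4 : (D <= 4 * (D %/ 3))%N by lia.
have x4 : (x <= 4 * P)%N.
  rewrite -(leq_pmul2r r0_big); apply: leq_trans xE _; apply: leq_trans (ltnW ED) _.
  by rewrite mulnAC leq_mul2r D4 orbT.
have MT : (M * (2 * (d * x) + 1) <= T)%N.
  rewrite /T leq_mul2l addn1 ltnS; apply/orP; right.
  have -> : (8 * (d * P) = 2 * (d * (4 * P)))%N by ring.
  by rewrite !leq_mul2l x4 !orbT.
have Tr0 : (T * d <= D %/ 3)%N by lia.
have key z : (D %/ 3 <= z)%N -> (M * (2 * (d * x) + 1) <= 3 * (z %/ d))%N.
  move=> hz; apply: leq_trans MT _.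
  have : (T <= z %/ d)%N by rewrite leq_divRL // (leq_trans Tr0).
  by move=> h; apply: leq_trans h _; rewrite leq_pmull.
by split; apply: key; lia.
Qed.

Section GiantComponent.
Local Open Scope nat_scope.
Variable d : nat.
Local Notation V := (vertex d).
Local Notation item := (V + {set V})%type.
Variables (w : {set bool * item}) (M n0 : nat).
Hypotheses (d0 : 0 < d) (M0 : 0 < M).

Let W := verts w.
Let G : rel V := induced (open_adj (edges w)) W.
Let g := graph1 [set: V] w.
Let L := large_vertices M w.

Hypothesis no_gap : forall v u, d <= u <= d * M -> ~~ isolated_cluster [set: V] v u w.

Let G_sym : symmetric G. Proof. exact/induced_sym/open_adj_sym. Qed.
Let g_sym : symmetric g. Proof. exact: graph1_sym. Qed.

Let edges1_sub : edges1 w \subset edges w.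
Proof. by rewrite edgesE subsetUl. Qed.

Let verts1_sub : verts1 w \subset W.
Proof. by rewrite /W vertsE subsetUl. Qed.

Let g_G : subrel g G.
Proof.
move=> x y /and3P[/setIP[_ x1] /setIP[_ y1] /andP[xy e]].
by apply/and3P; split; rewrite ?(subsetP verts1_sub) // /open_adj /= xy (subsetP edges1_sub).
Qed.

Let G_cube : subrel G (@cube_adj d).
Proof. by move=> x y /and3P[_ _ /andP[]]. Qed.

Let graph2_G X : subrel (graph2 X w) G.
Proof.
move=> x y /and3P[/setDP[x2 _] /setDP[y2 _] /andP[xy e]].
by rewrite /G /induced /open_adj /= /W vertsE edgesE !inE in x2 y2 e *;
  rewrite x2 y2 xy e !orbT.
Qed.

Let L_sub : L \subset W.
Proof.
by apply/subsetP => x; rewrite inE => /andP[/setIP[_ /(subsetP verts1_sub)]].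
Qed.

Let L_large x : x \in L -> M <= #|[set y | connect g x y]|.
Proof. by rewrite inE => /andP[]. Qed.

Let L_connect x y : connect g x y -> x \in L -> y \in L.
Proof.
move=> cxy; rewrite !inE => /andP[xW xM]; apply/andP; split.
  by have := subsetP (cluster1_sub xW) y; rewrite inE; apply.
apply: leq_trans xM _; apply/subset_leq_card/subsetP => z; rewrite !inE => cxz.
by apply: connect_trans _ cxz; rewrite connect_graph1_sym.
Qed.

Lemma connected_hits_large U v : connected_from (open_adj (edges w)) U v -> v \in U ->
  U \subset W -> #|U| = d -> exists2 x, x \in U & x \in L.
Proof.
move=> cU vU UW Ud; apply/exists_inP; apply: contraT => /exists_inPn noL.
pose U' := \bigcup_(x in U) cluster1 [set: V] w x.
have UU' : U \subset U'.
  by apply/subsetP => x xU; apply/bigcupP; exists x; rewrite ?mem_cluster1.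
have single x : x \notin verts1 w -> cluster1 [set: V] w x = [set x].
  move=> x1; apply/setP => y; rewrite !inE; apply/connectP/eqP => [[[|z s] /=]|->].
  - by move=> _ ->.
  - by case/andP=> /and3P[]; rewrite inE (negPf x1) andbF.
  - by exists [::].
have small x : x \in U -> #|cluster1 [set: V] w x| <= M.
  move=> xU; have [x1|x1] := boolP (x \in verts1 w); last by rewrite single // cards1.
  apply/ltnW; rewrite ltnNge; apply: contra (noL x xU) => big.
  by rewrite inE /large_in in_setI in_setT x1 big.
have U'd : #|U'| <= d * M.
  rewrite -[leqRHS](congr1 (muln^~ M) Ud) -sum_nat_const.
  apply: (big_rec2 (fun (S : {set V}) n => #|S| <= n)); first by rewrite cards0.
  move=> x n S xU Sn; apply: leq_trans (leq_card_setU _ _) _.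
  by rewrite leq_add ?small.
have vU' := subsetP UU' v vU.
have U'b : d <= #|U'| <= d * M.
  by have := subset_leq_card UU'; rewrite Ud U'd andbT.
case/negP: (no_gap v U'b).
apply/existsP; exists U'; rewrite vU' eqxx /=; apply/and3P; split.
- apply/subsetP => y /bigcupP[x xU yx]; rewrite inE in_setT /=.
  have [x1|x1] := boolP (x \in verts1 w).
    have /cluster1_sub/subsetP/(_ y yx) : x \in [set: V] :&: verts1 w by rewrite inE in_setT.
    by case/setIP=> _ /(subsetP verts1_sub).
  by move: yx; rewrite single // inE => /eqP->; apply: (subsetP UW).
- apply/forall_inP => y /bigcupP[x xU yx].
  apply: connect_trans (connected_fromW UU' cU xU) _.
  have sub : cluster1 [set: V] w x \subset U'.
    by apply/subsetP => z zx; apply/bigcupP; exists x.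
  exact: (connected_fromW sub (connected_cluster1 [set: V] w x) yx).
apply/forall_inP => x /setIP[/bigcupP[x0 x0U x0x] x1].
apply/forall_inP => y /setIP[/setDP[_ yU'] y1].
apply: contra yU' => exy; apply/bigcupP; exists x0 => //; rewrite inE.
rewrite inE in x0x; apply: connect_trans x0x (connect1 _).
by apply/and3P; split; rewrite // inE in_setT.
Qed.

Hypothesis well : well_linked M L g w.

(** The smaller side is encoded by some [Q] with [M * #|Q| <= #|A| + M * (d * #|X|)]. Adding
    [M * (d * #|X| + 1)] and the hypothesis with constant 3 yields the constant 4 of
    [cut_condition]. *)
Lemma cut_linked (X A B : {set V}) : A :|: B = L :\: X -> [disjoint A & B] ->
  (forall x y, x \in A -> y \in L :\: X -> g x y -> y \in A) ->
  M * (2 * (d * #|X|) + 1) <= 3 * #|A| -> M * (2 * (d * #|X|) + 1) <= 3 * #|B| ->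
  exists a b, [/\ a \in A, b \in B & connect (graph2 X w) a b].
Proof.
move=> ABE dAB.
have wlog_small A' B' : A' :|: B' = L :\: X -> [disjoint A' & B'] -> #|A'| <= #|B'| ->
    (forall x y, x \in A' -> y \in L :\: X -> g x y -> y \in A') ->
    M * (2 * (d * #|X|) + 1) <= 3 * #|A'| ->
    exists a b, [/\ a \in A', b \in B' & connect (graph2 X w) a b].
  move=> E dis AB cl hA.
  have [|||Q QA cQ] := @cut_closure_repr d g L M g_sym _ _ L_large X A' _ cl.
  - by move=> x y /g_G/G_cube.
  - by move=> x y gxy; apply: L_connect; apply: connect1.
  - by rewrite -E subsetUl.
  have BE : L :\: X :\: A' = B'.
    by rewrite -E setDUl setDv finset.set0U; apply/setDidPl; rewrite disjoint_sym.
  have := forallP (forallP well X) Q; rewrite /cut_condition QA BE => /implyP h.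
  have /h /exists_inP[a aA /exists_inP[b bB cab]] :
      (#|A'| <= #|B'|) && (M * (#|Q| + d * #|X| + 1) <= 4 * #|A'|).
    rewrite AB /=; move: cQ hA; move: (d * #|X|) #|Q| #|A'| => k q a.
    have -> : M * (2 * k + 1) = 2 * (M * k) + M by ring.
    have -> : M * (q + k + 1) = M * q + M * k + M by ring.
    by move: (M * k) (M * q); clear; lia.
  by exists a, b.
move=> cl hA hB; have [AB|/ltnW BA] := leqP #|A| #|B|; first exact: wlog_small.
have [|||||b [a [bB aA cba]]] := wlog_small B A.
- by rewrite finset.setUC.
- by rewrite disjoint_sym.
- exact: BA.
- move=> x y xB yLX gxy; have : y \in A :|: B by rewrite ABE.
  case/setUP=> // yA; have xA : x \in A.
    apply: (cl y x yA); last by rewrite g_sym.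
    by rewrite -ABE inE xB orbT.
  by rewrite (disjointFr dAB xA) in xB.
- exact: hB.
exists a, b; split=> //; by rewrite (sym_connect_sym (@graph2_sym _ X w)).
Qed.

Lemma large_connected x y : x \in L -> y \in L -> connect G x y.
Proof.
move=> xL yL; apply: contraT => nxy.
pose A := [set z in L | connect G x z].
have [|||||a [b [aA bB cab]]] := @cut_linked set0 A (L :\: A).
- by rewrite setD0 -[RHS](setID L A) (setIidPr _) //; apply/subsetP => z; rewrite inE => /andP[].
- by rewrite disjoints_subset; apply/subsetP => z zA; rewrite in_setC in_setD zA.
- move=> z t; rewrite inE => /andP[zL cz]; rewrite setD0 => tL gzt.
  by rewrite inE tL; apply: connect_trans cz (connect1 (g_G gzt)).
- rewrite cards0 !muln0 add0n muln1; apply: leq_trans (L_large xL) _.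
  apply: (@leq_trans #|A|); last by rewrite leq_pmull.
  apply/subset_leq_card/subsetP => z; rewrite !inE => cz.
  have := L_connect cz xL; rewrite inE => ->.
  by apply: connect_sub cz => s t /g_G/connect1.
- rewrite cards0 !muln0 add0n muln1; apply: leq_trans (L_large yL) _.
  apply: (@leq_trans #|L :\: A|); last by rewrite leq_pmull.
  apply/subset_leq_card/subsetP => z; rewrite inE => cz.
  rewrite inE (L_connect cz yL) andbT inE (L_connect cz yL) /=.
  apply: contra nxy => cxz; apply: connect_trans cxz _.
  rewrite (sym_connect_sym G_sym); by apply: connect_sub cz => s t /g_G/connect1.
move: aA bB; rewrite !inE => /andP[aL cxa] /andP[nA bL].
rewrite bL /= in nA; case/negP: nA; apply: connect_trans cxa _.
by apply: connect_sub cab => s t /graph2_G/connect1.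
Qed.

Section LargeComponent.
Variable l0 : V.
Hypothesis l0L : l0 \in L.
Let K := [set z | connect G l0 z].

Let K_step x y : x \in K -> G x y -> y \in K.
Proof. by rewrite !inE => cx xy; apply: connect_trans cx (connect1 xy). Qed.

Lemma large_sub_component : L \subset K.
Proof. by apply/subsetP => x xL; rewrite inE large_connected. Qed.

Lemma large_component_sub : K \subset W.
Proof.
apply/subsetP => x; rewrite inE => /connectP[s ps ->].
elim/last_ind: s ps => [|s y _] /=; first by rewrite (subsetP L_sub).
by rewrite rcons_path last_rcons => /andP[_ /and3P[]].
Qed.

Let e := induced G K.

Let connect_e x y : x \in K -> y \in K -> connect e x y.
Proof.
move=> xK yK; have : connect G x y.
  rewrite !inE in xK yK; apply: connect_trans yK.
  by rewrite (sym_connect_sym G_sym).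
move=> /connectP[s ps ->]; elim: s x xK ps {yK} => [|z s IH] x xK /=.
  by rewrite connect0.
move=> /andP[xz ps]; have zK := K_step xK xz.
by apply: connect_trans (connect1 _) (IH z zK ps); rewrite /e /induced /= xK zK.
Qed.

(** Each of the [k] consecutive blocks of [d] vertices on a geodesic is connected, so it meets [L].
    Blocks occupy disjoint ranges of distances from [x], so the vertices found are distinct. *)
Lemma geodesic_large x y t k : x \in K -> y \in K -> t + k * d <= (dist e x y).+1 ->
  k <= #|[set v in L | t <= dist e x v < t + k * d]|.
Proof.
move=> xK yK hk; have [s [ps ss ls lev]] := geodesic (connect_e xK yK).
pose z i := nth x (x :: s) i.
have zlev i : i <= dist e x y -> dist e x (z i) = i by apply: lev.
have zstep i : i < dist e x y -> e (z i) (z i.+1).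
  by move=> iD; have /pathP := ps; apply; rewrite ss.
have zK i : i <= dist e x y -> z i \in K.
  case: i => [|i] iD //; have /and3P[] := zstep i iD; by [].
have [f hf] : exists f : 'I_k -> V, forall j : 'I_k,
    f j \in L /\ t + j * d <= dist e x (f j) < t + j * d + d.
  apply: (@fin_all_exists _ (fun=> V) (fun (j : 'I_k) v =>
    v \in L /\ t + j * d <= dist e x v < t + j * d + d)) => j.
  have hj i : i < d -> t + j * d + i <= dist e x y.
    move=> id; rewrite -ltnS; apply: leq_trans hk; rewrite -addnA ltn_add2l.
    have : j.+1 * d <= k * d by rewrite leq_mul2r ltn_ord orbT.
    by apply: leq_trans; rewrite mulSn addnC ltn_add2r.
  pose U := [set z (t + j * d + i) | i : 'I_d].
  have zinj : injective (fun i : 'I_d => z (t + j * d + i)).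
    move=> i i' /(congr1 (dist e x)); rewrite !zlev ?hj // => /eqP.
    by rewrite eqn_add2l => /eqP/val_inj.
  have cU : #|U| = d by rewrite card_imset // card_ord.
  have UW : U \subset W.
    by apply/subsetP => _ /imsetP[i _ ->]; apply/(subsetP large_component_sub)/zK/hj.
  have vU : z (t + j * d) \in U.
    by apply/imsetP; exists (Ordinal d0); rewrite //= addn0.
  have conU : connected_from (open_adj (edges w)) U (z (t + j * d)).
    apply/forall_inP => _ /imsetP[[i id] _ ->] /=.
    elim: i id => [|i IH] id; first by rewrite addn0 connect0.
    apply: connect_trans (IH (ltnW id)) (connect1 _).
    have iD : t + j * d + i < dist e x y by rewrite -addnS hj.
    apply/and3P; split.
    - by apply/imsetP; exists (Ordinal (ltnW id)).
    - by apply/imsetP; exists (Ordinal id).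
    by have /and3P[_ _ /and3P[_ _]] := zstep _ iD; rewrite addnS.
  have [v /imsetP[i _ ->] vL] := connected_hits_large conU vU UW cU.
  by exists (z (t + j * d + i)); rewrite zlev ?hj // leq_addr ltn_add2l ltn_ord.
have f_inj : injective f.
  move=> j j' fj; apply/val_inj/eqP; rewrite eqn_leq.
  have [_ /andP[h1 h2]] := hf j; have [_ /andP[h3 h4]] := hf j'; rewrite fj in h1 h2.
  have c1 := leq_ltn_trans h1 h4; have c2 := leq_ltn_trans h3 h2.
  rewrite -!addnA !ltn_add2l -![_ * d + d]addnC -!mulSn in c1 c2.
  by rewrite !ltn_pmul2r // !ltnS in c1 c2; rewrite c1 c2.
rewrite -[leqLHS]card_ord -(card_codom f_inj).
apply/subset_leq_card/subsetP => _ /codomP[j ->]; have [fL /andP[h1 h2]] := hf j.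
rewrite inE fL (leq_trans (leq_addr _ _) h1) /=; apply: leq_trans h2 _.
by rewrite -addnA leq_add2l addnC -mulSn leq_mul2r ltn_ord orbT.
Qed.

(** Pigeonhole: the [D] layers at distances [D] to [2 * D - 1] are disjoint. *)
Lemma thin_layer x D : 0 < D ->
  exists2 r, D <= r < D + D & #|[set v | dist e x v == r]| * D <= 2 ^ d.
Proof.
move=> D0; suff [i iD hi] : exists2 i, i < D & #|[set v | dist e x v == D + i]| * D <= 2 ^ d.
  by exists (D + i); rewrite // leq_addr ltn_add2l.
have [/existsP[i hi]|/existsPn no] :=
    boolP [exists i : 'I_D, #|[set v | dist e x v == D + i]| * D <= 2 ^ d].
  by exists i.
have : \sum_(i < D) #|[set v | dist e x v == D + i]| <= 2 ^ d.
  have <- : #|{: V}| = 2 ^ d by rewrite card_ffun card_bool card_ord.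
  under eq_bigr do rewrite -sum1dep_card big_mkcond.
  rewrite exchange_big -sum1_card /=; apply: leq_sum => v _.
  have [/existsP[i /eqP hi]|/existsPn h] := boolP [exists i : 'I_D, dist e x v == D + i].
    rewrite (bigD1 i) //= hi eqxx big1 // => j ji.
    by rewrite eqn_add2l val_eqE eq_sym (negPf ji).
  by rewrite big1 // => i _; rewrite (negPf (h i)).
have : \sum_(i < D) (2 ^ d).+1 <= \sum_(i < D) #|[set v | dist e x v == D + i]| * D.
  by apply: leq_sum => i _; have := no i; rewrite -ltnNge.
rewrite -big_distrl sum_nat_const card_ord mulnC /= leq_pmul2r //.
by move=> h1 h2; have := leq_trans h1 h2; rewrite ltnn.
Qed.

Hypothesis big_cube : M * (8 * (d * d ^ 8)).+1 * (d * (4 * d ^ 8)) <= 2 ^ d.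

(* If the distance were larger, the thin layer [X] would separate two large parts of [L],
   and every second-round path between them avoiding [X] would skip a layer. *)
Lemma giant_dist x y : x \in K -> y \in K -> dist e x y * d ^ 8 <= 2 ^ d.
Proof.
move=> xK yK; rewrite leqNgt; apply/negP => long; set D := dist e x y in long.
have D3 : 0 < D %/ 3.
  rewrite divn_gt0 // ltnNge; apply/negP => D2; move: big_cube long.
  have : 0 < d ^ 8 by rewrite expn_gt0 d0.
  move: (2 ^ d) (d ^ 8) => E P P0 h1 h2.
  have : 2 * P <= M * (8 * (d * P)).+1 * (d * (4 * P)).
    apply: leq_mul; last by rewrite mulnA leq_pmull // muln_gt0 d0.
    apply: (@leq_trans (8 * (d * P)).+1); last by rewrite leq_pmull.
    by rewrite ltnS muln_gt0 muln_gt0 d0 P0.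
  have : D * P <= 2 * P by rewrite leq_mul2r D2 orbT.
  by move=> a b; have := leq_trans h2 (leq_trans a (leq_trans b h1)); rewrite ltnn.
have [r rr thin] := thin_layer x D3.
pose X := [set v | dist e x v == r].
have [numA numB] := layer_numerics d0 M0 big_cube long rr thin.
have /andP[rD rD2] := rr.
have rlt : r <= D by move: rD2; clear; lia.
pose A := [set v in L | dist e x v < r]; pose B := [set v in L | r < dist e x v].
have cA : r %/ d <= #|A|.
  have := @geodesic_large x y 0 (r %/ d) xK yK; rewrite add0n => h.
  apply: leq_trans (h _) _; first by apply: leqW (leq_trans (leq_divM _ _) rlt).
  apply/subset_leq_card/subsetP => v; rewrite !inE => /andP[-> /= hv].
  exact: leq_trans hv (leq_divM _ _).
have cB : (D - r) %/ d <= #|B|.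
  apply: leq_trans (@geodesic_large x y r.+1 ((D - r) %/ d) xK yK _) _.
    rewrite -/D addSn ltnS; apply: (@leq_trans (r + (D - r))); last by rewrite subnKC.
    by rewrite leq_add2l leq_divM.
  by apply/subset_leq_card/subsetP => v; rewrite !inE => /andP[-> /andP[-> _]].
have lev u v : u \in K -> G u v -> dist e x v <= (dist e x u).+1.
  move=> uK uv; apply: dist_step; first exact: connect_e.
  by rewrite /e /induced /= uK (K_step uK uv).
have [|||||a [b [aA bB cab]]] := @cut_linked X A B.
- apply/setP => v; rewrite in_setU in_setD [v \in A]inE [v \in B]inE [v \in X]inE.
  by case: (v \in L); rewrite ?andbF //=; case: ltngtP.
- rewrite disjoints_subset; apply/subsetP => v; rewrite in_setC [v \in A]inE [v \in B]inE.
  by move=> /andP[-> /=]; rewrite -leqNgt => /ltnW.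
- move=> u v; rewrite [u \in A]inE [v \in L :\: X]in_setD [v \in X]inE [v \in A]inE.
  move=> /andP[uL ur] /andP[vX vL] uv; rewrite vL ltn_neqAle vX /=.
  by apply: leq_trans (lev u v (subsetP large_sub_component u uL) (g_G uv)) ur.
- by apply: leq_trans numA _; rewrite leq_mul2l cA orbT.
- by apply: leq_trans numB _; rewrite leq_mul2l cB orbT.
have /connectP[s ps lb] := cab.
have inside u : u \in K -> dist e x u < r -> path (graph2 X w) u s -> dist e x (last u s) < r.
  elim: (s) u => //= v s' IH u uK ur /andP[uv ps'].
  have Guv := graph2_G uv; apply: IH ps'; first exact: K_step Guv.
  have /and3P[_ /setDP[_ vX] _] := uv; rewrite inE in vX.
  by rewrite ltn_neqAle vX; apply: leq_trans (lev u v uK Guv) ur.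
move: aA bB; rewrite [a \in A]inE [b \in B]inE => /andP[aL ar] /andP[_].
rewrite lb ltnNge => /negP[].
exact/ltnW/(inside a (subsetP large_sub_component a aL) ar ps).
Qed.

End LargeComponent.

Lemma component_hits_large x : x \in W -> d <= #|[set y in W | connect G x y]| ->
  exists2 l, l \in L & connect G x l.
Proof.
set U := [set y in W | connect G x y] => xW Ud.
have xU : x \in U by rewrite inE xW connect0.
have UW : U \subset W by apply/subsetP => y; rewrite inE => /andP[].
have conU : connected_from (open_adj (edges w)) U x.
  apply/forall_inP => y; rewrite inE => /andP[_] /connectP[s ps ->].
  elim/last_ind: s ps => [|s z IH]; first by rewrite connect0.
  rewrite rcons_path last_rcons => /andP[ps Gz]; apply: connect_trans (IH ps) (connect1 _).
  have cl : connect G x (last x s) by apply/connectP; exists s.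
  have cz : connect G x z by apply: connect_trans cl (connect1 Gz).
  have /and3P[lW zW Fz] := Gz.
  by apply/and3P; split; rewrite // inE ?cl ?cz ?lW ?zW.
have dU : 0 < d <= #|U| by rewrite d0.
have [U' cU' [U'U xU' dU']] := connected_subset (@open_adj_sym d (edges w)) conU xU dU.
have [l lU' lL] := connected_hits_large cU' xU' (subset_trans U'U UW) dU'.
by exists l => //; have := subsetP U'U l lU'; rewrite inE => /andP[].
Qed.

Hypothesis big_cube : M * (8 * (d * d ^ 8)).+1 * (d * (4 * d ^ 8)) <= 2 ^ d.

(** A component with at least [d] vertices contains a connected set of exactly [d], hence meets [L]
    and is [K]. This allows [C = 1]; the constant [y = 1 / n0] is the density of [L]. *)
Lemma giant_eventP (R : realType) :
  edges w \subset cube_edges d -> 2 ^ d <= n0 * #|L| -> n0 * d < 2 ^ d ->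
  giant_event (n0%:R^-1 : R) 1 W (edges w).
Proof.
move=> w_cube bigL n0d; rewrite /giant_event.
have -> : mixed_adj W (edges w) = G.
  apply/funext => x; apply/funext => y; rewrite /G /mixed_adj /induced /open_adj /=.
  case e : ([set x; y] \in edges w); last by rewrite !andbF.
  by have := subsetP w_cube _ e; rewrite cube_edgesP => ->.
have n00 : 0 < n0 by case: (n0) bigL; rewrite // mul0n leqNgt expn_gt0.
have /card_gt0P[l0 l0L] : 0 < #|L|.
  by rewrite lt0n; apply: contraTneq bigL => ->; rewrite muln0 leqNgt expn_gt0.
have csym : connect_sym G by exact: sym_connect_sym G_sym.
pose K := [set z | connect G l0 z].
have Ksub : K \subset W by apply: (large_component_sub l0L).
have comp x : x \in L -> [set y in W | connect G x y] = K.
  move=> xL; have cx := large_connected l0L xL.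
  apply/setP => y; rewrite inE; apply/andP/idP => [[_ cy]|yK].
    by rewrite inE (connect_trans cx cy).
  split; first exact: (subsetP Ksub).
  by rewrite inE (same_connect csym cx) in yK.
have large_comp U : U \in components G W -> d <= #|U| -> U = K.
  move=> /imsetP[x xW ->] dU; have [l lL cxl] := component_hits_large xW dU.
  rewrite -(comp l lL); by apply/setP => y; rewrite !inE (same_connect csym cxl).
have LK : L \subset K := large_sub_component l0L.
have n0R : (0 < n0%:R :> R)%R by rewrite ltr0n.
have threshold (n : nat) : (n0%:R^-1 * 2 ^+ d <= n%:R :> R)%R = (2 ^ d <= n0 * n).
  by rewrite mulrC ler_pdivrMr // -natrX -natrM ler_nat mulnC.
apply/existsP; exists K; apply/and3P; split.
(* By [n0d] the threshold [2 ^ d / n0] exceeds [d], so every component reaching it is [K]. *)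
- apply/eqP/setP => U; rewrite !inE threshold; apply/andP/eqP => [[UC Ularge]|->].
    apply: large_comp UC _; rewrite -(leq_pmul2l n00).
    exact: leq_trans (ltnW n0d) Ularge.
  split; last by apply: leq_trans bigL _; rewrite leq_mul2l subset_leq_card ?orbT.
  by apply/imsetP; exists l0; rewrite ?(subsetP L_sub) ?comp.
- apply/forall_inP => U UC; apply/implyP => UK; rewrite mul1r ler_nat ltnW // ltnNge.
  by apply: contra UK => dU; rewrite (large_comp U UC dU).
have d8 : 0 < d ^ 8 by rewrite expn_gt0 d0.
rewrite -!natrX ler_pdivlMr ?ltr0n // -natrM ler_nat -leq_divRL //.
apply/bigmax_leqP => x xK; apply/bigmax_leqP => y yK.
by rewrite leq_divRL //; apply: (giant_dist l0L).
Qed.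

End GiantComponent.

(** * Assembling the bounds *)

Lemma prob_off_edges (R : realType) (d : nat) (pr : bool * (vertex d + {set vertex d}) -> R) :
  proba_family pr -> (forall r e, e \notin cube_edges d -> pr (r, inr e) = 0) ->
  prob pr (fun w => ~~ (edges w \subset cube_edges d)) <= 0.
Proof.
move=> pr_ok pr0.
apply: (@le_trans _ _ (prob pr (fun w => [exists e, (e \notin cube_edges d) &&
    (inr e \in rounds w)]))).
  apply: (prob_le pr_ok) => w /subsetPn[e ew ec]; apply/existsP; exists e.
  by rewrite ec; rewrite !inE in ew *.
apply: le_trans (prob_union _ _ pr_ok) _.
by rewrite big1 // => e ec; rewrite prob_rounds !pr0 // subr0 mulr1 subrr.
Qed.

Lemma depends_on_edges1 d :
  depends_on (@edges1 d) [set j : bool * (vertex d + {set vertex d}) | j.1].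
Proof. by move=> w w' e; apply/setP => x; rewrite !inE e ?inE. Qed.

Lemma depends_on_verts1 d :
  depends_on (@verts1 d) [set j : bool * (vertex d + {set vertex d}) | j.1].
Proof. by move=> w w' e; apply/setP => x; rewrite !inE e ?inE. Qed.

Section Assembly.
Variables (R : realType) (d : nat).
Local Notation V := (vertex d).
Local Notation item := (V + {set V})%type.
Local Notation sample := {set bool * item}.

Variables (q c beta : R) (kappa k M n0 : nat).
Let s : R := d%:R^-1.
Let p : R := c / d%:R.
(** First-round probabilities are tuned so that, together with sprinkling at rate [s], the union has
    exactly the parameters [q] and [c / d]. *)
Let q1 : R := 1 - (1 - q) / (1 - s).
Let p1 : R := 1 - (1 - p) / (1 - s).
Let pr := @round_proba R d q1 s p1 s.
Let h := (d %/ 4)%N.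

Hypotheses (q_01 : 0 < q <= 1) (c1 : 1 <= c) (d0 : (0 < d)%N) (c_d : c <= d%:R)
  (s_q : s <= q / 2) (c_kappa : c <= kappa%:R).

Let sq_half : 0 < 1 - s.
Proof. by have := s_q; have /andP[_ q_1] := q_01; move=> *; lra. Qed.

Let s0 : 0 <= s. Proof. by rewrite invr_ge0. Qed.

Let s_01 : 0 <= s <= 1. Proof. by rewrite s0 -subr_ge0 ltW. Qed.

Let s_d : s * d%:R = 1.
Proof. by rewrite mulVf // pnatr_eq0 -lt0n. Qed.

Lemma q1E : 1 - q = (1 - q1) * (1 - s).
Proof. by rewrite /q1 opprB addrCA subrr addr0 divfK // gt_eqF. Qed.

Lemma p1E : 1 - p = (1 - p1) * (1 - s).
Proof. by rewrite /p1 opprB addrCA subrr addr0 divfK // gt_eqF. Qed.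

Lemma q1_ge : q / 2 <= q1.
Proof.
have [q_0 q_1] := andP q_01; rewrite /q1 lerBrDl -lerBrDr ler_pdivrMr //.
have : 0 <= q / 2 * s by rewrite mulr_ge0 // divr_ge0 // ltW.
have := s_q; nra.
Qed.

Lemma q1_01 : 0 <= q1 <= 1.
Proof.
have [q_0 q_1] := andP q_01; apply/andP; split; first by apply: le_trans q1_ge; lra.
by rewrite /q1 gerBl divr_ge0 ?subr_ge0 //; case/andP: s_01.
Qed.

Let s_p : s <= p.
Proof. by rewrite /p /s -[leLHS]mul1r; apply: ler_wpM2r. Qed.

Let p_1 : p <= 1.
Proof. by rewrite /p ler_pdivrMr ?ltr0n // mul1r. Qed.

Lemma p1_01 : 0 <= p1 <= 1.
Proof.
apply/andP; split; first by rewrite /p1 subr_ge0 ler_pdivrMr // mul1r lerD2l lerN2.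
by rewrite /p1 gerBl divr_ge0 ?subr_ge0 //; case/andP: s_01.
Qed.

Lemma p1_le : p1 <= p.
Proof.
have /andP[p10 p11] := p1_01; have := p1E.
have : 0 <= (1 - p1) * s by rewrite mulr_ge0 // subr_ge0.
by move: p p1 s => a b e; lra.
Qed.

Lemma p1_ge : p - s <= p1.
Proof.
have /andP[p10 p11] := p1_01; have := p1E.
have : 0 <= p1 * s by rewrite mulr_ge0.
by move: p p1 s => a b e; lra.
Qed.

Let pE : 1 - (1 - p1) * (1 - s) = p.
Proof. by rewrite -p1E opprB addrCA subrr addr0. Qed.

Let dp : d%:R * p = c.
Proof. by rewrite /p mulrCA divff ?mulr1 // pnatr_eq0 -lt0n. Qed.

Let pr_ok : proba_family pr := round_proba_family q1_01 s_01 p1_01 s_01.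

Hypotheses (beta01 : 0 <= beta <= 1) (s_beta : s <= beta ^+ 8)
  (qc_beta : expR (- (q * (c - 1) / 16)) <= beta)
  (c_beta : (1 + c) ^+ 2 * (2 * beta) <= q / 16)
  (k_d : (16 * (k * kappa.+2) <= d)%N) (M_k : (d * M * kappa.+1 <= 2 ^ k)%N)
  (M0 : (0 < M)%N).

Let q16 : 0 <= q / 16 <= 1 / 2.
Proof. by have := q_01; lra. Qed.

Lemma isolated_cluster_le (Z : {set V}) v u :
  {in Z, forall x, (d <= 2 * degree_in Z x)%N} -> (0 < u <= d * M)%N ->
  prob pr (isolated_cluster Z v u) <= (q / 16) ^+ u.
Proof.
move=> degZ /andP[u0 uM].
have [b0 b1] := andP beta01; have [q10 q11] := andP q1_01; have [p10 p11] := andP p1_01.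
have kap0 : (0 < kappa)%N.
  by rewrite -(ltr0n R); apply: lt_le_trans c_kappa; apply: lt_le_trans c1.
have pk : p1 * d%:R <= kappa%:R.
  apply: le_trans c_kappa; rewrite -dp mulrC; apply: ler_wpM2l => //; exact: p1_le.
(* The bounds [q1 >= q / 2] and [p1 * d >= p * d - s * d = c - 1] turn this exponent into the one in
   [qc_beta]. *)
have qp : expR (- (q1 * p1 * d%:R / 8)) <= beta.
  apply: le_trans qc_beta; rewrite ler_expR lerN2.
  have : c - 1 <= p1 * d%:R.
    have -> : c - 1 = (p - s) * d%:R by rewrite mulrBl s_d [p * _]mulrC dp.
    by apply: ler_wpM2r => //; exact: p1_ge.
  move=> hc; have : q / 2 * (c - 1) <= q1 * (p1 * d%:R).
    apply: ler_pM => //; first by have := q_01; move=> /andP[? _]; rewrite divr_ge0 // ltW.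
      by rewrite subr_ge0.
    exact: q1_ge.
  rewrite mulrA; move: (q1 * p1 * d%:R) => x; lra.
have uk : (u * kappa.+1 <= 2 ^ k)%N by apply: leq_trans M_k; rewrite leq_mul2r uM orbT.
apply: le_trans (prob_isolated_cluster q1_01 s_01 p1_01 s_01 beta01 s_beta qp pk kap0 d0 k_d
  v degZ u0 uk) _.
rewrite pE dp; apply: lerXn2r => //; rewrite nnegrE; first by rewrite mulr_ge0 ?sqr_ge0 ?mulr_ge0.
by case/andP: q16.
Qed.

(** The sizes from [d] on contribute at most [2 * (q / 16) ^+ d] per root, which absorbs the number
    [2 ^ d] of roots. *)
Lemma prob_gap_le :
  prob pr (fun w => [exists v, [exists u : 'I_(d * M).+1, (d <= u)%N &&
     isolated_cluster [set: V] v u w]]) <= 2 * (1 / 2) ^+ d.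
Proof.
have [q16_0 q16_h] := andP q16.
have term v : prob pr (fun w => [exists u : 'I_(d * M).+1, (d <= u)%N &&
     isolated_cluster [set: V] v u w]) <= 2 * (q / 16) ^+ d.
  apply: le_trans (prob_union _ _ pr_ok) _.
  apply: (@le_trans _ _ (\sum_(u < (d * M).+1 | (d <= u)%N) (q / 16) ^+ u)).
    apply: ler_sum => u du; apply: isolated_cluster_le.
      move=> x _; apply: (@leq_trans (1 * d)); first by rewrite mul1n.
      apply: leq_mul => //; rewrite -[leqLHS]card_ord /degree_in -cardsT.
      by apply/subset_leq_card/subsetP => i; rewrite !inE.
    by rewrite (leq_trans d0 du) -ltnS ltn_ord.
  apply: le_trans (geometric_sum_le q16 (d * M).+1 d q16_0).
  rewrite -(big_mkord (fun u => d <= u)%N (fun u => (q / 16) ^+ u)).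
  have dM : (d <= (d * M).+1)%N by rewrite leqW // leq_pmulr.
  rewrite (big_cat_nat (leq0n d) dM) //= big_nat_cond big1 ?add0r; last first.
    by move=> i /andP[/andP[_ id]]; rewrite leqNgt id.
  rewrite big_mkcond -{1}[d]add0n big_addn.
  apply: (@le_trans _ _ (\sum_(i < (d * M).+1 - d) (q / 16) ^+ (d + i))).
    by rewrite big_mkord; apply: ler_sum => i _; rewrite leq_addl addnC.
  have sub : ((d * M).+1 - d <= (d * M).+1)%N by rewrite leq_subr.
  rewrite (big_ord_widen _ (fun i => (q / 16) ^+ (d + i)) sub).
  rewrite [leRHS](bigID (fun i : 'I__ => (i < (d * M).+1 - d)%N)) /= lerDl.
  by apply: sumr_ge0 => i _; rewrite exprn_ge0.
apply: le_trans (prob_union predT _ pr_ok) _.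
apply: (@le_trans _ _ (\sum_(v : V) 2 * (q / 16) ^+ d)); first by apply: ler_sum => v _.
rewrite sumr_const card_ffun card_bool card_ord -[leLHS]mulr_natl natrX mulrCA -exprMn.
apply: ler_wpM2l => //; apply: lerXn2r; rewrite ?nnegrE ?mulr_ge0 //; have /andP[_ ?] := q_01; lra.
Qed.

Hypotheses (n0_q : 16 <= n0%:R * q)
  (h_d : 2 ^+ d * (1 - q / 16) ^+ (h * h) <= (1 / 2) ^+ d :> R).
Let t := (h * h %/ n0)%N.

Let n00 : (0 < n0)%N.
Proof. by case: (n0) n0_q => //; rewrite mul0r lern0. Qed.

(** Since [n0 * q >= 16], [(1 + q / 16) ^+ n0 >= 2], hence [2 ^+ t <= (1 + q / 16) ^+ (h * h)]. A
    trial contributes at most [1 - q / 8], and [(1 + q / 16) * (1 - q / 8) <= 1 - q / 16]. *)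
Lemma prob_sparse_le : prob pr (fun w => ~~ dense M t w) <= (1 / 2) ^+ d.
Proof.
have [q_0 q_1] := andP q_01.
apply: le_trans (@prob_not_dense _ _ _ _ _ _ q1_01 s_01 p1_01 s_01 _ M q16 t _) _.
  move=> Z v u degZ /andP[u0 uM]; apply: isolated_cluster_le => //.
  by rewrite u0 (leq_trans (ltnW uM)) // leq_pmull.
apply: le_trans h_d; apply: ler_wpM2l; first by rewrite exprn_ge0.
have two : 2 <= (1 + q / 16) ^+ n0.
  have : 1 + (q / 16) *+ n0 <= (1 + q / 16) ^+ n0.
    elim: (n0) => [|n IH]; first by rewrite expr0 mulr0n addr0.
    rewrite exprS mulrS; apply: (@le_trans _ _ ((1 + q / 16) * (1 + (q / 16) *+ n))).
      have : 0 <= q / 16 * (q / 16 *+ n) by rewrite mulr_ge0 ?mulrn_wge0 //; lra.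
      by move: (q / 16 *+ n) => y; lra.
    by apply: ler_wpM2l => //; lra.
  apply: le_trans; rewrite -[_ *+ n0]mulr_natl; move: n0_q; move: (n0%:R : R) => y; lra.
have two_t : 2 ^+ t <= (1 + q / 16) ^+ (h * h).
  apply: (@le_trans _ _ (((1 + q / 16) ^+ n0) ^+ t)).
    by apply: lerXn2r; rewrite ?nnegrE // exprn_ge0 //; lra.
  rewrite -exprM; apply: ler_weXn2l; first by lra.
  by rewrite mulnC leq_divM.
have q1q := q1_ge.
apply: (@le_trans _ _ ((1 + q / 16) ^+ (h * h) * (1 - q / 8) ^+ (h * h))).
  apply: ler_pM two_t _; first by rewrite exprn_ge0.
    by rewrite exprn_ge0 //; have /andP[_ ?] := q1_01; lra.
  by apply: lerXn2r; rewrite ?nnegrE; have /andP[_ ?] := q1_01; lra.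
rewrite -exprMn; apply: lerXn2r; rewrite ?nnegrE; nra.
Qed.

Hypothesis M_big : (12 * n0 * d.+1 ^ 7 * (2 * d ^ 15).+1 <= M)%N.

Lemma dense_large (w : sample) : dense M t w -> (2 ^ d <= n0 * #|large_vertices M w|)%N.
Proof.
move=> dw; have := card_large_vertices dw; rewrite -/h => hL.
rewrite -(@leq_pmul2r t.+1) //; apply: leq_trans hL _.
rewrite [leqRHS]mulnAC leq_mul2r; apply/orP; right.
by rewrite [leqRHS]mulnC ltnW // ltn_ceil.
Qed.

Lemma dense_near (w : sample) v : dense M t w ->
  [exists x in large_vertices M w, (hamming v x <= 2)%N].
Proof.
move=> /forallP/(_ v)/(leq_ltn_trans (leq0n _))/card_gt0P[ij ijg].
apply/exists_inP; exists (quarter v ij); first exact: good_quarters_large ijg.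
apply: leq_trans (hamming_triangle (flip v (low_ord ij.1)) _ _) _.
by rewrite !hamming1.
Qed.

(** Conditioning on the first round by [expect_splice] freezes [L], its graph and the density event,
    while [well_linked] for fixed [L] and graph reads only the second round. The cut estimate then
    applies with a deterministic [L]. *)
Lemma prob_unlinked_le :
  prob pr (fun w => dense M t w &&
    ~~ well_linked M (large_vertices M w) (graph1 [set: V] w) w) <= 4 * (1 / 4) ^+ d.
Proof.
pose A : sample := [set j | j.1].
rewrite /prob (expect_splice pr A) -[leRHS](expect_cst pr).
apply: (ler_expect pr_ok) => w.
have spliceE w' : {in A, forall j, (j \in splice A w w') = (j \in w)}.
  by move=> j jA; rewrite inE jA.
have eg w' : graph1 [set: V] (splice A w w') = graph1 [set: V] w.
  by rewrite /graph1 (depends_on_edges1 (spliceE w')) (depends_on_verts1 (spliceE w')).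
have eL w' Z : large_in Z M^~ (splice A w w') =1 large_in Z M^~ w.
  move=> v; apply: large_in_depends => j; rewrite inE => /andP[/eqP jt _].
  by rewrite spliceE // inE jt.
have eLV w' : large_vertices M (splice A w w') = large_vertices M w.
  by apply/setP => v; rewrite !inE; apply: eL.
have ed w' : dense M t (splice A w w') = dense M t w.
  apply: eq_forallb => v; congr (_ < _)%N; apply: eq_card => ij.
  by rewrite !inE; apply: eL.
have ewl w' : well_linked M (large_vertices M w) (graph1 [set: V] w) (splice A w w') =
    well_linked M (large_vertices M w) (graph1 [set: V] w) w'.
  by apply: well_linked_depends => j; rewrite !inE => /negPf ->.
under eq_expect do rewrite ed eLV eg ewl.
have [dw|_] := boolP (dense M t w); last first.
  by rewrite /= expect_cst mulr_ge0 // exprn_ge0 //; lra.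
apply: (@prob_not_well_linked _ _ _ _ q1_01 p1_01 d0 n0 M) => //.
  by move=> v; apply: dense_near.
exact: dense_large.
Qed.

Hypotheses (cube_big : (M * (8 * (d * d ^ 8)).+1 * (d * (4 * d ^ 8)) <= 2 ^ d)%N)
  (n0d : (n0 * d < 2 ^ d)%N).

Lemma mixed_prob_giant_ge :
  1 - 7 * (1 / 2) ^+ d <= mixed_prob p q (@giant_event R d n0%:R^-1 1).
Proof.
rewrite (@mixed_prob_rounds R d p q pr) => [|v|e ec|r e ec]; last first.
- by rewrite /pr /round_proba /= (negPf ec).
- by rewrite /pr /round_proba /= ec p1E.
- by rewrite /pr /round_proba /= q1E.
set E := (fun w : sample => _ && _).
pose gap (w : sample) := [exists v, [exists u : 'I_(d * M).+1, (d <= u)%N &&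
     isolated_cluster [set: V] v u w]].
pose off (w : sample) := ~~ (edges w \subset cube_edges d).
pose unl (w : sample) := dense M t w &&
    ~~ well_linked M (large_vertices M w) (graph1 [set: V] w) w.
have cover w : ~~ E w -> off w || (gap w || (~~ dense M t w || unl w)).
  apply: contraR; rewrite !negb_or => /and4P[/negPn w_cube ng /negPn dw nu].
  rewrite /unl dw /= negbK in nu.
  have no_gap v u : (d <= u <= d * M)%N -> ~~ isolated_cluster [set: V] v u w.
    move=> /andP[du uM]; apply/negP => iso; case/negP: ng; rewrite /gap.
    apply/existsP; exists v.
    by apply/existsP; exists (Ordinal (uM : (u < (d * M).+1)%N)); rewrite /= du.
  rewrite /E -/(edges w) w_cube /=.
  exact: (@giant_eventP d w M n0 d0 M0 no_gap nu cube_big R w_cube (dense_large dw) n0d).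
(* The constant 7 is 2 + 1 + 4, for a size gap, sparsity and a missing link; edges off the cube have
   probability 0. *)
have : prob pr (fun w => ~~ E w) <= 0 + (2 * (1 / 2) ^+ d + ((1 / 2) ^+ d + 4 * (1 / 4) ^+ d)).
  apply: le_trans (prob_le pr_ok cover) _; apply: le_trans (prob_or _ _ pr_ok) _.
  apply: lerD; first by apply: prob_off_edges => // r e ec; rewrite /pr /round_proba /= (negPf ec).
  apply: le_trans (prob_or _ _ pr_ok) _; apply: lerD; first exact: prob_gap_le.
  apply: le_trans (prob_or _ _ pr_ok) _; apply: lerD; first exact: prob_sparse_le.
  exact: prob_unlinked_le.
have : (1 / 4) ^+ d <= (1 / 2) ^+ d :> R by apply: lerXn2r; rewrite ?nnegrE; lra.
rewrite prob_not; move: ((1 / 4) ^+ d : R) ((1 / 2) ^+ d : R) (prob pr E) => x y z; lra.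
Qed.

End Assembly.

(** * Elementary estimates and the choice of the constants *)

Lemma polynomial_le_exp2 (a b m : nat) : (0 < m)%N ->
  exists D, forall d, (D <= d)%N -> (b * d ^ a <= 2 ^ (d %/ m))%N.
Proof.
move=> m0; pose C := ((a.+1 * m * 2) ^ a.+1)%N.
exists (maxn m (b * C)) => d; rewrite geq_max => /andP[md bd].
set n := (d %/ m)%N; have n1 : (0 < n)%N by rewrite divn_gt0.
pose j := (n %/ a.+1)%N.
have dn : (d <= 2 * m * n)%N.
  have := ltn_ceil d m0; rewrite -/n mulSn => h; apply: leq_trans (ltnW h) _.
  by rewrite [(n * m)%N]mulnC -mulnA mul2n -addnn leq_add2r leq_pmulr.
have nj : (n <= a.+1 * j.+1)%N by rewrite mulnC ltnW // ltn_ceil.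
have dj : (d <= a.+1 * m * 2 * 2 ^ j)%N.
  apply: leq_trans dn _; apply: (@leq_trans (2 * m * (a.+1 * j.+1))%N).
    by rewrite leq_mul2l nj orbT.
  have -> : (2 * m * (a.+1 * j.+1) = a.+1 * m * 2 * j.+1)%N by ring.
  by rewrite leq_mul2l ltn_expl ?orbT.
(* One power of [d] more than needed: the extra factor absorbs [b * C]. *)
have dC : (d ^ a.+1 <= C * 2 ^ n)%N.
  apply: (@leq_trans ((a.+1 * m * 2 * 2 ^ j) ^ a.+1)%N); first by rewrite leq_exp2r.
  rewrite expnMn -expnM leq_mul2l; apply/orP; right.
  by rewrite leq_pexp2l // leq_divM.
have C0 : (0 < C)%N by rewrite expn_gt0 !muln_gt0 m0.
rewrite -(leq_pmul2l C0); apply: leq_trans dC; rewrite expnS mulnA leq_mul2r.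
by rewrite mulnC bd orbT.
Qed.

(** With [y = c - 1] and [x = q * y / 48], the exponential is at least [x ^+ 3]. The summand 3 gives
    [y >= 2], hence [1 + c <= 2 * y]. What remains is [8 * y ^+ 2 <= q / 16 * x ^+ 3], that is
    [y >= 128 * 48 ^+ 3 / q ^+ 4]. *)
Lemma large_c_bound (R : realType) (q c : R) :
  0 < q <= 1 -> 3 + 128 * 48 ^+ 3 / q ^+ 4 <= c ->
  (1 + c) ^+ 2 * (2 * expR (- (q * (c - 1) / 16))) <= q / 16.
Proof.
case/andP=> q0 q1 hc; set y := c - 1; pose x := q * y / 48.
have q4 : 0 < q ^+ 4 by rewrite exprn_gt0.
have C0 : 0 <= 128 * 48 ^+ 3 / q ^+ 4 by rewrite divr_ge0 ?mulr_ge0 ?exprn_ge0 // ltW.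
have y2 : 2 <= y by rewrite /y; move: hc C0; move: (128 * 48 ^+ 3 / q ^+ 4) => t; lra.
have qy : 128 * 48 ^+ 3 <= q ^+ 4 * y.
  rewrite [q ^+ 4 * y]mulrC -ler_pdivrMr // /y.
  by move: hc; move: (128 * 48 ^+ 3 / q ^+ 4) => t; lra.
have x0 : 0 <= x by rewrite /x divr_ge0 // mulr_ge0 ?ltW //; lra.
have E : x ^+ 3 <= expR (q * y / 16).
  have -> : q * y / 16 = 3%:R * x by rewrite /x; field.
  rewrite expRM_natl; apply: lerXn2r; rewrite ?nnegrE ?expR_ge0 //.
  by have := expR_ge1Dx x; lra.
rewrite expRN mulrA ler_pdivrMr ?expR_gt0 //.
apply: (@le_trans _ _ (8 * y ^+ 2)).
  have : (1 + c) ^+ 2 <= (2 * y) ^+ 2.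
    by apply: lerXn2r; rewrite ?nnegrE /y; move: y2; rewrite /y; lra.
  by rewrite exprMn; move: ((1 + c) ^+ 2) (y ^+ 2) => a b; lra.
apply: (@le_trans _ _ (q / 16 * x ^+ 3)); last by rewrite ler_pM2l // divr_gt0.
have -> : q / 16 * x ^+ 3 = (q ^+ 4 * y) / (16 * 48 ^+ 3) * y ^+ 2 by rewrite /x; field.
apply: ler_wpM2r; first by rewrite sqr_ge0.
rewrite ler_pdivlMr ?mulr_gt0 ?exprn_gt0 //.
by apply: le_trans qy; rewrite mulrA -natrM.
Qed.

(** The power decays faster than any exponential in [d]: for large [h],
    [(1 - q / 16) ^+ h <= 4 ^ -8], and [8 * h >= d] turns its [h]-th power into [4 ^ -d]. *)
Lemma sparse_numerics (R : realType) (q : R) : 0 < q <= 1 ->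
  exists D, forall d, (D <= d)%N ->
    2 ^+ d * (1 - q / 16) ^+ (d %/ 4 * (d %/ 4)) <= (1 / 2) ^+ d :> R.
Proof.
case/andP=> q0 q1; pose a := Num.bound (16 * 4 ^+ 8 / q).
have ha : 4 ^+ 8 <= q / 16 * a%:R.
  have : 16 * 4 ^+ 8 / q <= a%:R.
    by apply/ltW/archi_boundP; rewrite divr_ge0 ?mulr_ge0 ?exprn_ge0 // ltW.
  rewrite ler_pdivrMr // => h.
  by rewrite mulrAC ler_pdivlMr // mulrC [q * _]mulrC.
set z := 1 - q / 16; have z0 : 0 <= z by rewrite /z; lra.
have z1 : z <= 1 by rewrite /z; lra.
have za : z ^+ a <= (1 / 4) ^+ 8.
  apply: (@le_trans _ _ (expR (- (q / 16)) ^+ a)).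
    by apply: lerXn2r; rewrite ?nnegrE ?expR_ge0 //; apply: expR_ge1Dx.
  rewrite -expRM_natl mulrN expRN exprMn expr1n mul1r exprVn lef_pV2 ?posrE ?expR_gt0 ?exprn_gt0 //.
  apply: le_trans (expR_ge1Dx _); rewrite [a%:R * _]mulrC; apply: le_trans ha _.
  by rewrite lerDr.
exists (4 * a + 8)%N => d hd; set h := (d %/ 4)%N.
have ah : (a <= h)%N by rewrite /h leq_divRL //; move: hd; clear; lia.
have d8 : (d <= 8 * h)%N by rewrite /h; move: hd; clear; lia.
have zh : z ^+ (h * h) <= (1 / 4) ^+ d.
  rewrite exprM; apply: (@le_trans _ _ (((1 / 4) ^+ 8) ^+ h)).
    apply: lerXn2r; rewrite ?nnegrE ?exprn_ge0 //.
    by apply: le_trans za; apply: ler_wiXn2l.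
  by rewrite -exprM; apply: ler_wiXn2l => //; lra.
apply: le_trans (ler_wpM2l _ zh) _; first by rewrite exprn_ge0.
by rewrite -exprMn; apply: lerXn2r; rewrite ?nnegrE; lra.
Qed.

Lemma mixed_prob_giant_eventually (R : realType) (q c : R) :
  0 < q <= 1 -> 3 + 128 * 48 ^+ 3 / q ^+ 4 <= c ->
  exists n0 D, (0 < n0)%N /\ forall d, (D <= d)%N ->
    1 - 7 * (1 / 2) ^+ d <= mixed_prob (c / d%:R) q (@giant_event R d n0%:R^-1 1) <= 1.
Proof.
move=> q01 hc; have [q0 q1] := andP q01.
have c3 : 3 <= c by apply: le_trans hc; rewrite lerDl divr_ge0 ?mulr_ge0 ?exprn_ge0 // ltW.
pose beta := expR (- (q * (c - 1) / 16)).
have beta_gt0 : 0 < beta by apply: expR_gt0.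
have beta01 : 0 <= beta <= 1.
  by rewrite ltW //= expR_le1 oppr_le0 divr_ge0 // mulr_ge0 ?ltW //; lra.
pose kappa := Num.bound c; pose n0 := Num.bound (16 / q).
have c_kappa : c <= kappa%:R by apply/ltW/archi_boundP; lra.
have n0_q : 16 <= n0%:R * q.
  by rewrite -ler_pdivrMr //; apply/ltW/archi_boundP; rewrite divr_ge0 // ltW.
have n00 : (0 < n0)%N by case: (n0) n0_q => //; rewrite mul0r lern0.
(* With [r = d %/ m] and [k = 2 * r + kappa], the term [32 * r * kappa.+2] of [16 * (k * kappa.+2)]
   is at most [d / 2]; the rest is bounded because [d] is large. *)
pose m := (64 * kappa.+2)%N.
(* These constants come from the lower bound on [M]: 22 is 7 + 15, and 4608 is 12 * 2 ^ 7 * 3 after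
   bounding [d.+1] by [2 * d] and [(2 * d ^ 15).+1] by [3 * d ^ 15]. *)
have [D1 hD1] := @polynomial_le_exp2 22 (4608 * n0) m isT.
have [D2 hD2] := sparse_numerics q01.
(* Makes the sprinkling rate [1 / d] at most [q / 2] and at most [beta ^+ 8]. *)
pose D3 := maxn (Num.bound (2 / q)) (Num.bound (beta ^- 8)).
exists n0, (maxn (maxn D1 D2) (maxn D3 (32 * (kappa * kappa.+2) + kappa + 1)%N)).
split=> // d; rewrite !geq_max => /andP[/andP[dD1 dD2] /andP[/andP[dq db] dk]].
have d0 : (0 < d)%N by apply: leq_trans dk; rewrite addn1.
have dR : 0 < d%:R :> R by rewrite ltr0n.
have exp_big := hD1 d dD1; set r := (d %/ m)%N in exp_big.
have dpow i : (i <= 22)%N -> (d ^ i <= d ^ 22)%N by move=> hi; rewrite leq_pexp2l.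
have n0D i b : (i <= 22)%N -> (b <= 4608)%N -> (b * n0 * d ^ i <= 2 ^ r)%N.
  by move=> hi hb; apply: leq_trans exp_big; rewrite leq_mul ?dpow // leq_mul2r hb orbT.
have bD i b : (i <= 22)%N -> (b <= 4608)%N -> (b * d ^ i <= 2 ^ r)%N.
  move=> hi hb; apply: leq_trans (n0D i b hi hb).
  by rewrite leq_mul2r; apply/orP; right; rewrite leq_pmulr.
have rd : (m * r <= d)%N by rewrite mulnC leq_divM.
have r2d : (r + r <= d)%N.
  apply: leq_trans rd; rewrite addnn -mul2n leq_mul2r; apply/orP; right.
  by rewrite /m -[X in (X <= _)%N]/(2 * 1)%N leq_mul.
have c_d : c <= d%:R.
  apply: le_trans c_kappa _; rewrite ler_nat; apply: leq_trans dk.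
  by rewrite -addnA addnCA leq_addr.
apply/andP; split; last first.
  apply: mixed_prob_le1; last by rewrite ltW.
  by rewrite ler_pdivrMr // mul1r c_d andbT divr_ge0 // (le_trans _ c3).
(* [M = 2 ^ r]; the exponent [2 * r + kappa] leaves [2 ^ r] for the factor [d] and [2 ^ kappa] for
   [kappa.+1] in [M_k]. *)
apply: (@mixed_prob_giant_ge R d q c beta kappa (2 * r + kappa) (2 ^ r) n0) => //.
- by apply: le_trans c3; rewrite ler1n.
- rewrite -[leRHS]invrK lef_pV2 ?posrE ?invr_gt0 ?divr_gt0 // invf_div.
  apply: (@le_trans _ _ (Num.bound (2 / q))%:R); last by rewrite ler_nat.
  by apply/ltW/archi_boundP; rewrite divr_ge0 // ltW.
- rewrite -[leRHS]invrK lef_pV2 ?posrE ?invr_gt0 ?exprn_gt0 //.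
  apply: (@le_trans _ _ (Num.bound (beta ^- 8))%:R); last by rewrite ler_nat.
  by apply/ltW/archi_boundP; rewrite invr_ge0 exprn_ge0 // ltW.
- exact: large_c_bound.
- have -> : (16 * ((2 * r + kappa) * kappa.+2) =
      32 * (r * kappa.+2) + 16 * (kappa * kappa.+2))%N by ring.
  have e : (m * r = 64 * (r * kappa.+2))%N by rewrite /m; ring.
  rewrite e in rd; move: rd dk; move: (r * kappa.+2)%N (kappa * kappa.+2)%N => a b.
  by clear; lia.
- rewrite expnD mul2n -addnn expnD; apply: leq_mul; last exact: ltn_expl.
  by rewrite leq_mul2r (leq_trans _ (bD 1%N 1%N isT isT)) ?orbT // mul1n.
- by rewrite expn_gt0.
- exact: hD2.
- apply: leq_trans (n0D 22 4608 isT isT).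
  have h1 : (d.+1 ^ 7 <= (2 * d) ^ 7)%N by rewrite leq_exp2r // mul2n -addnn -addn1 leq_add2l.
  have h2 : ((2 * d ^ 15).+1 <= 3 * d ^ 15)%N.
    by rewrite -addn1 [(3 * _)%N]mulSn addnC leq_add2r expn_gt0 d0.
  apply: (@leq_trans (12 * n0 * (2 * d) ^ 7 * (3 * d ^ 15))%N).
    by rewrite leq_mul // leq_mul2l h1 orbT.
  by rewrite expnMn [X in (_ <= _ * X)%N](expnD d 7 15) eq_leq //; ring.
- apply: (@leq_trans (2 ^ r * 2 ^ r)%N); last by rewrite -expnD leq_pexp2l.
  rewrite -mulnA leq_mul2l; apply/orP; right; apply: leq_trans (bD 18 36 isT isT).
  have -> : (d * (4 * d ^ 8) = 4 * d ^ 9)%N by rewrite (expnS d 8); ring.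
  rewrite -(expnS d 8).
  have h1 : ((8 * d ^ 9).+1 <= 9 * d ^ 9)%N.
    by rewrite -addn1 [(9 * _)%N]mulSn addnC leq_add2r expn_gt0 d0.
  apply: (@leq_trans (9 * d ^ 9 * (4 * d ^ 9))%N); first by rewrite leq_mul.
  by rewrite (expnD d 9 9) eq_leq //; ring.
apply: (@leq_trans (2 * n0 * d ^ 1)%N).
  by rewrite expn1 -mulnA mul2n -addnn -[X in (X < _)%N]addn0 ltn_add2l muln_gt0 n00.
apply: leq_trans (n0D 1%N 2%N isT isT) _; rewrite leq_pexp2l //.
exact: leq_trans (leq_addr r r) r2d.
Qed.

Local Open Scope classical_set_scope.

Theorem theorem2p6 (R : realType) (q : R) (hq : 0 < q <= 1) :
  exists c0 : R, forall c : R, c0 <= c ->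
    exists y C : R, [/\ 0 < y, 0 < C &
      mixed_prob (c / d%:R) q (@giant_event R d y C) @[d --> \oo] --> (1 : R)].
Proof.
exists (3 + 128 * 48 ^+ 3 / q ^+ 4) => c hc.
have [n0 [D [n00 hD]]] := mixed_prob_giant_eventually hq hc.
exists n0%:R^-1, 1; rewrite invr_gt0 ltr0n n00 ltr01; split=> //.
apply: (@squeeze_cvgr _ _ _ _ (fun d : nat => 1 - 7 * (1 / 2) ^+ d) (fun=> 1)).
- by near=> d; apply: hD; near: d; apply: nbhs_infty_ge.
- rewrite -[X in _ --> X]subr0 -[X in _ --> _ - X](mulr0 7).
  apply: cvgB; first exact: cvg_cst.
  by apply: cvgMl_tmp; apply: cvg_expr; rewrite ger0_norm; lra.
- exact: cvg_cst.
Unshelve. all: by end_near.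
Qed.
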